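(* Let $n\ge2$, $k\ge1$. The Loewner ellipsoid (minimum-volume ellipsoid containing) of $\overline{L\!f}$, as a convex body in the affine hyperplane $M$, is \[ \Big\{f\in M:\ \sum_{i=1}^{k}\left(\frac{(k-i)!\,\Gamma\!\left(\frac{2k+2i+n}{2}\right)}{k!\,\Gamma\!\left(\frac{2k+n}{2}\right)}\right)^{2}\|l_{2i}(f)\|^2\ \le\ D(n,2k)-1\Big\}, \] and the coefficient of symmetry of $\overline{L\!f}$ with respect to $r^{2k}$ is \[ \frac{1}{D(n,k)-1}=\frac{1}{\binom{n+k-1}{k}-1}. \]
   Context: $P_{n,d}$ is the space of real forms of degree $d$ in $n$ variables, $r^2=x_1^2+\dots+x_n^2$, $\sigma$ the rotation-invariant probability measure on $S^{n-1}$, $\langle f,g\rangle=\int_{S^{n-1}}fg\,d\sigma$, $\|f\|=\langle f,f\rangle^{1/2}$. $D(n,d)=\binom{n+d-1}{d}=\dim P_{n,d}$. $H_{n,d}=\{f\in P_{n,d}:\Delta f=0\}$ (harmonic forms), and $P_{n,2k}=\bigoplus_{i=0}^{k} r^{2k-2i}H_{n,2i}$ is an orthogonal decomposition; $l_{2i}(f)$ denotes the orthogonal projection of $f$ onto $r^{2k-2i}H_{n,2i}$. $M=\{f\in P_{n,2k}:\int f\,d\sigma=1\}$. $L\!f$ is the cone of finite sums of $2k$-th powers of real linear forms in $P_{n,2k}$, and $\overline{L\!f}=L\!f\cap M$. The coefficient of symmetry of a convex body $K$ about an interior point $v$ is the largest $\beta\in\mathbb R$ with $-\beta(K-v)\subseteq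 K-v$. *)

(* Defs.v *)
From HB Require Import structures.
From mathcomp Require Import all_boot all_order all_algebra.
From mathcomp Require Import all_classical all_reals all_analysis.
Unset Printing Implicit Defensive.
Import Order.TTheory GRing.Theory Num.Theory.
Import numFieldNormedType.Exports.
Local Open Scope classical_set_scope.
Local Open Scope ring_scope.

Section Forms.
Context {R : realType}.

Definition fn (n : nat) := 'rV[R]_n -> R.

Definition r2 (n : nat) (x : 'rV[R]_n) : R := \sum_(i < n) x ord0 i ^+ 2.

Definition rpow (n k : nat) : fn n := fun x => r2 n x ^+ k.

Definition is_form (n d : nat) (f : fn n) : Prop :=
  exists c : {ffun 'I_n -> 'I_d.+1} -> R,
    f = fun x => \sum_(a : {ffun 'I_n -> 'I_d.+1} | (\sum_(i < n) (a i : nat))%N == d)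
                   c a * \prod_(i < n) x ord0 i ^+ (a i).

Definition Ddim (n d : nat) : nat := 'C(n + d - 1, d).

Fixpoint iint (m : nat) (F : seq R -> R) : R :=
  match m with
  | 0%N => F [::]
  | m'.+1 => Rintegral (@lebesgue_measure R) `[(-1)%R, 1%R]%classic
               (fun t => iint m' (fun s => F (t :: s)))
  end.

Definition row_of_seq (n : nat) (s : seq R) : 'rV[R]_n := \row_(i < n) nth 0 s i.

Definition ball_int (n : nat) (F : fn n) : R :=
  iint n (fun s => let x := row_of_seq n s in if r2 n x <= 1 then F x else 0).

(* sigma: the rotation-invariant probability measure on S^{n-1}, realised as the
   push-forward of normalised Lebesgue measure on the unit ball under x |-> x/|x|.
   sph_int g = \int_{S^{n-1}} g dsigma. *)
Definition sph_int (n : nat) (g : fn n) : R :=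
  ball_int n (fun x => g ((Num.sqrt (r2 n x))^-1 *: x)) / ball_int n (fun _ : 'rV[R]_n => 1).

Definition ip (n : nat) (f g : fn n) : R := sph_int n (fun x => f x * g x).
Definition nrm (n : nat) (f : fn n) : R := Num.sqrt (ip n f f).

Definition ebasis (n : nat) (j : 'I_n) : 'rV[R]_n := delta_mx ord0 j.
Definition laplacian (n : nat) (f : fn n) : fn n :=
  fun x => \sum_(j < n) derive (fun y => derive f y (ebasis n j)) x (ebasis n j).

Definition harmonic_form (n d : nat) (h : fn n) : Prop :=
  is_form n d h /\ forall x, laplacian n h x = 0.

Definition rH (n k i : nat) : set (fn n) :=
  [set f | exists h, harmonic_form n (2 * i) h /\ f = fun x => r2 n x ^+ (k - i) * h x].

Definition oproj (n : nat) (W : set (fn n)) (f : fn n) : fn n :=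
  xget (fun _ => 0) [set g | W g /\ forall w, W w -> ip n (fun x => f x - g x) w = 0].

Definition l2i (n k i : nat) (f : fn n) : fn n := oproj n (rH n k i) f.

Definition Mset (n k : nat) : set (fn n) :=
  [set f | is_form n (2 * k) f /\ sph_int n f = 1].
Definition M0set (n k : nat) : set (fn n) :=
  [set f | is_form n (2 * k) f /\ sph_int n f = 0].

Definition Lf (n k : nat) : set (fn n) :=
  [set f | exists (N : nat) (a : 'I_N -> 'rV[R]_n),
     f = fun x : 'rV[R]_n => \sum_(j < N) (\sum_(i < n) a j ord0 i * x ord0 i) ^+ (2 * k)].
Definition Lfbar (n k : nat) : set (fn n) := Lf n k `&` Mset n k.

(* ellipsoids in M: { c + sum_j t_j v_j : sum_j t_j^2 <= 1 }, with c in M,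
   v_j in M_0; its (D(n,2k)-1)-dim. volume w.r.t. <,> is
   (vol of unit ball) * sqrt(det Gram(v)). *)
Definition ellipsoid (n m : nat) (c : fn n) (v : 'I_m -> fn n) : set (fn n) :=
  [set f | exists t : 'I_m -> R, \sum_(j < m) t j ^+ 2 <= 1 /\
                                 f = fun x : 'rV[R]_n => c x + \sum_(j < m) t j * v j x].
Definition gram (n m : nat) (v : 'I_m -> fn n) : 'M[R]_m := \matrix_(i, j) ip n (v i) (v j).

Definition is_ellipsoid_in_M (n k : nat) (c : fn n) (v : 'I_(Ddim n (2 * k) - 1) -> fn n) :=
  Mset n k c /\ (forall j, M0set n k (v j)) /\ 0 < \det (gram n _ v).

Definition loewner_ellipsoid (n k : nat) (K E : set (fn n)) : Prop :=
  exists c v, is_ellipsoid_in_M n k c v /\ E = ellipsoid n _ c v /\ K `<=` E /\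
    forall c' v', is_ellipsoid_in_M n k c' v' -> K `<=` ellipsoid n _ c' v' ->
      \det (gram n _ v) <= \det (gram n _ v').

Definition sym_ok (n : nat) (K : set (fn n)) (v : fn n) (b : R) : Prop :=
  forall f, K f -> K (fun x => v x - b * (f x - v x)).
Definition coeff_symmetry (n : nat) (K : set (fn n)) (v : fn n) (b : R) : Prop :=
  sym_ok n K v b /\ forall b', sym_ok n K v b' -> b' <= b.

Definition Gamma (x : R) : R :=
  Rintegral (@lebesgue_measure R) `]0%R, +oo[%classic (fun t => powR t (x - 1) * expR (- t)).

Definition lcoef (n k i : nat) : R :=
  ((k - i)`!%:R * Gamma ((2 * k + 2 * i + n)%:R / 2) /
   (k`!%:R * Gamma ((2 * k + n)%:R / 2))) ^+ 2.

Definition loewner_target (n k : nat) : set (fn n) :=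
  [set f | Mset n k f /\
    \sum_(1 <= i < k.+1) lcoef n k i * nrm n (l2i n k i f) ^+ 2 <= (Ddim n (2 * k))%:R - 1].

End Forms.

(* Main.v *)
(* Let T f (x) = int (x.v)^(2k) f(v) dsigma(v), scaled so that T r^(2k) = r^(2k). It is
   self-adjoint, acts as a scalar on each r^(2k-2i) H_(n,2i) (the Gamma quotients of the statement
   are the inverses of these scalars), and maps the reproducing kernel at v, v on the sphere, to the
   normalised power u_v of the linear form (v.x).

   Loewner ellipsoid. The reproducing kernel at v has squared norm D(n,2k), so T^-1 maps the convex
   hull of the u_v into the ball of squared radius D(n,2k): this is the containment. If another
   ellipsoid, with axes of coordinate matrix B, contains all u_v, integrating its inequality over
   the sphere bounds the Hilbert-Schmidt norm of B^-1 T by 1, and the inequality of the arithmetic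
   and geometric means then bounds det B from below.

   Coefficient of symmetry. By conic duality the reflected body lies in L f iff G(v) <= D(n,k) int G
   for every form G >= 0 of degree 2k and every v on the sphere. Averaging G over the rotations
   fixing v gives a nonnegative binary form, hence a sum of squares, and a square q^2 satisfies
   q(v)^2 <= D(n,k) int q^2, with equality for the reproducing kernel at v in degree k. *)

(* The measure sigma is given only as an iterated Lebesgue integral over the ball, so neither polar
   coordinates nor rotation invariance comes for free. One identity is extracted from that
   definition, integration by parts on the sphere ([sph_ibp]): the weight 1 - |x|^2 kills the
   boundary terms along each coordinate, and homogeneity turns ball integrals into spherical ones.
   The later analysis on the sphere is algebra on forms, mostly by induction on the degree: the
   Laplacian determines the mean, hence rotation invariance; then come definiteness of the inner
   product and the scalars of T. The harmonic components are orthogonal as eigenspaces of T, because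
   the scalars decrease strictly. The average over the rotations fixing v also avoids a group
   integral: G is sliced by powers of one coordinate, and each slice is replaced by its mean times a
   power of the radius. Conic duality needs a nearest point in the cone of powers. It is sought
   among sums of D(n,2k) + 1 powers; a linear dependence then frees one slot, which suffices to test
   every further power. *)
Require Import Defs.
From HB Require Import structures.
From mathcomp Require Import all_boot all_order all_algebra.
From mathcomp Require Import all_classical all_reals all_analysis.
From mathcomp Require Import measurable_realfun.
From mathcomp Require Import ring lra zify.
From mathcomp Require polyrcf.
Import Order.TTheory GRing.Theory Num.Theory.
Import numFieldNormedType.Exports.
Set Implicit Arguments.
Unset Strict Implicit.
Unset Printing Implicit Defensive.
Local Open Scope classical_set_scope.
Local Open Scope ring_scope.


(** * Iterated integrals over the cube *)

Lemma eq_ler (R : numDomainType) (x y : R) : x = y -> x <= y.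
Proof. by move=> ->. Qed.

Section UnitInterval.
Context {R : realType}.
Notation mu := (@lebesgue_measure R).
Notation D := (`[(-1)%R, 1%R]%classic : set R).

Lemma bounded_integrable (A : set R) (f : R -> R) (M : R) :
  measurable A -> (mu A < +oo)%E -> measurable_fun setT f ->
  (forall x, `|f x| <= M) -> mu.-integrable A (EFin \o f).
Proof.
move=> mA muA mf fM; apply: measurable_bounded_integrable => //.
  exact: measurable_funS mf.
exists M; split; first exact: num_real.
by move=> x Mx y _; apply: le_trans (fM y) (ltW _).
Qed.

Lemma unit_itv_measure : mu D = 2%:E.
Proof.
have := @lebesgue_measure_itv R `[-1, 1].
by rewrite /= lte_fin ifT ?(lt_trans (ltrN10 _) ltr01) //= -EFinB opprK => ->.
Qed.

Lemma unit_itv_integrable (f : R -> R) (M : R) :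
  measurable_fun setT f -> (forall x, `|f x| <= M) -> mu.-integrable D (EFin \o f).
Proof.
move=> mf fM; apply: (@bounded_integrable _ _ M) => //.
by have : (mu D < +oo)%E by rewrite unit_itv_measure ltry.
Qed.

Lemma unit_itv_norm_le (f : R -> R) (M : R) :
  measurable_fun setT f -> (forall x, `|f x| <= M) ->
  `|Rintegral mu D f| <= 2 * M.
Proof.
move=> mf fM; apply: le_trans (le_normr_Rintegral _ _) _ => //.
  exact: unit_itv_integrable fM.
have -> : 2 * M = Rintegral mu D (fun=> M).
  transitivity (M * fine (mu D)); first by rewrite unit_itv_measure mulrC.
  by rewrite -Rintegral_cst.
apply: le_Rintegral => //.
- apply: (@unit_itv_integrable _ M) => [|x]; last by rewrite normr_id.
  exact: measurableT_comp.
- apply: (@unit_itv_integrable _ `|M|) => [|x //]; exact: measurable_cst.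
Qed.

(** After cutting off by the indicator of the interval, the positive and negative parts are
    measurable in [t] by Tonelli; their difference is the integral. *)
Lemma unit_itv_measurable d (T : measurableType d) (f : T * R -> R) :
  measurable_fun setT f ->
  measurable_fun setT (fun t => Rintegral mu D (fun x => f (t, x))).
Proof.
move=> mf; rewrite /Rintegral.
pose F (t : T) : \bar R := (\int[mu]_(x in D) (f (t, x))%:E)%E.
suff mF : measurable_fun setT F.
  exact: measurableT_comp mF.
pose g (p : T * R) := (f p * \1_D p.2)%:E.
have mg : measurable_fun setT g.
  apply/measurable_EFinP; apply: measurable_funM => //.
  by apply: (measurableT_comp (measurable_indic _) measurable_snd).
pose Fp (t : T) : \bar R := (\int[mu]_x (g^\+ (t, x)))%E.
pose Fn (t : T) : \bar R := (\int[mu]_x (g^\- (t, x)))%E.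
have -> : F = (Fp \- Fn)%E.
  apply/funext => t; rewrite /F integral_mkcond.
  transitivity (\int[mu]_x g (t, x))%E.
    apply: eq_integral => x _; rewrite /g /patch /= indicE.
    by case: ifP => _; rewrite ?mulr1 ?mulr0.
  rewrite [LHS]integralE /Fp /Fn.
  under eq_integral do rewrite funepos_comp/=.
  by under [X in (_ - X = _)%E]eq_integral do rewrite funeneg_comp/=.
apply: emeasurable_funB.
  by apply: (@measurable_fun_fubini_tonelli_F _ _ _ _ _ mu) => //; exact: measurable_funepos.
by apply: (@measurable_fun_fubini_tonelli_F _ _ _ _ _ mu) => //; exact: measurable_funeneg.
Qed.

Lemma unit_itv_mkcond (f : R -> R) (M : R) :
  measurable_fun setT f -> (forall x, `|f x| <= M) ->
  (\int[mu]_x (f x * \1_D x)%:E)%E = (Rintegral mu D f)%:E.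
Proof.
move=> mf fM; rewrite /Rintegral fineK; last first.
  by apply: integrable_fin_num => //; exact: unit_itv_integrable fM.
rewrite [RHS]integral_mkcond; apply: eq_integral => x _.
by rewrite /patch /= indicE; case: ifP => _; rewrite ?mulr1 ?mulr0.
Qed.

Lemma unit_itv_Fubini (f : R * R -> R) (M : R) :
  measurable_fun setT f -> (forall p, `|f p| <= M) ->
  Rintegral mu D (fun x => Rintegral mu D (fun y => f (x, y))) =
  Rintegral mu D (fun y => Rintegral mu D (fun x => f (x, y))).
Proof.
move=> mf fM.
have mf' : measurable_fun setT (fun p : R * R => f (p.2, p.1)).
  apply: measurableT_comp => //.
  by apply/measurable_fun_pairP; split; [exact: measurable_snd|exact: measurable_fst].
have mfx x : measurable_fun setT (fun y => f (x, y)).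
  by apply: measurableT_comp => //; exact: pair1_measurable.
have mfy y : measurable_fun setT (fun x => f (x, y)).
  by apply: measurableT_comp => //; exact: pair2_measurable.
(* Cutting off by the indicator of the square turns the integrals over the interval into integrals
   over the line, to which Fubini applies. *)
pose g (p : R * R) := (f p * \1_D p.2 * \1_D p.1)%:E.
have mg : measurable_fun setT g.
  apply/measurable_EFinP; apply: measurable_funM => //; first apply: measurable_funM => //.
    by exact: measurableT_comp (measurable_indic _) measurable_snd.
  by exact: measurableT_comp (measurable_indic _) measurable_fst.
have inner x : (\int[mu]_y g (x, y) = (Rintegral mu D (fun y => f (x, y)) * \1_D x)%:E)%E.
  rewrite -RintegralZr //; last exact: unit_itv_integrable (mfx x) (fun y => fM (x, y)).
  rewrite -(@unit_itv_mkcond _ M) //.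
  - by apply: eq_integral => y _; congr EFin; rewrite /g mulrAC.
  - by apply: measurable_funM => //; exact: measurable_cst.
  - move=> y; rewrite normrM indicE; case: (x \in _); rewrite ?normr1 ?normr0 ?mulr1 ?mulr0 //.
    exact: le_trans (fM (x, y)).
have inner2 y : (\int[mu]_x g (x, y) = (Rintegral mu D (fun x => f (x, y)) * \1_D y)%:E)%E.
  rewrite -RintegralZr //; last exact: unit_itv_integrable (mfy y) (fun x => fM (x, y)).
  rewrite -(@unit_itv_mkcond _ M) //.
  - by apply: measurable_funM => //; exact: measurable_cst.
  - move=> x; rewrite normrM indicE; case: (y \in _); rewrite ?normr1 ?normr0 ?mulr1 ?mulr0 //.
    exact: le_trans (fM (x, y)).
have ig : (mu \x mu)%E.-integrable setT g.
  apply/integrable12ltyP => //.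
  rewrite (_ : (fun x => _) = fun x => (Rintegral mu D (fun y => `|f (x, y)|) * \1_D x)%:E); last first.
    apply/funext => x.
    rewrite -RintegralZr //; last first.
      apply: (@unit_itv_integrable _ M) => [|y]; last by rewrite normr_id.
      exact: measurableT_comp.
    rewrite -(@unit_itv_mkcond _ M) //.
    + apply: eq_integral => y _; congr EFin; rewrite /g !normrM mulrAC; congr (_ * _ * _).
        by rewrite ger0_norm // indicE.
      by rewrite ger0_norm // indicE.
    + by apply: measurable_funM => //; exact: measurableT_comp.
    + move=> y; rewrite normrM normr_id indicE; case: (x \in _); rewrite ?normr1 ?normr0 ?mulr1 ?mulr0 //.
      exact: le_trans (fM (x, y)).
  have mA : measurable_fun setT (fun x => Rintegral mu D (fun y => `|f (x, y)|)).
    by apply: (@unit_itv_measurable _ _ (fun p => `|f p|)); exact: measurableT_comp.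
  have bA x : `|Rintegral mu D (fun y => `|f (x, y)|)| <= 2 * M.
    apply: unit_itv_norm_le => [|y]; last by rewrite normr_id.
    exact: measurableT_comp.
  by rewrite (unit_itv_mkcond mA bA) ltry.
have := Fubini ig.
under eq_integral do rewrite inner.
under [X in _ = X -> _]eq_integral do rewrite inner2.
rewrite (unit_itv_mkcond (unit_itv_measurable mf) (fun x => unit_itv_norm_le (mfx x) (fun y => fM (x, y)))).
rewrite (unit_itv_mkcond (unit_itv_measurable mf') (fun y => unit_itv_norm_le (mfy y) (fun x => fM (x, y)))).
by case.
Qed.

(** The image of Lebesgue measure under division by [s] is [s] times Lebesgue measure. This follows
    from uniqueness: [mn], the image divided by [s], gives half-open intervals their length. *)
Lemma ge0_integral_scale (f : R -> \bar R) (s : R) : 0 < s -> measurable_fun setT f ->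
  (forall x, 0 <= f x)%E ->
  (\int[mu]_x f ((x : R) / s)%R = s%:E * \int[mu]_x f x)%E.
Proof.
move=> s0 mf f0.
pose phi (x : measurableTypeR R) : measurableTypeR R := (x : R) / s.
have mphi : measurable_fun setT phi by exact: mulrr_measurable.
rewrite -[LHS]/(\int[mu]_(x in phi @^-1` setT) (f \o phi) x)%E.
rewrite -ge0_integral_pushforward //.
rewrite -[RHS]/((NngNum (ltW s0))%:num%:E * \int[mu]_x f x)%E -ge0_integral_mscale //.
apply: eq_measure_integral => A mA _.
pose sV := NngNum (ltW (etrans (invr_gt0 s) s0)).
pose mn := mscale sV (measure_function_pushforward__canonical__measure_function_Measure mu mphi).
have muE : mu A = mn A.
  apply: lebesgue_measure_unique => // X [[a b] _ <-] /=.
  rewrite /mn /mscale /=.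
  have -> : pushforward mu phi `]a, b]%classic = mu `]a * s, b * s]%classic.
    congr (lebesgue_measure _); apply/seteqP; split => x; rewrite /phi /= !in_itv /=;
    by rewrite ltr_pdivlMr // ler_pdivrMr.
  have -> : mu `]a * s, b * s]%classic = (if (a < b)%R then ((b - a) * s)%:E else 0%E).
    have := @lebesgue_measure_itv R `]a * s, b * s].
    by rewrite /= lte_fin ltr_pM2r // => ->; case: ifP => // _; rewrite -EFinB mulrBl.
  have -> : mu `]a, b]%classic = (if (a < b)%R then (b - a)%:E else 0%E).
    have := @lebesgue_measure_itv R `]a, b].
    by rewrite /= lte_fin => ->; case: ifP.
  by case: ifPn; rewrite ?mule0 // -EFinM mulrCA mulVf ?mulr1 ?gt_eqF.
suff : pushforward mu phi A = (s%:E * mu A)%E by [].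
by rewrite muE /mn /mscale /= muleA -EFinM divff ?mul1e ?gt_eqF.
Qed.

(** Since [s <= 1], both [f] and its contraction vanish off the interval, so both integrals may be
    taken over the line, where scaling is available. *)
Lemma unit_itv_scale (f : R -> R) (s M : R) : 0 < s <= 1 -> measurable_fun setT f ->
  (forall x, `|f x| <= M) -> (forall x, 1 < `|x| -> f x = 0) ->
  Rintegral mu D (fun x => f (x / s)) = s * Rintegral mu D f.
Proof.
move=> /andP[s0 s1] mf fM f0.
have mphi : measurable_fun setT (fun x : R => x / s) by exact: mulrr_measurable.
have supp (g : R -> R) : measurable_fun setT g -> (forall x, `|g x| <= M) -> (forall x, 1 < `|x| -> g x = 0) -> 
    (\int[mu]_x (g x)%:E)%E = (Rintegral mu D g)%:E.
  move=> mg gM g0; rewrite -(unit_itv_mkcond mg gM); apply: eq_integral => x _.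
  rewrite indicE; case: (boolP (_ \in _)); rewrite ?mulr1 // notin_setE /= in_itv /= => /negP.
  by rewrite -ler_norml -ltNge => /g0 ->; rewrite mul0r.
apply: EFin_inj; rewrite EFinM -!supp //; last 2 first.
- exact: measurableT_comp.
- by move=> x x1; apply: f0; rewrite normrM normfV (gtr0_norm s0) ltr_pdivlMr // mul1r; apply: le_lt_trans x1.
rewrite [LHS]integralE [in RHS]integralE.
pose F := EFin \o f.
have mF : measurable_fun setT F by exact/measurable_EFinP.
have iF : mu.-integrable setT F.
  have : mu.-integrable setT (F \_ D).
    by apply: (iffLR (integrable_mkcond _ _)) => //; exact: unit_itv_integrable mf fM.
  congr (integrable _ _); apply/funext => x; rewrite /patch; case: (boolP (_ \in _)) => //.
  by rewrite notin_setE /= in_itv /= => /negP; rewrite -ler_norml -ltNge /F /= => /f0 ->.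
rewrite muleBr //; last by apply: integrable_add_def.
rewrite -(ge0_integral_scale (f := F^\+)%E) //; last exact: measurable_funepos.
rewrite -(ge0_integral_scale (f := F^\-)%E) //; last exact: measurable_funeneg.
by congr (_ - _)%E; apply: eq_integral => x _; rewrite ?funeposE ?funenegE.
Qed.

End UnitInterval.

(** * Joint measurability and iterated integrals in several variables *)

Section MultiMeasurable.
Context {R : realType}.
Notation mu := (@lebesgue_measure R).
Notation D := (`[(-1)%R, 1%R]%classic : set R).

(* [F t s] is jointly measurable in [t] and the first [m] entries of [s]. *)
Fixpoint smfun (m : nat) : forall d (T : measurableType d), (T -> seq R -> R) -> Prop :=
  match m with
  | 0%N => fun d T F => measurable_fun setT (fun t => F t [::])
  | m'.+1 => fun d T F => @smfun m' _ (T * R)%type (fun p s => F p.1 (p.2 :: s))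
  end.

Lemma smfun_map2 (op : R -> R -> R) m d (T : measurableType d) (F G : T -> seq R -> R) :
  measurable_fun setT (fun p : R * R => op p.1 p.2) ->
  smfun m F -> smfun m G -> smfun m (fun t s => op (F t s) (G t s)).
Proof.
move=> mop; elim: m d T F G => [|m IH] d T F G /= mF mG; last exact: IH.
exact: (measurableT_comp mop (measurable_fun_pair mF mG)).
Qed.

Lemma smfun_map (g : R -> R) m d (T : measurableType d) (F : T -> seq R -> R) :
  measurable_fun setT g -> smfun m F -> smfun m (fun t s => g (F t s)).
Proof.
move=> mg; elim: m d T F => [|m IH] d T F /= mF; last exact: IH.
exact: measurableT_comp.
Qed.

Lemma smfun_param (m : nat) d (T : measurableType d) (u : T -> R) :
  measurable_fun setT u -> smfun m (fun t _ => u t).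
Proof.
elim: m d T u => [//|m IH] d T u /= mu.
apply: (IH _ _ (fun p => u p.1)).
exact: measurableT_comp.
Qed.

Lemma smfun_cst (m : nat) d (T : measurableType d) (c : R) :
  smfun m (fun (_ : T) _ => c).
Proof. by apply: (@smfun_param m d T (fun=> c)). Qed.

Lemma smfun_nth (m : nat) d (T : measurableType d) i : smfun m (fun (_ : T) s => nth 0 s i).
Proof.
elim: m d T i => [|m IH] d T [|i] /=; do ?exact: measurable_cst.
  by apply: (@smfun_param m _ (T * R)%type snd); exact: measurable_snd.
exact: IH.
Qed.

Lemma smfun_reparam (m : nat) d (T : measurableType d) d' (T' : measurableType d')
    (u : T' -> T) (F : T -> seq R -> R) :
  measurable_fun setT u -> smfun m F -> smfun m (fun t s => F (u t) s).
Proof.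
elim: m d T d' T' u F => [|m IH] d T d' T' u F mu /= mF.
  exact: (measurableT_comp (f := fun t => F t [::])).
apply: (IH _ (T * R)%type _ _ (fun p : T' * R => (u p.1, p.2)) _ _ mF).
apply: measurable_fun_pair => //.
exact: measurableT_comp.
Qed.

Lemma smfunD m d (T : measurableType d) (F G : T -> seq R -> R) :
  smfun m F -> smfun m G -> smfun m (fun t s => F t s + G t s).
Proof.
apply: (smfun_map2 (op := fun x y => x + y)).
by apply: measurable_funD; [exact: measurable_fst | exact: measurable_snd].
Qed.

Lemma smfunM m d (T : measurableType d) (F G : T -> seq R -> R) :
  smfun m F -> smfun m G -> smfun m (fun t s => F t s * G t s).
Proof.
apply: (smfun_map2 (op := fun x y => x * y)).
by apply: measurable_funM; [exact: measurable_fst | exact: measurable_snd].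
Qed.

Lemma smfun_sum m d (T : measurableType d) I (r : seq I) (F : I -> T -> seq R -> R) :
  (forall i, smfun m (F i)) -> smfun m (fun t s => \sum_(i <- r) F i t s).
Proof.
move=> mF; elim: r => [|i r IH].
  have -> : (fun t s => \sum_(i <- [::]) F i t s) = (fun _ _ => 0).
    by apply/funext => t; apply/funext => s; rewrite big_nil.
  exact: smfun_cst.
have -> : (fun t s => \sum_(j <- i :: r) F j t s) = (fun t s => F i t s + \sum_(j <- r) F j t s).
  by apply/funext => t; apply/funext => s; rewrite big_cons.
exact: smfunD.
Qed.

Lemma smfun_if_le m d (T : measurableType d) (F G H : T -> seq R -> R) :
  smfun m F -> smfun m G -> smfun m H ->
  smfun m (fun t s => if F t s <= G t s then H t s else 0).
Proof.
move=> mF mG mH.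
have -> : (fun t s => if F t s <= G t s then H t s else 0) =
    (fun t s => (fun x y : R => (x <= y)%R%:R : R) (F t s) (G t s) * H t s).
  by apply/funext => t; apply/funext => s; case: ifP; rewrite ?mul1r ?mul0r.
apply: smfunM => //; apply: (smfun_map2 (op := fun x y : R => (x <= y)%R%:R)) => //.
apply: (measurableT_comp (f := fun b : bool => (b%:R : R))) => //.
by apply: measurable_fun_ler; [exact: measurable_fst | exact: measurable_snd].
Qed.

(** The parameter [t] makes the induction possible: at each step the head of the list joins the
    parameter space. The bound is carried along because integrability of the sections is deduced
    from it. *)
Lemma iint_measurable m d (T : measurableType d) (F : T -> seq R -> R) (M : R) :
  smfun m F -> (forall t s, `|F t s| <= M) ->
  measurable_fun setT (fun t => iint m (F t)) /\ forall t, `|iint m (F t)| <= 2 ^+ m * M.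
Proof.
elim: m d T F => [|m IH] d T F /= mF FM; first by split=> // t; rewrite mul1r.
have [mI bI] := IH _ _ _ mF (fun p s => FM p.1 (p.2 :: s)).
split; first exact: (unit_itv_measurable mI).
move=> t; rewrite exprS -mulrA; apply: unit_itv_norm_le => [|x]; last exact: (bI (t, x)).
exact: (measurableT_comp (f := fun p : T * R => iint m (fun s => F p.1 (p.2 :: s))) mI (pair1_measurable t)).
Qed.

Lemma iint_section_measurable m d (T : measurableType d) (F : T -> seq R -> R) (M : R) t :
  smfun m.+1 F -> (forall t s, `|F t s| <= M) ->
  measurable_fun setT (fun x => iint m (fun s => F t (x :: s))) /\
  (forall x, `|iint m (fun s => F t (x :: s))| <= 2 ^+ m * M).
Proof.
move=> mF FM.
have [mI bI] := iint_measurable (mF : smfun m _) (fun p s => FM p.1 (p.2 :: s)).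
split; last by move=> x; exact: (bI (t, x)).
exact: (measurableT_comp (f := fun p : T * R => iint m (fun s => F p.1 (p.2 :: s))) mI (pair1_measurable t)).
Qed.

Lemma iint_eq m (F G : seq R -> R) :
  (forall s, size s = m -> F s = G s) -> iint m F = iint m G.
Proof.
elim: m F G => [|m IH] F G FG /=; first exact: FG.
by apply: eq_Rintegral => x _; apply: IH => s sm; apply: FG; rewrite /= sm.
Qed.

Lemma iint0 m : iint m (fun=> 0) = 0 :> R.
Proof.
elim: m => [//|m IH] /=; under eq_Rintegral do rewrite IH.
by rewrite Rintegral_cst // mul0r.
Qed.

Lemma iint_ge0 m (F : seq R -> R) : (forall s, 0 <= F s) -> 0 <= iint m F.
Proof.
elim: m F => [|m IH] F F0 /=; first exact: F0.
by apply: Rintegral_ge0 => x _; apply: IH.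
Qed.

Lemma iintD m d (T : measurableType d) (F G : T -> seq R -> R) (M N : R) t :
  smfun m F -> smfun m G -> (forall t s, `|F t s| <= M) -> (forall t s, `|G t s| <= N) ->
  iint m (fun s => F t s + G t s) = iint m (F t) + iint m (G t).
Proof.
elim: m d T F G t => [//|m IH] d T F G t mF mG FM GN /=.
have [mF1 bF1] := iint_section_measurable t mF FM.
have [mG1 bG1] := iint_section_measurable t mG GN.
rewrite -RintegralD //; last 2 first.
- exact: unit_itv_integrable bF1.
- exact: unit_itv_integrable bG1.
apply: eq_Rintegral => x _.
exact: (IH _ _ (fun p s => F p.1 (p.2 :: s)) (fun p s => G p.1 (p.2 :: s)) (t, x) mF mG (fun p s => FM p.1 (p.2 :: s)) (fun p s => GN p.1 (p.2 :: s))).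
Qed.

Lemma iintZ m d (T : measurableType d) (F : T -> seq R -> R) (M c : R) t :
  smfun m F -> (forall t s, `|F t s| <= M) ->
  iint m (fun s => c * F t s) = c * iint m (F t).
Proof.
elim: m d T F t => [//|m IH] d T F t mF FM /=.
have [mF1 bF1] := iint_section_measurable t mF FM.
rewrite -RintegralZl //; last exact: unit_itv_integrable bF1.
apply: eq_Rintegral => x _.
exact: (IH _ _ (fun p s => F p.1 (p.2 :: s)) (t, x) mF (fun p s => FM p.1 (p.2 :: s))).
Qed.

(** The support condition is imposed on each entry separately so that the one-variable scaling
    applies at every level of the iterated integral. *)
Lemma iint_scale m d (T : measurableType d) (F : T -> seq R -> R) (M s : R) t :
  0 < s <= 1 -> smfun m F -> (forall t xs, `|F t xs| <= M) ->
  (forall xs, size xs = m -> has (fun x => 1 < `|x|) xs -> F t xs = 0) ->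
  iint m (fun xs => F t [seq x / s | x <- xs]) = s ^+ m * iint m (F t).
Proof.
move=> s01; elim: m d T F t => [|m IH] d T F t mF FM F0 /=; first by rewrite mul1r.
have [mF1 bF1] := iint_section_measurable t mF FM.
rewrite exprSr -mulrA -(unit_itv_scale s01 mF1 bF1); last first.
  move=> x x1; rewrite -[RHS](iint0 m); apply: iint_eq => xs sm.
  by rewrite F0 //= ?sm // x1.
rewrite -RintegralZl //; last first.
  apply: (@unit_itv_integrable _ _ (2 ^+ m * M)) => [|x]; last exact: bF1.
  exact: (measurableT_comp mF1 (mulrr_measurable _)).
apply: eq_Rintegral => x _.
apply: (IH _ _ (fun p s => F p.1 (p.2 :: s)) (t, x / s) mF (fun p s => FM p.1 (p.2 :: s))).
by move=> xs sm h; apply: F0; rewrite /= ?sm // h orbT.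
Qed.

Lemma iint_swap m d (T : measurableType d) (F : T * R -> seq R -> R) (M : R) t :
  smfun m F -> (forall t xs, `|F t xs| <= M) ->
  iint m (fun s => Rintegral mu D (fun y => F (t, y) s)) =
  Rintegral mu D (fun y => iint m (F (t, y))).
Proof.
elim: m d T F t => [//|m IH] d T F t mF FM /=.
pose F' (p : T * R * R) s := F (p.1.1, p.2) (p.1.2 :: s).
have mF' : smfun m F'.
  apply: (smfun_reparam (u := fun p : T * R * R => ((p.1.1, p.2), p.1.2)) _ (mF : smfun m _)).
  apply: measurable_fun_pair; first apply: measurable_fun_pair.
  - exact: (measurableT_comp measurable_fst measurable_fst).
  - exact: measurable_snd.
  - exact: (measurableT_comp measurable_snd measurable_fst).
transitivity (Rintegral mu D (fun x => Rintegral mu D (fun y => iint m (F' (t, x, y))))).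
  by apply: eq_Rintegral => x _; exact: (IH _ _ F' (t, x) mF' (fun p s => FM _ _)).
have [mI bI] := iint_measurable mF' (fun p s => FM (p.1.1, p.2) (p.1.2 :: s)).
apply: (@unit_itv_Fubini _ (fun p => iint m (F' (t, p.1, p.2))) (2 ^+ m * M)); last by move=> p; exact: bI.
apply: (measurableT_comp (f := fun p => iint m (F' p)) mI).
apply: measurable_fun_pair; last exact: measurable_snd.
exact: (measurableT_comp (pair1_measurable t) measurable_fst).
Qed.

(** Makes coordinate [j] the innermost variable, so that one-dimensional calculus can be done in an
    arbitrary direction. *)
Lemma iint_insert m j d (T : measurableType d) (F : T -> seq R -> R) (M : R) t : (j <= m)%N ->
  smfun m.+1 F -> (forall t xs, `|F t xs| <= M) ->
  iint m.+1 (F t) =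
  iint m (fun s => Rintegral mu D (fun y => F t (take j s ++ y :: drop j s))).
Proof.
elim: j m d T F t => [|j IH] m d T F t jm mF FM.
  rewrite -[LHS](@iint_swap m d T (fun p s => F p.1 (p.2 :: s)) M) //.
  by apply: iint_eq => s _; apply: eq_Rintegral => y _; rewrite take0 drop0.
case: m jm mF => // m jm mF.
rewrite [LHS]/= [RHS]/=; apply: eq_Rintegral => x _.
exact: (IH m _ _ (fun p s => F p.1 (p.2 :: s)) (t, x) jm mF (fun p s => FM _ _)).
Qed.

End MultiMeasurable.

(** * Forms and their partial derivatives *)

Section FormCalculus.
Context {R : realType}.

(* Real forms of degree [d]; the zero form has every degree. *)
Inductive hform (n : nat) : nat -> @fn R n -> Prop :=
| hform0 d : hform d (fun=> 0)
| hformC c : hform 0 (fun=> c)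
| hformX d j f : hform d f -> hform d.+1 (fun x : 'rV[R]_n => x ord0 j * f x)
| hformD d f g : hform d f -> hform d g -> hform d (fun x : 'rV[R]_n => f x + g x).

Definition pd (n : nat) (j : 'I_n) (f : @fn R n) : @fn R n := fun x => 'D_(ebasis n j) f x.

Lemma derivable_coord n (i : 'I_n) (x v : 'rV[R]_n) :
  derivable (fun y : 'rV[R]_n => y ord0 i) x v.
Proof. by apply: diff_derivable; exact: differentiable_coord. Qed.

Lemma pd_coord n (i j : 'I_n) (x : 'rV[R]_n) :
  pd j (fun y => y ord0 i) x = (i == j)%:R.
Proof.
rewrite /pd /derive; apply: cvg_lim => //.
apply: (@cvg_near_cst _ _ ((i == j)%:R : R)).
near=> h; rewrite /= !mxE addrK eqxx /= [LHS]mulrA mulVf ?mul1r //.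
by near: h; exact: nbhs_dnbhs_neq.
Unshelve. all: by end_near. Qed.

Lemma hform_derivable n d f (x v : 'rV[R]_n) : hform d f -> derivable f x v.
Proof.
elim=> {d f} [d|c|d j f _ IH|d f g _ IHf _ IHg].
- exact: derivable_cst.
- exact: derivable_cst.
- by have := derivableM (@derivable_coord _ j x v) IH.
- exact: (derivableD IHf IHg).
Qed.

Lemma pd_cst n (j : 'I_n) c : pd j (fun=> c) = (fun=> 0).
Proof. by apply/funext => x; rewrite /pd derive_cst. Qed.

Lemma pdD n (j : 'I_n) d e f g : hform d f -> hform e g ->
  pd j (fun x => f x + g x) = (fun x => pd j f x + pd j g x).
Proof.
move=> hf hg; apply/funext => x; rewrite /pd.
by apply: (@deriveD _ _ _ f g); [exact: hform_derivable hf | exact: hform_derivable hg].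
Qed.

Lemma pdM n (j : 'I_n) d e f g : hform d f -> hform e g ->
  pd j (fun x => f x * g x) = (fun x => f x * pd j g x + g x * pd j f x).
Proof.
move=> hf hg; apply/funext => x; rewrite /pd.
by apply: (@deriveM _ _ f g); [exact: hform_derivable hf | exact: hform_derivable hg].
Qed.

Lemma hform_coord n (i : 'I_n) : hform 1 (fun x : 'rV[R]_n => x ord0 i).
Proof.
have -> : (fun x : 'rV[R]_n => x ord0 i) = (fun x => x ord0 i * 1).
  by apply/funext => x; rewrite mulr1.
by apply: hformX; exact: hformC.
Qed.

Lemma pdX n (j i : 'I_n) d f : hform d f ->
  pd j (fun x => x ord0 i * f x) = (fun x => x ord0 i * pd j f x + (i == j)%:R * f x).
Proof.
move=> hf; rewrite (pdM _ (hform_coord i) hf); apply/funext => x.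
by rewrite pd_coord [f x * _]mulrC.
Qed.

Lemma hform_const n f : hform (n := n) 0 f -> exists c, f = fun=> c.
Proof.
suff H d : hform (n := n) d f -> d = 0%N -> exists c, f = fun=> c by move/H; apply.
elim=> {d f} [d|c|//|d f g _ IHf _ IHg d0]; [by exists 0|by exists c|].
by have [[a ->] [b ->]] := (IHf d0, IHg d0); exists (a + b).
Qed.

Lemma hform_pd n (j : 'I_n) d f : hform d f -> hform d.-1 (pd j f).
Proof.
elim=> {d f} [d|c|d i f hf IH|d f g hf IHf hg IHg].
- by rewrite pd_cst; exact: hform0.
- by rewrite pd_cst; exact: hform0.
- rewrite (pdX _ _ hf) /=.
  apply: hformD.
    case: d hf IH => [|d] hf IH /=; last exact: hformX.
    have [c ->] := hform_const hf; rewrite pd_cst.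
    by under eq_fun do rewrite mulr0; exact: hform0.
  by case: (i == j);
    [under eq_fun do rewrite mul1r | under eq_fun do rewrite mul0r; exact: hform0].
- by rewrite (pdD _ hf hg); exact: hformD.
Qed.

End FormCalculus.

Section PolynomialFTC.
Context {R : realType}.
Notation mu := (@lebesgue_measure R).
Notation D := (`[(-1)%R, 1%R]%classic : set R).

Lemma horner_continuous (p : {poly R}) : continuous (horner p).
Proof.
move=> x; apply: differentiable_continuous.
by apply/derivable1_diffP; exact: derivable_horner.
Qed.

Lemma Rintegral_deriv_poly (p : {poly R}) (a b : R) : -1 <= a -> a <= b -> b <= 1 ->
  Rintegral mu D (fun y => if (a <= y <= b) then p^`().[y] else 0) = p.[b] - p.[a].
Proof.
move=> a1 ab b1.
have -> : (fun y => if (a <= y <= b) then p^`().[y] else 0) = (horner p^`()) \_ `[a, b]%classic.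
  apply/funext => y; rewrite /patch; case: ifPn => [yab|]; first by rewrite mem_set //= in_itv.
  by move=> yab; rewrite memNset //= in_itv /=; exact/negP.
rewrite -Rintegral_mkcondr (_ : _ `&` _ = `[a, b]%classic); last first.
  apply/seteqP; split => y /=; rewrite !in_itv /=; first by case.
  by move=> /andP[ay yb]; rewrite (le_trans a1 ay) (le_trans yb b1) ay yb.
move: ab; rewrite le_eqVlt => /predU1P[->|ab].
  by rewrite set_itv1 Rintegral_set1 subrr.
rewrite /Rintegral (@continuous_FTC2 _ _ (horner p)) //=.
- by apply: continuous_subspaceT; exact: horner_continuous.
- split; first by move=> x _; exact: derivable_horner.
    by apply: cvg_at_right_filter; exact: horner_continuous.
  by apply: cvg_at_left_filter; exact: horner_continuous.
- by move=> x _; rewrite derivE.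
Qed.

End PolynomialFTC.

(** * Integration over the ball and the sphere *)

Section BallIntegral.
Context {R : realType}.
Notation mu := (@lebesgue_measure R).
Notation D := (`[(-1)%R, 1%R]%classic : set R).

(** The bound is asked only on the unit ball, since a nonconstant form is unbounded on the whole
    space; the cut-off below turns it into a global bound. *)
Definition ball_mfun n (G : @fn R n) : Prop :=
  smfun n (fun (_ : R) s => G (row_of_seq n s)) /\
  exists M : R, forall x, r2 n x <= 1 -> `|G x| <= M.

Lemma r2_ge0 n (x : 'rV[R]_n) : 0 <= r2 n x.
Proof. by apply: sumr_ge0 => i _; exact: sqr_ge0. Qed.

Lemma sqr_le_r2 n (x : 'rV[R]_n) i : x ord0 i ^+ 2 <= r2 n x.
Proof. by rewrite /r2 (bigD1 i) //= lerDl sumr_ge0 // => j _; exact: sqr_ge0. Qed.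

Lemma r2_eq0 n (x : 'rV[R]_n) : r2 n x = 0 -> x = 0.
Proof.
move=> x0; apply/rowP => i; rewrite !mxE; apply/eqP; rewrite -sqrf_eq0 eq_le.
by rewrite sqr_ge0 andbT -x0 sqr_le_r2.
Qed.

Lemma r2Z n c (x : 'rV[R]_n) : r2 n (c *: x) = c ^+ 2 * r2 n x.
Proof. by rewrite /r2 mulr_sumr; apply: eq_bigr => i _; rewrite mxE exprMn. Qed.

Lemma smfun_row m n d (T : measurableType d) (u : 'I_n -> T -> seq R -> R) e f :
  (forall i, smfun m (u i)) -> hform (n := n) e f ->
  smfun m (fun t s => f (\row_i u i t s)).
Proof.
move=> mu'; elim=> {e f} [e|c|e j f _ IH|e f g _ IHf _ IHg].
- exact: smfun_cst.
- exact: smfun_cst.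
- apply: smfunM => //.
  by rewrite (_ : (fun t s => _) = u j) //; apply/funext => t; apply/funext => s; rewrite mxE.
- exact: smfunD.
Qed.

Lemma smfun_r2 m n d (T : measurableType d) :
  smfun m (fun (_ : T) s => r2 n (row_of_seq n s) : R).
Proof.
apply: (@smfun_sum _ m d T _ _ (fun (i : 'I_n) (_ : T) s => row_of_seq n s ord0 i ^+ 2)) => i.
have -> : (fun (_ : T) (s : seq R) => row_of_seq n s ord0 i ^+ 2) = (fun _ s => nth 0 s i * nth 0 s i).
  by apply/funext => t; apply/funext => s; rewrite mxE expr2.
by apply: smfunM; exact: smfun_nth.
Qed.

Lemma hform_bounded n d f : hform (n := n) d f ->
  exists M : R, forall x : 'rV[R]_n, (forall i, `|x ord0 i| <= 1) -> `|f x| <= M.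
Proof.
elim=> {d f} [d|c|d j f _ [M IH]|d f g _ [M IHf] _ [N IHg]].
- by exists 0 => x _; rewrite normr0.
- by exists `|c|.
- exists M => x x1; rewrite normrM -[leRHS]mul1r; apply: ler_pM => //; exact: IH.
- by exists (M + N) => x x1; apply: le_trans (ler_normD _ _) (lerD (IHf _ x1) (IHg _ x1)).
Qed.

Lemma ball_coord n (x : 'rV[R]_n) : r2 n x <= 1 -> forall i, `|x ord0 i| <= 1.
Proof.
move=> x1 i; rewrite -(ler_pXn2r (n := 2)) ?nnegrE // expr1n.
by rewrite real_normK ?num_real //; apply: le_trans (sqr_le_r2 _ _) x1.
Qed.

Lemma hform_ball_mfun n d f : hform (n := n) d f -> ball_mfun (f : @fn R n).
Proof.
move=> hf; split; first by apply: smfun_row hf => i; exact: smfun_nth.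
by have [M fM] := hform_bounded hf; exists M => x /ball_coord /fM.
Qed.

Lemma sph_ball_mfun n d f : hform (n := n) d f ->
  ball_mfun (fun x : 'rV[R]_n => f ((Num.sqrt (r2 n x))^-1 *: x)).
Proof.
move=> hf; split.
  (* The inverse square root is written as a real power, whose measurability is known; the two agree
     at the origin as well, where both are 0. *)
  rewrite (_ : (fun t s => _) = (fun (_ : R) s => f (\row_(i < n) 
      ((fun y : R => powR y (- 2^-1)) (r2 n (row_of_seq n s)) * nth 0 s i)))).
    apply: (smfun_row (u := fun i (_ : R) s => powR (r2 n (row_of_seq n s)) (- 2^-1) * nth 0 s i) _ hf) => i.
    apply: smfunM; last exact: smfun_nth.
    by apply: (smfun_map (g := fun y : R => powR y (- 2^-1))) => //; exact: smfun_r2.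
  apply/funext => t; apply/funext => s; congr f; apply/rowP => i.
  by rewrite !mxE powRN powR12_sqrt ?r2_ge0.
have [M fM] := hform_bounded hf; exists M => x _; apply: fM; apply: ball_coord.
rewrite r2Z exprVn sqr_sqrtr ?r2_ge0 //.
by have [->|?] := eqVneq (r2 n x) 0; rewrite ?mulr0 ?ler01 // mulVf.
Qed.

Lemma ball_mfunD n F G : ball_mfun F -> ball_mfun G -> ball_mfun (fun x : 'rV[R]_n => F x + G x).
Proof.
move=> [mF [M FM]] [mG [N GN]]; split; first exact: smfunD.
by exists (M + N) => x x1; apply: le_trans (ler_normD _ _) (lerD (FM _ x1) (GN _ x1)).
Qed.

Lemma ball_mfunM n F G : ball_mfun F -> ball_mfun G -> ball_mfun (fun x : 'rV[R]_n => F x * G x).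
Proof.
move=> [mF [M FM]] [mG [N GN]]; split; first exact: smfunM.
by exists (M * N) => x x1; rewrite normrM; apply: ler_pM => //; [exact: FM | exact: GN].
Qed.

Lemma ball_mfun_cst n c : ball_mfun (fun _ : 'rV[R]_n => c).
Proof. exact: hform_ball_mfun (hformC n c). Qed.

(** [rho] bounds the squared radius. Keeping it variable allows integration over balls of all radii
    at once in the layer-cake argument. *)
Definition cutoff n (G : @fn R n) (rho : R) (s : seq R) : R :=
  if r2 n (row_of_seq n s) <= rho then G (row_of_seq n s) else 0.

Lemma cutoff_smfun n G : ball_mfun G -> smfun n (fun (rho : R) s => cutoff (n := n) G rho s).
Proof.
move=> [mG _]; apply: smfun_if_le; first exact: smfun_r2.
  exact: (@smfun_param _ n _ R id (@measurable_id _ _ _)).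
exact: mG.
Qed.

Lemma cutoff_bounded n G : ball_mfun G ->
  exists M : R, forall rho s, rho <= 1 -> `|cutoff (n := n) G rho s| <= M.
Proof.
move=> [_ [M GM]]; exists `|M| => rho s r1; rewrite /cutoff; case: ifPn => [h|_].
  by apply: le_trans (GM _ (le_trans h r1)) (ler_norm _).
by rewrite normr0.
Qed.

Lemma ball_intE n G : ball_int n G = iint n (cutoff (n := n) G 1).
Proof. by []. Qed.

Lemma cutoff1_smfun n G : ball_mfun G -> smfun n (fun (_ : R) => cutoff (n := n) G 1).
Proof. move=> [mG _]; apply: smfun_if_le; [exact: smfun_r2 | exact: smfun_cst | exact: mG]. Qed.

Lemma ball_intD n F G : ball_mfun F -> ball_mfun G ->
  ball_int n (fun x => F x + G x) = ball_int n F + ball_int n G.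
Proof.
move=> nF nG; rewrite !ball_intE.
have [M FM] := cutoff_bounded nF; have [N GN] := cutoff_bounded nG.
rewrite -(@iintD R n _ R _ _ M N 0 (cutoff1_smfun nF) (cutoff1_smfun nG) (fun _ s => FM 1 s (lexx _))
  (fun _ s => GN 1 s (lexx _))).
by apply: iint_eq => s _; rewrite /cutoff; case: ifP; rewrite ?addr0.
Qed.

Lemma ball_intZ n c F : ball_mfun F -> ball_int n (fun x => c * F x) = c * ball_int n F.
Proof.
move=> nF; rewrite !ball_intE.
have [M FM] := cutoff_bounded nF.
rewrite -(@iintZ R n _ R _ M c 0 (cutoff1_smfun nF) (fun _ s => FM 1 s (lexx _))).
by apply: iint_eq => s _; rewrite /cutoff; case: ifP; rewrite ?mulr0.
Qed.

Lemma ball_int_ge0 n (F : @fn R n) : (forall x, 0 <= F x) -> 0 <= ball_int n F.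
Proof. by move=> F0; apply: iint_ge0 => s /=; case: ifP. Qed.

End BallIntegral.

(** * Radial weights: the substitute for polar coordinates *)

Section RadialIntegration.
Context {R : realType}.
Notation mu := (@lebesgue_measure R).
Notation D := (`[(-1)%R, 1%R]%classic : set R).

Lemma unit_itv_monomial (c : R) (p : nat) :
  Rintegral mu D (fun y => if 0 <= y then c * p.+1%:R * y ^+ p else 0) = c.
Proof.
rewrite -[RHS](_ : (c *: 'X^(p.+1)).[1] - (c *: 'X^(p.+1)).[0] = c); last first.
  by rewrite !hornerZ !hornerXn expr1n expr0n /= mulr0 subr0 mulr1.
rewrite -Rintegral_deriv_poly //.
apply: eq_Rintegral => y; rewrite inE /= in_itv /= => /andP[_ ->]; rewrite andbT.
by case: ifP => // _; rewrite derivZ derivXn hornerZ hornerMn hornerXn /= -mulrA mulr_natl.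
Qed.

Lemma unit_itv_monomial_ge (a : nat) (rho : R) : 0 <= rho <= 1 ->
  Rintegral mu D (fun y => if rho <= y ^+ 2 then
     (if 0 <= y then (2 * a)%:R * y ^+ (2 * a).-1 else 0) else 0) = 1 - rho ^+ a.
Proof.
move=> /andP[r0 r1].
have := @Rintegral_deriv_poly R 'X^(2 * a) (Num.sqrt rho) 1.
have -> : rho ^+ a = Num.sqrt rho ^+ (2 * a) by rewrite exprM sqr_sqrtr.
rewrite !hornerXn expr1n => <- //; last 2 first.
- by apply: le_trans (sqrtr_ge0 _); exact: lerN10.
- by rewrite -sqrtr1 ler_wsqrtr.
apply: eq_Rintegral => y; rewrite inE /= in_itv /= => /andP[_ ->]; rewrite andbT.
rewrite derivXn hornerMn hornerXn.
case: (leP 0 y) => y0.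
  by rewrite -(ler_sqrt _ (sqr_ge0 y)) sqrtr_sqr ger0_norm // mulr_natl.
have /negPf -> : ~~ (Num.sqrt rho <= y) by rewrite -ltNge (lt_le_trans y0) ?sqrtr_ge0.
by case: ifP.
Qed.

Lemma row_of_seq_scale n (c : R) (s : seq R) :
  row_of_seq n [seq x / c | x <- s] = c^-1 *: row_of_seq n s.
Proof.
apply/rowP => i; rewrite !mxE mulrC.
have [h|h] := ltnP i (size s); first by rewrite (nth_map 0).
by rewrite !nth_default ?size_map // mul0r.
Qed.

Lemma r2X_ball_mfun n a : ball_mfun (fun x : 'rV[R]_n => r2 n x ^+ a).
Proof.
split.
  apply: (@smfun_map _ (fun y : R => y ^+ a)); first exact: exprn_measurable.
  exact: smfun_r2.
exists 1 => x x1; rewrite ger0_norm ?exprn_ge0 ?r2_ge0 //.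
by rewrite exprn_ile1 // r2_ge0.
Qed.

(* Layer-cake: [1 - |x|^(2a)] is the integral of [2a y^(2a-1)] over [|x| <= y <= 1]. *)
Lemma ball_int_radial n a (h : @fn R n) : ball_mfun h -> (forall c x, 0 < c -> h (c *: x) = h x) ->
  (n + 2 * a)%:R * ball_int n (fun x => r2 n x ^+ a * h x) = n%:R * ball_int n h.
Proof.
move=> nh h0.
case: a => [|a]; first by under eq_fun do rewrite mul1r; rewrite addn0.
have [q pE] : exists q, (2 * a.+1)%N = q.+2 by exists (2 * a)%N; rewrite mulnS.
rewrite pE.
(* The layer-cake density, truncated outside [0, 1] so as to be bounded on the whole line. *)
pose w (y : R) : R := if (0 <= y <= 1) then q.+2%:R * y ^+ q.+1 else 0.
have mw : measurable_fun setT w.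
  apply: measurable_fun_ifT => //.
    by apply: measurable_and; exact: measurable_fun_ler.
  by apply: measurable_funM => //; exact: exprn_measurable.
have bw y : `|w y| <= q.+2%:R.
  rewrite /w; case: ifP => [/andP[y0 y1]|_]; last by rewrite normr0.
  by rewrite ger0_norm ?mulr_ge0 ?exprn_ge0 // ler_piMr // exprn_ile1.
(* Capping the squared radius at 1 changes nothing on the interval, but makes [K] bounded for every
   real [y]. *)
pose K (y : R) (s : seq R) : R := w y * cutoff h (Num.min (y ^+ 2) 1) s.
have mC : smfun n (fun (y : R) => cutoff h (Num.min (y ^+ 2) 1)).
  apply: (@smfun_reparam _ n _ R _ R (fun y : R => Num.min (y ^+ 2) 1) _ _ (cutoff_smfun nh)).
  by apply: measurable_minr => //; exact: exprn_measurable.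
have nK : smfun n K by apply: smfunM => //; exact: (@smfun_param _ n _ R w).
have [M hM] := cutoff_bounded nh.
have hM' y s : `|cutoff h (Num.min (y ^+ 2) 1) s| <= M by apply: hM; rewrite ge_min lexx orbT.
have bK y s : `|K y s| <= q.+2%:R * M by rewrite normrM ler_pM.
have nK' : smfun n (fun q : R * R => K q.2).
  exact: (@smfun_reparam _ n _ R _ (R * R)%type snd _ (measurable_snd) nK).
have := @iint_swap R n _ R (fun q : R * R => K q.2) (q.+2%:R * M) 0 nK' (fun q s => bK q.2 s).
(* Integrating over [y] first: each point x of the unit ball receives the weight 1 - |x|^(2a). *)
have -> : iint n (fun s => Rintegral mu D (fun y => K y s)) =
    ball_int n h - ball_int n (fun x => r2 n x ^+ a.+1 * h x).
  have := ball_intD nh (ball_mfunM (ball_mfun_cst n (-1)) (ball_mfunM (r2X_ball_mfun n a.+1) nh)).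
  rewrite (ball_intZ (-1)) ?mulN1r => [<-|]; last by apply: ball_mfunM => //; exact: r2X_ball_mfun.
  apply: iint_eq => s _; case: (leP (r2 n (row_of_seq n s)) 1) => r1; last first.
    rewrite /= (leNgt (r2 n _)) r1 /=.
    rewrite -[RHS](mul0r (fine (mu D))) -Rintegral_cst //; apply: eq_Rintegral => y _.
    by rewrite /K /cutoff le_min [X in _ && X]leNgt r1 andbF mulr0.
  set x := row_of_seq n s in r1 *.
  pose g y : R := if r2 n x <= y ^+ 2 then w y else 0.
  transitivity (Rintegral mu D (fun y => h x * g y)).
    apply: eq_Rintegral => y _; rewrite /K /g /cutoff -/x le_min r1 andbT.
    by case: ifP; rewrite ?mulr0 // mulrC.
  have mg : measurable_fun setT g.
    apply: measurable_fun_ifT => //.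
    by apply: measurable_fun_ler => //; exact: exprn_measurable.
  have bg y : `|g y| <= q.+2%:R by rewrite /g; case: ifP => // _; rewrite normr0.
  rewrite RintegralZl //; last exact: unit_itv_integrable mg bg.
  have -> : Rintegral mu D g = 1 - r2 n x ^+ a.+1.
    have := @unit_itv_monomial_ge a.+1 (r2 n x); rewrite r2_ge0 r1 pE => <- //; apply: eq_Rintegral => y.
    rewrite inE /= in_itv /= => /andP[_ y1].
    by rewrite /g /w y1 andbT.
  by rewrite /= r1 mulN1r mulrBr mulr1 [h x * _]mulrC.
(* Integrating over the ball of radius [y] first: scaling gives the factor [y ^+ n], because [h] is
   constant on rays, and a monomial in [y] remains. *)
have -> : Rintegral mu D (fun y => iint n (K y)) = q.+2%:R / (n + q.+2)%:R * ball_int n h.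
  rewrite -[RHS](@unit_itv_monomial _ (q.+1 + n)); apply: eq_Rintegral => y.
  rewrite inE /= in_itv /= => /andP[_ y1].
  have -> : iint n (K y) = w y * iint n (cutoff h (Num.min (y ^+ 2) 1)).
    exact: (@iintZ R n _ R _ M (w y) y mC hM').
  rewrite /w y1 andbT; case: ifPn => y0; last by rewrite mul0r.
  have np : (q.+1 + n).+1 = (n + q.+2)%N by rewrite addnC -addnS.
  have np0 : (n + q.+2)%:R != 0 :> R by rewrite pnatr_eq0 -np.
  move: y0; rewrite le_eqVlt => /predU1P[<-|y0].
    by rewrite exprD !expr0n /= !(mulr0, mul0r).
  have y01 : 0 < y <= 1 by rewrite y0.
  rewrite (_ : Num.min _ _ = y ^+ 2); last by apply/min_idPl; rewrite exprn_ile1 // ltW.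
  have -> : iint n (cutoff h (y ^+ 2)) = y ^+ n * ball_int n h.
    rewrite ball_intE -(@iint_scale R n _ R _ M y 0 y01 (cutoff1_smfun nh)) //.
    - apply: iint_eq => s _; rewrite /cutoff row_of_seq_scale r2Z exprVn ler_pdivrMl ?exprn_gt0 //.
      by rewrite mulr1 h0 // invr_gt0.
    - by move=> _ s; exact: hM.
    - move=> s sn; rewrite /cutoff; case: ifP => // r1 /(has_nthP 0)[i].
      rewrite sn => ilt; have := ball_coord r1 (Ordinal ilt).
      by rewrite mxE leNgt => /negP.
  have alg (A u v B N : R) : N != 0 -> A * u * (v * B) = A / N * B * N * (u * v).
    by move=> N0; field.
  by rewrite np exprD; exact: alg.
move=> E.
have np0 : (n + q.+2)%:R != 0 :> R by rewrite pnatr_eq0 addn_eq0 negb_and orbT.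
have -> : ball_int n (fun x => r2 n x ^+ a.+1 * h x) = ball_int n h - q.+2%:R / (n + q.+2)%:R * ball_int n h.
  by rewrite -E opprB addrC subrK.
by rewrite natrD in np0 *; field.
Qed.

End RadialIntegration.

(** * The mean over the sphere and integration by parts *)

Section SphericalMean.
Context {R : realType}.
Notation mu := (@lebesgue_measure R).
Notation D := (`[(-1)%R, 1%R]%classic : set R).

Lemma smfun_prod_nth (g : R -> R) m d (T : measurableType d) : measurable_fun setT g ->
  smfun m (fun (_ : T) s => \prod_(x <- s) g x).
Proof.
move=> mg; elim: m d T => [|m IH] d T /=.
  by under [X in measurable_fun _ X]eq_fun do rewrite big_nil; exact: measurable_cst.
have -> : (fun (p : T * R) s => \prod_(x <- p.2 :: s) g x) =
    (fun p s => g p.2 * \prod_(x <- s) g x).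
  by apply/funext => p; apply/funext => s; rewrite big_cons.
apply: smfunM; last exact: IH.
apply: (@smfun_param _ m _ (T * R)%type (fun p => g p.2)).
exact: (measurableT_comp mg measurable_snd).
Qed.

Lemma iint_cube (c : R) m : 0 < c <= 1 ->
  iint m (fun s => \prod_(x <- s) (if - c <= x <= c then 1 else 0)) = (2 * c) ^+ m.
Proof.
move=> /andP[c0 c1].
pose g (x : R) : R := if - c <= x <= c then 1 else 0.
have mg : measurable_fun setT g.
  apply: measurable_fun_ifT => //.
  by apply: measurable_and; exact: measurable_fun_ler.
have bg (s : seq R) : `|\prod_(x <- s) g x| <= 1.
  elim: s => [|x s IH]; first by rewrite big_nil normr1.
  rewrite big_cons normrM -[leRHS]mulr1; apply: ler_pM => //.
  by rewrite /g; case: ifP; rewrite ?normr1 ?normr0.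
elim: m => [|m IH] /=; first by rewrite big_nil.
transitivity (Rintegral mu D (fun x => (2 * c) ^+ m * g x)).
  apply: eq_Rintegral => x _.
  rewrite mulrC -IH -(@iintZ R m _ R (fun (_ : R) s => \prod_(x <- s) g x) 1 (g x) 0) //.
    by apply: iint_eq => s _; rewrite big_cons.
  exact: smfun_prod_nth.
rewrite RintegralZl //; last first.
  apply: (@unit_itv_integrable _ _ 1) => // x.
  by rewrite /g; case: ifP; rewrite ?normr1 ?normr0.
rewrite exprSr; congr (_ * _).
have := @Rintegral_deriv_poly R 'X (- c) c; rewrite !hornerX derivX opprK -mulr2n mulr_natl.
move=> <- //; [|by rewrite lerN2|by rewrite ge0_cp // ltW].
by apply: eq_Rintegral => x _; rewrite hornerC.
Qed.

Lemma ball_int1_gt0 n : 0 < ball_int n (fun=> 1 : R).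
Proof.
(* The cube of half-side 1/(n+1) lies in the unit ball, and its volume is computed by
   [iint_cube]. *)
pose c : R := n.+1%:R^-1.
have c01 : 0 < c <= 1 by rewrite /c invr_gt0 ltr0n /= invf_le1 ?ltr0n // ler1n.
pose F (s : seq R) : R := \prod_(x <- s) (if - c <= x <= c then 1 else 0).
have nF : smfun n (fun (_ : R) => F).
  apply: (@smfun_prod_nth (fun x => if - c <= x <= c then 1 else 0)).
  apply: measurable_fun_ifT => //.
  by apply: measurable_and; exact: measurable_fun_ler.
have F01 s : (F s == 0) || (F s == 1).
  rewrite /F; elim: s => [|x s /orP[] /eqP E]; rewrite ?big_nil ?eqxx ?orbT // big_cons E.
    by rewrite mulr0 eqxx.
  by case: ifP; rewrite ?mul0r ?mul1r eqxx ?orbT.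
have FM s : `|F s| <= 1 by case/orP: (F01 s) => /eqP ->; rewrite ?normr0 ?normr1.
have F1 s : size s = n -> F s = 1 -> r2 n (row_of_seq n s) <= 1.
  move=> sn Fs.
  have xs x : x \in s -> - c <= x <= c.
    move=> xs; apply/negPn/negP => /negPf h; move: Fs; rewrite /F (big_rem x) //= h mul0r.
    by move/eqP; rewrite eq_sym oner_eq0.
  apply: (@le_trans _ _ (\sum_(i < n) n.+1%:R^-1)).
    apply: ler_sum => i _; rewrite mxE -/c.
    have : - c <= s`_i <= c by apply: xs; rewrite mem_nth ?sn.
    rewrite -ler_norml -real_normK ?num_real // => h.
    apply: (@le_trans _ _ (c ^+ 2)); first by rewrite ler_pXn2r ?nnegrE // (le_trans _ h).
    by case/andP: c01 => c0 c1; rewrite expr2 ler_piMr // ltW.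
  rewrite sumr_const card_ord -[_ *+ n]mulr_natl ler_pdivrMr ?ltr0n // mul1r ler_nat.
  exact: leqnSn.
have [M hM] := cutoff_bounded (ball_mfun_cst (R := R) n 1).
apply: (@lt_le_trans _ _ (iint n F)).
  by rewrite iint_cube // exprn_gt0 // mulr_gt0 //; case/andP: c01.
rewrite ball_intE -subr_ge0 -mulN1r.
rewrite -(@iintZ R n _ R (fun _ => F) 1 (-1) 0 nF) //.
have nF' : smfun n (fun (_ : R) s => -1 * F s).
  by apply: smfunM => //; exact: smfun_cst.
rewrite -(@iintD R n _ R (fun _ => cutoff (fun=> 1) 1) (fun _ s => -1 * F s) M 1 0) //.
(* [iint_ge0] asks for nonnegativity at lists of every length, while the cube is compared with the
   ball at length [n] only; the maximum with 0 bridges the gap. *)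
- rewrite (@iint_eq _ n _ (fun s => Num.max 0 (cutoff (n := n) (fun=> 1) 1 s + -1 * F s))).
    by apply: iint_ge0 => s; rewrite le_max lexx.
  move=> s sn; apply/esym/max_idPr; rewrite mulN1r subr_ge0 /cutoff.
  case/orP: (F01 s) => /eqP E; rewrite E; first by case: ifP.
  by rewrite (F1 _ sn E).
- exact: cutoff1_smfun (ball_mfun_cst n 1).
- by move=> _ s; exact: hM.
- by move=> _ s; rewrite normrM normrN normr1 mul1r.
Qed.

Lemma hform_homog n d f : hform (n := n) d f ->
  forall (c : R) x, f (c *: x) = c ^+ d * f x.
Proof.
elim=> {d f} [d|a|d j f _ IH|d f g _ IHf _ IHg] c x.
- by rewrite mulr0.
- by rewrite mul1r.
- by rewrite IH mxE exprS -!mulrA; congr (_ * _); rewrite mulrCA.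
- by rewrite IHf IHg mulrDr.
Qed.

Definition setcoord n (w : 'rV[R]_n) (j : 'I_n) (y : R) : 'rV[R]_n :=
  \row_i (if i == j then y else w ord0 i).

Lemma hform_line n d f : hform (n := n) d f -> forall (w : 'rV[R]_n) j, exists p : {poly R},
  forall y, f (setcoord w j y) = p.[y] /\ pd j f (setcoord w j y) = p^`().[y].
Proof.
move=> hf w j; elim: hf => {d f} [d|c|d i f hf [p IH]|d f g hf [p IHf] hg [q IHg]].
- by exists 0 => y; rewrite pd_cst deriv0 !horner0.
- by exists c%:P => y; rewrite pd_cst derivC horner0 hornerC.
- exists ((if i == j then 'X else (w ord0 i)%:P) * p) => y; have [E1 E2] := IH y.
  rewrite (pdX _ _ hf) E1 E2 mxE.
  by case: eqP => _; rewrite derivM ?derivX ?derivC !hornerE; split=> //; rewrite ?mul0r ?addr0 ?add0r // addrC.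
- exists (p + q) => y; have [[E1 E2] [E3 E4]] := (IHf y, IHg y).
  by rewrite (pdD _ hf hg) derivD !hornerD E1 E2 E3 E4.
Qed.

(** The integrand is the derivative along coordinate [j] of (1 - |x|^2) f. This product vanishes at
    both ends of every chord of the ball in that direction, so the innermost integral is already
    0. *)
Lemma ball_int_divergence n d f j : hform (n := n) d f ->
  ball_int n (fun x : 'rV[R]_n => (1 - r2 n x) * pd j f x + - 2 * (x ord0 j * f x)) = 0.
Proof.
case: n f j => [f []//|n f j hf].
set G := (fun x : 'rV[R]_n.+1 => _).
have nr : ball_mfun (fun x : 'rV[R]_n.+1 => 1 - r2 n.+1 x).
  apply: ball_mfunD; first exact: ball_mfun_cst.
  under eq_fun do rewrite -mulN1r; apply: ball_mfunM; first exact: ball_mfun_cst.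
  exact: (r2X_ball_mfun n.+1 1).
have nG : ball_mfun G.
  apply: ball_mfunD; apply: ball_mfunM => //; first exact: hform_ball_mfun (hform_pd j hf).
    exact: ball_mfun_cst.
  exact: hform_ball_mfun (hformX j hf).
have [M GM] := cutoff_bounded nG.
have jn : (j <= n)%N by rewrite -ltnS.
rewrite ball_intE (@iint_insert R n j _ R (fun _ => cutoff G 1) M 0 jn (cutoff1_smfun nG)) //; last first.
  by move=> _ s; exact: GM.
rewrite -[RHS](iint0 n); apply: iint_eq => s sn.
set w := row_of_seq n.+1 (take j s ++ 0 :: drop j s).
have rowE y : row_of_seq n.+1 (take j s ++ y :: drop j s) = setcoord w j y.
  apply/rowP => i; rewrite !mxE; have [->|ij] := eqVneq i j.
    by rewrite nth_cat size_takel ?sn // ltnn subnn.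
  rewrite !nth_cat; case: ifP => // /negbT; rewrite -leqNgt size_takel ?sn // leq_eqVlt.
  by rewrite eq_sym (inj_eq val_inj) (negPf ij) /= => ji; rewrite -(subnSK ji).
pose rho := \sum_(i < n.+1 | i != j) w ord0 i ^+ 2.
have r2E y : r2 n.+1 (setcoord w j y) = y ^+ 2 + rho.
  rewrite /r2 (bigD1 j) //= mxE eqxx; congr (_ + _).
  by apply: eq_bigr => i /negPf ij; rewrite mxE ij.
have [p pE] := hform_line hf w j.
pose q := p * ((1 - rho)%:P - 'X^2).
have qE y : G (setcoord w j y) = q^`().[y].
  have [E1 E2] := pE y; rewrite /G r2E E1 E2 mxE eqxx /q derivM derivB derivC derivXn /=.
  rewrite !(hornerE, hornerXn) /=; ring.
have E y : cutoff G 1 (take j s ++ y :: drop j s) = if y ^+ 2 <= 1 - rho then q^`().[y] else 0.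
  by rewrite /cutoff rowE r2E qE lerBrDr.
under eq_Rintegral do rewrite E.
have [r1|r1] := leP 0 (1 - rho); last first.
  rewrite -[RHS](mul0r (fine (mu D))) -Rintegral_cst //; apply: eq_Rintegral => y _.
  by rewrite ifN // -ltNge (lt_le_trans r1) ?sqr_ge0.
have rho0 : 0 <= rho by apply: sumr_ge0 => i _; exact: sqr_ge0.
set c := Num.sqrt (1 - rho).
have c0 : 0 <= c by exact: sqrtr_ge0.
have c1 : c <= 1 by rewrite -sqrtr1 ler_wsqrtr // gerBl.
have qc y : y ^+ 2 = 1 - rho -> q.[y] = 0.
  by move=> E'; rewrite /q !(hornerE, hornerXn) E' subrr mulr0.
have c2 : c ^+ 2 = 1 - rho by rewrite sqr_sqrtr.
transitivity (Rintegral mu D (fun y => if - c <= y <= c then q^`().[y] else 0)).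
  apply: eq_Rintegral => y _; congr (if _ then _ else _).
  by rewrite -ler_norml -c2 -(real_normK (num_real y)) ler_pXn2r ?nnegrE.
by rewrite Rintegral_deriv_poly ?lerN2 ?ge0_cp // !qc ?sqrrN // subrr.
Qed.

Definition sph_proj n (x : 'rV[R]_n) : 'rV[R]_n := (Num.sqrt (r2 n x))^-1 *: x.

Lemma r2_sph_proj n (x : 'rV[R]_n) : r2 n x != 0 -> r2 n (sph_proj x) = 1.
Proof. by move=> x0; rewrite /sph_proj r2Z exprVn sqr_sqrtr ?r2_ge0 // mulVf. Qed.

Lemma sph_projZ n (c : R) (x : 'rV[R]_n) : 0 < c -> sph_proj (c *: x) = sph_proj x.
Proof.
move=> c0; rewrite /sph_proj r2Z sqrtrM ?sqr_ge0 // sqrtr_sqr gtr0_norm //.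
by rewrite invfM scalerA mulrAC mulVf ?mul1r // gt_eqF.
Qed.

Lemma hform_sph n k f (x : 'rV[R]_n) : hform (2 * k) f -> f x = r2 n x ^+ k * f (sph_proj x).
Proof.
move=> hf; have [x0|x0] := eqVneq (r2 n x) 0.
  have -> : sph_proj x = 0 *: x by rewrite /sph_proj x0 sqrtr0 invr0.
  rewrite {1}(r2_eq0 x0) -(scale0r x) !(hform_homog hf) x0 mulrA; congr (_ * _).
  by rewrite exprM expr0n /= -exprMn mulr0.
rewrite /sph_proj (hform_homog hf) exprM exprVn sqr_sqrtr ?r2_ge0 //.
by rewrite mulrA -exprMn divff // expr1n mul1r.
Qed.

(** Replaces polar coordinates for forms of even degree: the integrals of a form and of its radial
    projection differ by a factor depending on the degree alone. *)
Lemma ball_int_hform n k f : hform (n := n) (2 * k) f ->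
  (n + 2 * k)%:R * ball_int n f = n%:R * ball_int n (fun x => f (sph_proj x)).
Proof.
move=> hf; rewrite -(ball_int_radial k (sph_ball_mfun hf)); last first.
  by move=> c x c0; rewrite -[_ *: (c *: x)]/(sph_proj (c *: x)) sph_projZ.
by congr (_ * ball_int n _); apply/funext => x; exact: hform_sph.
Qed.

Lemma hformZ n d c f : hform (n := n) d f -> hform d (fun x : 'rV[R]_n => c * f x).
Proof.
elim=> {d f} [d|a|d j f _ IH|d f g _ IHf _ IHg].
- by under eq_fun do rewrite mulr0; exact: hform0.
- exact: hformC.
- by under eq_fun do rewrite mulrCA; exact: hformX.
- by under eq_fun do rewrite mulrDr; exact: hformD.
Qed.

Lemma hformM n d e f g : hform (n := n) d f -> hform e g ->
  hform (d + e) (fun x : 'rV[R]_n => f x * g x).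
Proof.
move=> hf hg; elim: hf => {d f} [d|a|d j f _ IH|d f h _ IHf _ IHg].
- by under eq_fun do rewrite mul0r; exact: hform0.
- exact: hformZ.
- by under eq_fun do rewrite -mulrA; exact: hformX.
- by under eq_fun do rewrite mulrDl; exact: hformD.
Qed.

Lemma hform_sum n d I (r : seq I) (P : pred I) (F : I -> @fn R n) : (forall i, P i -> hform d (F i)) ->
  hform d (fun x : 'rV[R]_n => \sum_(i <- r | P i) F i x).
Proof.
move=> hF; elim: r => [|i r IH].
  by under eq_fun do rewrite big_nil; exact: hform0.
case Pi: (P i); under eq_fun do rewrite big_cons Pi; last exact: IH.
by apply: hformD => //; exact: hF.
Qed.

Lemma hform_r2 n : hform 2 (r2 n : @fn R n).
Proof.
apply: hform_sum => i _; under eq_fun do rewrite expr2.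
by apply: hformX; exact: hform_coord.
Qed.

Lemma hform_r2X n k : hform (2 * k) (fun x : 'rV[R]_n => r2 n x ^+ k).
Proof.
elim: k => [|k IH]; first by under eq_fun do rewrite expr0; exact: hformC.
rewrite mulnS; under eq_fun do rewrite exprS.
by apply: hformM => //; exact: hform_r2.
Qed.

Lemma sphD n d e (f g : @fn R n) : hform (n := n) d f -> hform e g ->
  sph_int n (fun x => f x + g x) = sph_int n f + sph_int n g.
Proof.
by move=> hf hg; rewrite /sph_int (ball_intD (sph_ball_mfun hf) (sph_ball_mfun hg)) mulrDl.
Qed.

Lemma sphZ n d c (f : @fn R n) : hform (n := n) d f -> sph_int n (fun x => c * f x) = c * sph_int n f.
Proof. by move=> hf; rewrite /sph_int (ball_intZ _ (sph_ball_mfun hf)) mulrA. Qed.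

Lemma eq_sph n (f g : @fn R n) : (forall x, f x = g x) -> sph_int n f = sph_int n g.
Proof. by move=> fg; congr (sph_int n _); exact/funext. Qed.

Lemma sph_ge0 n (f : @fn R n) : (forall x, 0 <= f x) -> 0 <= sph_int n f.
Proof.
by move=> f0; rewrite /sph_int divr_ge0 ?ball_int_ge0 // ltW // ball_int1_gt0.
Qed.

Lemma sph_cst n (c : R) : sph_int n (fun=> c) = c.
Proof.
transitivity (sph_int n (fun=> c * 1)); first by congr sph_int; apply/funext => x; rewrite mulr1.
by rewrite (sphZ _ (hformC n 1)) /sph_int divff ?mulr1 // gt_eqF // ball_int1_gt0.
Qed.

Lemma sph_r2 n k (f : @fn R n) : (0 < n)%N -> hform (n := n) (2 * k) f ->
  sph_int n (fun x => r2 n x * f x) = sph_int n f.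
Proof.
move=> n0 hf; congr (_ / _); apply: (@mulfI _ (n%:R : R)); first by rewrite pnatr_eq0 -lt0n.
have h2 : hform (2 * k.+1) (fun x => r2 n x * f x).
  by rewrite mulnS; exact: hformM (hform_r2 n) hf.
rewrite -(ball_int_hform h2) -(ball_int_radial k.+1 (sph_ball_mfun hf)); last first.
  by move=> c x c0; rewrite -[_ *: (c *: x)]/(sph_proj (c *: x)) sph_projZ.
congr (_ * ball_int n _); apply/funext => x.
by rewrite (hform_sph x hf) exprS mulrA.
Qed.

(* Integration by parts on the sphere; it determines all the moments of [sigma]. *)
Lemma sph_ibp n k j (f : @fn R n) : hform (n := n) (2 * k).+1 f ->
  (n + 2 * k)%:R * sph_int n (fun x => x ord0 j * f x) = sph_int n (pd j f).
Proof.
move=> hf.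
have hX : hform (2 * k.+1) (fun x : 'rV[R]_n => x ord0 j * f x) by rewrite mulnS; exact: hformX.
have hp : hform (2 * k) (pd j f) by have := hform_pd j hf.
have h2 : hform (2 * k.+1) (fun x => r2 n x * pd j f x).
  by rewrite mulnS; exact: hformM (hform_r2 n) hp.
have n0 : (n%:R : R) != 0 by rewrite pnatr_eq0 -lt0n; case: n j {hf hX hp h2 f} => // -[].
have := ball_int_divergence j hf.
have -> : (fun x => (1 - r2 n x) * pd j f x + -2 * (x ord0 j * f x)) =
  (fun x => (pd j f x + -1 * (r2 n x * pd j f x)) + -2 * (x ord0 j * f x)).
  by apply/funext => x; ring.
have nn := hform_ball_mfun.
rewrite ball_intD; [|by apply: ball_mfunD; [exact: nn hp | exact: nn (hformZ _ h2)] | exact: nn (hformZ _ hX)].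
rewrite ball_intD; [| exact: nn hp | exact: nn (hformZ _ h2)].
rewrite !ball_intZ; [|exact: nn hX | exact: nn h2].
have E1 := ball_int_hform hX; have E2 := ball_int_hform hp.
have E3 := ball_int_hform h2.
have E4 : ball_int n (fun x => r2 n (sph_proj x) * pd j f (sph_proj x)) = ball_int n (fun x => pd j f (sph_proj x)).
  have n1 : (0 < n)%N by move: n0; rewrite pnatr_eq0 lt0n.
  have := sph_r2 n1 hp; rewrite /sph_int; apply: mulIf.
  by rewrite invr_eq0 gt_eqF // ball_int1_gt0.
rewrite E4 in E3 => E5.
rewrite /sph_int mulrA; congr (_ / _); apply: (mulfI n0).
rewrite mulrCA -E1 -E2.
have p1 : (n + 2 * k.+1)%:R = (n + 2 * k)%:R + 2 :> R by rewrite mulnS addnCA natrD addrC.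
move: E1 E2 E3 E5; rewrite p1.
set b1 := ball_int n (fun x => x ord0 j * f x); set b2 := ball_int n (pd j f).
set b3 := ball_int n (fun x => r2 n x * _); set N := (n + 2 * k)%:R => _ E2 E3 E5.
(* The integrands of [b2] and [b3] agree on the sphere, where [r2] is 1, so these ball integrals
   differ only by the factors attached to their degrees. *)
have : (N + 2) * b3 = N * b2 by rewrite E3 E2.
move=> E6; have : (N + 2) * (2 * b1) = 2 * b2.
  have -> : 2 * b1 = b2 - b3 by move: E5; lra.
  by rewrite mulrBr E6; ring.
by move=> E7; congr (_ * _); lra.
Qed.

End SphericalMean.

#[local] Opaque derive sph_int.

(** * Monomials, Euler's identity and the Laplacian *)

Section FormAlgebra.
Context {R : realType}.
Implicit Types (n d e k : nat).

Lemma hform_prod n I (r : seq I) (F : I -> @fn R n) (d : I -> nat) :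
  (forall i, hform (d i) (F i)) ->
  hform (\sum_(i <- r) d i) (fun x : 'rV[R]_n => \prod_(i <- r) F i x).
Proof.
move=> hF; elim: r => [|i r IH].
  by rewrite big_nil; under eq_fun do rewrite big_nil; exact: hformC.
rewrite big_cons (_ : (fun x => _) = fun x => F i x * \prod_(i <- r) F i x); first exact: hformM.
by apply/funext => x; rewrite big_cons.
Qed.

Lemma hformXn n d e (f : @fn R n) : hform d f -> hform (e * d) (fun x => f x ^+ e).
Proof.
move=> hf; elim: e => [|e IH]; first by under eq_fun do rewrite expr0; exact: hformC.
by rewrite mulSn; under eq_fun do rewrite exprS; exact: hformM.
Qed.

Lemma hform_monomial n (b : 'I_n -> nat) :
  hform (\sum_i b i) (fun x : 'rV[R]_n => \prod_i x ord0 i ^+ b i).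
Proof.
apply: (@hform_prod n _ _ (fun i (x : 'rV[R]_n) => x ord0 i ^+ b i)) => i.
by have := hformXn (b i) (hform_coord i); rewrite muln1.
Qed.

Lemma hform_monomials n d (f : @fn R n) : hform d f ->
  exists s : seq (R * ('I_n -> nat)), (forall p, List.In p s -> (\sum_i p.2 i)%N = d) /\
    f = fun x => \sum_(p <- s) p.1 * \prod_i x ord0 i ^+ p.2 i.
Proof.
elim=> {d f} [d|c|d j f _ [s [sd ->]]|d f g _ [s [sd ->]] _ [t [td ->]]].
- by exists [::]; split=> //; apply/funext => x; rewrite big_nil.
- exists [:: (c, fun=> 0%N)]; split=> [p [<-|//]|]; first by rewrite big1.
  by apply/funext => x; rewrite big_seq1 /= big1 ?mulr1.
- exists [seq (p.1, fun i => (i == j) + p.2 i)%N | p <- s]; split.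
    elim: s sd => [//|q s IH] sd p /= [<-|/IH] /=; last by apply=> q' hq'; apply: sd; right.
    rewrite big_split /= (sd q); last by left.
    by rewrite (bigD1 j) //= eqxx big1 // => i /negPf ->.
  apply/funext => x; rewrite big_map mulr_sumr; apply: eq_bigr => p _ /=.
  rewrite mulrCA; congr (_ * _); rewrite [RHS](bigD1 j) //= eqxx exprS -mulrA; congr (_ * _).
  rewrite (bigD1 j) //=; congr (_ * _).
  by apply: eq_bigr => i /negPf ->.
- exists (s ++ t); split=> [p /(List.in_app_or _ _ _)[]|]; [exact: sd|exact: td|].
  by apply/funext => x; rewrite big_cat.
Qed.

Lemma is_formP n d (f : @fn R n) : is_form n d f <-> hform d f.
Proof.
split=> [[c ->]|/hform_monomials[s [sd ->]]].
  apply: hform_sum => a /eqP ad; apply: hformZ.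
  by have := hform_monomial (fun i => a i : nat); rewrite ad.
elim: s sd => [|[c b] s IH] sd.
  exists (fun=> 0); apply/funext => x; rewrite big_nil.
  by rewrite big1 // => a _; rewrite mul0r.
have [|c' E] := IH; first by move=> p hp; apply: sd; right.
have bd : (\sum_i b i)%N = d by exact: (sd (c, b) (or_introl erefl)).
have bi i : (b i < d.+1)%N by rewrite ltnS -bd (bigD1 i) //= leq_addr.
pose a0 : {ffun 'I_n -> 'I_d.+1} := [ffun i => Ordinal (bi i)].
exists (fun a => (if a == a0 then c else 0) + c' a); apply/funext => x.
rewrite big_cons /=; have /(congr1 (fun f => f x)) /= -> := E.
under [RHS]eq_bigr do rewrite mulrDl.
rewrite big_split /=; congr (_ + _).
rewrite (bigD1 a0) /=; last first.
  by apply/eqP; rewrite -[RHS]bd; apply: eq_bigr => i _; rewrite ffunE.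
rewrite eqxx [X in _ + X]big1; last by move=> a /andP[_ /negPf ->]; rewrite mul0r.
rewrite addr0.
by congr (_ * _); apply: eq_bigr => i _; rewrite ffunE.
Qed.

Lemma hform_euler n d (f : @fn R n) (x : 'rV[R]_n) : hform d f ->
  \sum_j x ord0 j * pd j f x = d%:R * f x.
Proof.
elim=> {d f} [d|c|d i f hf IH|d f g hf IHf hg IHg].
- by rewrite mulr0 big1 // => j _; rewrite pd_cst mulr0.
- by rewrite mul0r big1 // => j _; rewrite pd_cst mulr0.
- under eq_bigr do rewrite (pdX _ _ hf) mulrDr.
  rewrite big_split /= [X in _ + X](bigD1 i) //= [X in _ + (_ + X)]big1; last first.
    by move=> j; rewrite eq_sym => /negPf ->; rewrite mul0r mulr0.
  rewrite eqxx mul1r addr0 -[d.+1]addn1 natrD mulrDl mul1r; congr (_ + _).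
  by rewrite mulrCA -IH mulr_sumr; apply: eq_bigr => j _; exact: mulrCA.
- under eq_bigr do rewrite (pdD _ hf hg) mulrDr.
  by rewrite big_split /= IHf IHg mulrDr.
Qed.

Lemma pdZ n (j : 'I_n) d c (f : @fn R n) : hform d f ->
  pd j (fun x => c * f x) = (fun x => c * pd j f x).
Proof.
move=> hf; rewrite (pdM _ (hformC n c) hf); apply/funext => x.
by rewrite pd_cst mulr0 addr0.
Qed.

Lemma pd_sum n (j : 'I_n) d I (r : seq I) (P : pred I) (F : I -> @fn R n) :
  (forall i, P i -> hform d (F i)) ->
  pd j (fun x => \sum_(i <- r | P i) F i x) = (fun x => \sum_(i <- r | P i) pd j (F i) x).
Proof.
move=> hF; elim: r => [|i r IH].
  under eq_fun do rewrite big_nil; under [RHS]eq_fun do rewrite big_nil.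
  by rewrite pd_cst.
case Pi: (P i); under eq_fun do rewrite big_cons Pi; under [RHS]eq_fun do rewrite big_cons Pi.
  by rewrite (pdD _ (hF _ Pi) (hform_sum r hF)) IH.
exact: IH.
Qed.

Lemma sph_sum n d I (r : seq I) (P : pred I) (F : I -> @fn R n) :
  (forall i, P i -> hform d (F i)) ->
  sph_int n (fun x => \sum_(i <- r | P i) F i x) = \sum_(i <- r | P i) sph_int n (F i).
Proof.
move=> hF; elim: r => [|i r IH].
  by under eq_fun do rewrite big_nil; rewrite big_nil sph_cst.
rewrite big_cons; case Pi: (P i); under eq_fun do rewrite big_cons Pi; last exact: IH.
by rewrite (sphD (hF _ Pi) (hform_sum r hF)) IH.
Qed.

Lemma laplacianE n (f : @fn R n) : laplacian n f = fun x => \sum_j pd j (pd j f) x.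
Proof. by []. Qed.

Lemma hform_laplacian n d (f : @fn R n) : hform d f -> hform d.-2 (laplacian n f).
Proof. by move=> hf; apply: hform_sum => j _; apply: hform_pd; exact: hform_pd. Qed.

(** Euler's identity spreads the mean of [f] over the products of a coordinate with a partial
    derivative, and each of these is integrated by parts. *)
Lemma sph_laplacian n k (f : @fn R n) : hform (2 * k.+1) f ->
  sph_int n (laplacian n f) = (n + 2 * k)%:R * (2 * k.+1)%:R * sph_int n f.
Proof.
move=> hf.
have hp j : hform (2 * k).+1 (pd j f) by have := hform_pd j hf; rewrite mulnS.
rewrite -mulrA -(sphZ _ hf).
under [in RHS]eq_fun do rewrite -(hform_euler _ hf).
have hX j : hform (2 * k.+1) (fun x : 'rV[R]_n => x ord0 j * pd j f x).
  by rewrite mulnS; refine (hformX j (hp j)).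
rewrite (sph_sum _ (fun j _ => hX j)).
rewrite mulr_sumr; under [RHS]eq_bigr do rewrite (sph_ibp _ (hp _)).
rewrite laplacianE (@sph_sum n (2 * k)) // => j _.
exact: hform_pd (hp j).
Qed.

End FormAlgebra.

(** * Rotation invariance of the mean *)

Section Orthogonal.
Context {R : realType}.
Implicit Types (n d e k : nat).
Variables (n : nat) (Q : 'M[R]_n).

Lemma hform_mulmx d (f : @fn R n) : hform d f -> hform d (fun x => f (x *m Q)).
Proof.
elim=> {d f} [d|c|d i f hf IH|d f g hf IHf hg IHg].
- exact: hform0.
- exact: hformC.
- rewrite -add1n; apply: hformM => //.
  under eq_fun do rewrite mxE; apply: hform_sum => j _.
  under eq_fun do rewrite mulrC; apply: hformZ; exact: hform_coord.
- exact: hformD.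
Qed.

Lemma pd_mulmx d l (f : @fn R n) : hform d f ->
  pd l (fun x => f (x *m Q)) = fun x => \sum_p Q l p * pd p f (x *m Q).
Proof.
move=> hf; apply/funext => x; elim: hf => {d f} [d|c|d i f hf IH|d f g hf IHf hg IHg].
- by rewrite pd_cst big1 // => p _; rewrite pd_cst mulr0.
- by rewrite pd_cst big1 // => p _; rewrite pd_cst mulr0.
- have hX : hform 1 (fun x : 'rV[R]_n => (x *m Q) ord0 i).
    exact: (hform_mulmx (hform_coord i)).
  rewrite (pdM _ hX (hform_mulmx hf)) IH mulr_sumr.
  have -> : pd l (fun x : 'rV[R]_n => (x *m Q) ord0 i) = fun=> Q l i.
    apply/funext => y.
    transitivity (pd l (fun x : 'rV[R]_n => \sum_j Q j i * x ord0 j) y).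
      by congr (pd l _ y); apply/funext => z; rewrite mxE; apply: eq_bigr => j _; rewrite mulrC.
    rewrite (@pd_sum _ n _ 1) => [|j _]; last by apply: hformZ; exact: hform_coord.
    under eq_bigr do rewrite (pdZ _ _ (hform_coord _)) pd_coord.
    rewrite (bigD1 l) //= eqxx mulr1 big1 ?addr0 // => j /negPf ->; exact: mulr0.
  under [RHS]eq_bigr do rewrite (pdX _ _ hf) mulrDr.
  rewrite big_split /=; congr (_ + _); first by apply: eq_bigr => p _; exact: mulrCA.
  rewrite (bigD1 i) //= eqxx mul1r big1 ?addr0 1?mulrC // => p.
  by rewrite eq_sym => /negPf ->; rewrite mul0r mulr0.
- rewrite (pdD _ (hform_mulmx hf) (hform_mulmx hg)) IHf IHg -big_split /=.
  by apply: eq_bigr => p _; rewrite (pdD _ hf hg) mulrDr.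
Qed.

Hypothesis QQ : Q *m Q^T = 1%:M.

Lemma laplacian_mulmx d (f : @fn R n) : hform d f ->
  laplacian n (fun x => f (x *m Q)) = fun x => laplacian n f (x *m Q).
Proof.
move=> hf; rewrite !laplacianE; apply/funext => x.
have hp p : hform d.-1 (pd p f) by exact: hform_pd.
transitivity (\sum_l \sum_p \sum_q Q l p * (Q l q * pd q (pd p f) (x *m Q))).
  apply: eq_bigr => l _; rewrite (pd_mulmx _ hf).
  rewrite (@pd_sum _ n _ d.-1) => [|p _]; last exact: hformZ (hform_mulmx (hp p)).
  apply: eq_bigr => p _.
  by rewrite (pdZ _ _ (hform_mulmx (hp p))) (pd_mulmx _ (hp p)) mulr_sumr.
have QTQ : Q^T *m Q = 1%:M by exact: mulmx1C.
rewrite exchange_big /=; apply: eq_bigr => p _; rewrite exchange_big.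
transitivity (\sum_q (p == q)%:R * pd q (pd p f) (x *m Q)).
  apply: eq_bigr => q _.
  have := congr1 (fun M : 'M[R]_n => M p q) QTQ; rewrite !mxE => <-.
  by rewrite mulr_suml; apply: eq_bigr => i _; rewrite mxE mulrA.
rewrite (bigD1 p) //= eqxx mul1r -[RHS]addr0; congr (_ + _).
by apply: big1 => q; rewrite eq_sym => /negPf ->; rewrite mul0r.
Qed.

(** No change of variables is made. The Laplacian commutes with [Q], and by [sph_laplacian] it
    determines the mean through a nonzero factor; lowering the degree by two at a time ends at
    constants. *)
Lemma sph_mulmx k (f : @fn R n) : (0 < n)%N -> hform (2 * k) f ->
  sph_int n (fun x => f (x *m Q)) = sph_int n f.
Proof.
move=> n0; elim: k f => [|k IH] f hf.
  by have [c ->] := hform_const hf; rewrite !sph_cst.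
have C0 : (n + 2 * k)%:R * (2 * k.+1)%:R != 0 :> R.
  by rewrite mulf_neq0 // pnatr_eq0 ?mulnS // addn_eq0 negb_and -lt0n n0.
apply: (mulfI C0); rewrite -(sph_laplacian hf) -(sph_laplacian (hform_mulmx hf)).
have hl : hform (2 * k) (laplacian n f) by have := hform_laplacian hf; rewrite mulnS.
by rewrite (laplacian_mulmx hf); exact: IH.
Qed.

End Orthogonal.

(** * Determinants and orthogonal matrices *)

Section PositiveDefinite.
Context {R : realType}.

Definition posdef N (G : 'M[R]_N) : Prop :=
  G^T = G /\ forall v : 'rV[R]_N, v != 0 -> 0 < (v *m G *m v^T) ord0 ord0.

(** Induction on the size: the Schur complement [S] of the corner entry is again positive definite,
    and its factor is bordered by one row and column. *)
Lemma posdef_cholesky N (G : 'M[R]_N) : posdef G ->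
  exists L : 'M[R]_N, [/\ is_trig_mx L, L \in unitmx & G = L *m L^T].
Proof.
elim: N G => [|N IH] G [symG posG].
  by exists 1%:M; split; [by apply/is_trig_mxP => -[] | exact: unitmx1 | by apply/matrixP => -[]].
rewrite -[N.+1]/(1 + N)%N in G symG posG *.
set a := G 0 0; pose b : 'rV[R]_N := ursubmx G; pose C : 'M[R]_N := drsubmx G.
have ulE : ulsubmx G = a%:M.
  by apply/matrixP => i j; rewrite !ord1 !mxE /= mulr1n; congr (G _ _); apply: val_inj.
have dlE : dlsubmx G = b^T by rewrite /b trmx_ursub symG.
have GE : G = block_mx a%:M b b^T C by rewrite -ulE -dlE submxK.
have a0 : 0 < a.
  have := posG (delta_mx 0 0); rewrite -rowE => H.
  have := H _; rewrite mxE (bigD1 0) //= !mxE !eqxx mulr1 big1 ?addr0.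
    apply; apply/negP => /eqP/matrixP/(_ 0 0); rewrite !mxE eqxx => /eqP.
    by rewrite oner_eq0.
  by move=> i i0; rewrite !mxE (negPf i0) andbF mulr0.
have a1 : a != 0 by rewrite gt_eqF.
pose S := C - a^-1 *: (b^T *m b).
have symC : C^T = C by rewrite /C trmx_drsub symG.
have [|L' [trigL' unitL' SE]] := IH S.
  split; first by rewrite /S linearB linearZ /= trmx_mul trmxK symC.
  (* The first entry of [w] is chosen to cancel the cross terms, so that the quadratic form of [G]
     at [w] equals that of [S] at [v]. *)
  move=> v v0; pose w : 'rV[R]_(1 + N) := row_mx (- a^-1 *: (v *m b^T)) v.
  have w0 : w != 0.
    by apply: contra v0 => /eqP w0; rewrite -(row_mxKr (- a^-1 *: (v *m b^T)) v) -/w w0 linear0.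
  suff -> : v *m S *m v^T = w *m G *m w^T by exact: posG.
  rewrite GE /w mul_row_block tr_row_mx mul_row_col.
  rewrite mul_mx_scalar !scalerA mulrN divff // scaleN1r addNr mul0mx add0r.
  congr (_ *m _); rewrite /S mulmxBr -scalemxAr -scalemxAl mulmxA scaleNr.
  by rewrite addrC.
pose s := Num.sqrt a.
have s0 : 0 < s by rewrite sqrtr_gt0.
have s2 : s * s = a by rewrite -expr2 sqr_sqrtr // ltW.
have s1 : s != 0 by rewrite gt_eqF.
exists (block_mx s%:M 0 (s^-1 *: b^T) L'); split.
- by rewrite is_trig_block_mx // eqxx trigL' andbT /=; apply/is_trig_mxP => i j; rewrite !ord1.
- by rewrite unitmxE det_lblock unitrM -!unitmxE unitL' andbT unitmxE det_scalar unitrX ?unitfE.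
- rewrite GE tr_block_mx mulmx_block !trmx0 !mulmx0 !mul0mx !addr0.
  have trZ : (s^-1 *: b^T)^T = s^-1 *: b by rewrite [LHS]linearZ /= trmxK.
  rewrite trZ tr_scalar_mx !mul_scalar_mx mul_mx_scalar scale_scalar_mx s2.
  rewrite !scalerA divff // !scale1r; congr block_mx.
  rewrite -SE -scalemxAl -scalemxAr scalerA -invfM s2 /S.
  by rewrite addrC subrK.
Qed.

(** Hadamard's inequality followed by the inequality of the means. The squared determinant is the
    product of the squared diagonal entries of a Cholesky factor of C C^T, and each of these is at
    most the squared norm of a row of [C]. *)
Lemma det_gram_le m (C : 'M[R]_m) : (0 < m)%N -> C \in unitmx ->
  \sum_i \sum_j C i j ^+ 2 <= 1 -> m%:R ^+ m * \det C ^+ 2 <= 1.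
Proof.
move=> m0 uC HS.
have [|L [trigL unitL E]] := @posdef_cholesky _ (C *m C^T).
  split; first by rewrite trmx_mul trmxK.
  move=> v v0; rewrite mulmxA -mulmxA -trmx_mul mxE.
  have vC : v *m C != 0.
    by apply: contra v0 => /eqP vC; rewrite -[v]mulmx1 -(mulmxV uC) mulmxA vC mul0mx.
  have sq i : 0 <= (v *m C) 0 i * (v *m C)^T i 0 by rewrite [_^T _ _]mxE -expr2 sqr_ge0.
  rewrite lt_def sumr_ge0 // andbT; apply: contra vC => /eqP/psumr_eq0P H.
  apply/eqP/rowP => i; have := H (fun i _ => sq i) i isT.
  by rewrite [_^T _ _]mxE -expr2 => /eqP; rewrite sqrf_eq0 => /eqP ->; rewrite mxE.
have dE : \det C ^+ 2 = \prod_i L i i ^+ 2.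
  have := congr1 determinant E; rewrite !det_mulmx !det_tr -!expr2 => ->.
  by rewrite det_trig // prodrXl.
have LC i : L i i ^+ 2 <= \sum_j C i j ^+ 2.
  have -> : \sum_j C i j ^+ 2 = \sum_j L i j ^+ 2.
    have := congr1 (fun A : 'M[R]_m => A i i) E; rewrite !mxE.
    by under eq_bigr do rewrite mxE -expr2; under [X in _ = X -> _]eq_bigr do rewrite mxE -expr2.
  by rewrite (bigD1 i) //= lerDl sumr_ge0 // => j _; exact: sqr_ge0.
have := @leif_AGM R _ (mem 'I_m) (fun i => L i i ^+ 2) (fun i _ => sqr_ge0 _).
rewrite (_ : #|_| = m); last by rewrite -[RHS]card_ord; apply: eq_card.
move=> /leifP; rewrite dE => AGM.
have {}AGM : \prod_(i in 'I_m) L i i ^+ 2 <= ((\sum_(i in 'I_m) L i i ^+ 2) / m%:R) ^+ m.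
  by move: AGM; case: ifP => _ => [/eqP ->|/ltW].
have mR : 0 < (m%:R : R) by rewrite ltr0n.
have -> : \prod_i L i i ^+ 2 = \prod_(i in 'I_m) L i i ^+ 2 by apply: eq_bigl.
apply: le_trans (ler_wpM2l _ AGM) _; first by rewrite exprn_ge0 // ltW.
rewrite -exprMn mulrCA divff ?gt_eqF // mulr1; apply: exprn_ile1.
  by apply: sumr_ge0 => i _; exact: sqr_ge0.
by apply: le_trans HS; apply: ler_sum => i _; exact: LC.
Qed.

(** Reflection in the hyperplane orthogonal to [w], the difference of the first basis vector and
    [u], swaps the two. As |w|^2 is [2 * c], the usual factor 2/|w|^2 becomes [c^-1]; the case of
    equal vectors is settled apart. *)
Lemma householder N (u : 'rV[R]_N.+1) : u *m u^T = 1%:M ->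
  exists Q : 'M[R]_N.+1, Q *m Q^T = 1%:M /\ forall j, Q ord0 j = u ord0 j.
Proof.
move=> uu; have [->|u1] := eqVneq u (delta_mx 0 0).
  by exists 1%:M; rewrite trmx1 mulmx1; split=> // j; rewrite !mxE eqxx eq_sym.
pose d0 : 'rV[R]_N.+1 := delta_mx 0 0.
pose w := d0 - u; pose c := 1 - u 0 0.
have dd : d0 *m d0^T = 1%:M.
  apply/matrixP => i j; rewrite !ord1 !mxE (bigD1 0) //= !mxE !eqxx mulr1 big1 ?addr0 //.
  by move=> k k0; rewrite !mxE (negPf k0) andbF mul0r.
have du : d0 *m u^T = (u 0 0)%:M.
  by rewrite /d0 -rowE; apply/matrixP => i j; rewrite !ord1 !mxE eqxx mulr1n.
have ud : u *m d0^T = (u 0 0)%:M by rewrite -[LHS]trmxK trmx_mul trmxK du tr_scalar_mx.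
have ww : w *m w^T = (2 * c)%:M.
  rewrite /w linearB /= mulmxBl !mulmxBr dd du ud uu /c.
  rewrite -!raddfB /=; congr (_%:M); ring.
have dw : d0 *m w^T = c%:M by rewrite /w linearB /= mulmxBr dd du -raddfB.
have c0 : c != 0.
  apply/eqP => c0; move/eqP: u1; apply; apply/eqP; rewrite eq_sym -subr_eq0.
  have ww0 : w *m w^T = 0 by rewrite ww c0 mulr0 raddf0.
  have := congr1 (fun A : 'M[R]_1 => A 0 0) ww0; rewrite !mxE => /psumr_eq0P H.
  apply/eqP/rowP => i; rewrite [RHS]mxE; apply/eqP; rewrite -sqrf_eq0 expr2; apply/eqP.
  have := H _ i isT; rewrite [_^T _ _]mxE; apply => j _.
  by rewrite [_^T _ _]mxE -expr2 sqr_ge0.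
pose P := w^T *m w.
have PT : P^T = P by rewrite trmx_mul trmxK.
have PP : P *m P = (2 * c) *: P.
  by rewrite /P mulmxA -(mulmxA w^T w) ww mul_mx_scalar -scalemxAl.
exists (1%:M - c^-1 *: P); split.
  have -> : (1%:M - c^-1 *: P)^T = 1%:M - c^-1 *: P.
    by rewrite [LHS]linearB /= [X in _ - X]linearZ /= PT trmx1.
  rewrite mulmxBl !mulmxBr !mulmx1 mul1mx.
  rewrite -scalemxAr -scalemxAl PP !scalerA.
  have -> : c^-1 / c * (2 * c) = c^-1 + c^-1 by field.
  by rewrite scalerDl opprB addrK subrK.
move=> j; have -> : (1%:M - c^-1 *: P) ord0 j = (d0 *m (1%:M - c^-1 *: P)) ord0 j.
  by rewrite /d0 -rowE [RHS]mxE.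
rewrite mulmxBr mulmx1 -scalemxAr /P mulmxA dw mul_scalar_mx scalerA mulVf // scale1r.
by rewrite /w opprB addrC subrK.
Qed.

End PositiveDefinite.

(** * Orthonormal bases of forms *)

Section InnerProduct.
Context {R : realType}.
Implicit Types (d e k : nat).
Variable n : nat.
Implicit Types (f g h : @fn R n).

Lemma ipC f g : ip n f g = ip n g f.
Proof. by apply: eq_sph => x; rewrite mulrC. Qed.

Lemma ipDl d e f g h : hform d f -> hform d g -> hform e h ->
  ip n (fun x => f x + g x) h = ip n f h + ip n g h.
Proof.
move=> hf hg hh; rewrite /ip -(sphD (hformM hf hh) (hformM hg hh)).
by apply: eq_sph => x; rewrite mulrDl.
Qed.

Lemma ipZl d e c f h : hform d f -> hform e h ->
  ip n (fun x => c * f x) h = c * ip n f h.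
Proof.
move=> hf hh; rewrite /ip -(sphZ c (hformM hf hh)).
by apply: eq_sph => x; rewrite mulrA.
Qed.

Lemma ipDr d e f g h : hform d f -> hform d g -> hform e h ->
  ip n h (fun x => f x + g x) = ip n h f + ip n h g.
Proof. by move=> hf hg hh; rewrite ipC (ipDl hf hg hh) (ipC f) (ipC g). Qed.

Lemma ipZr d e c f h : hform d f -> hform e h ->
  ip n h (fun x => c * f x) = c * ip n h f.
Proof. by move=> hf hh; rewrite ipC (ipZl c hf hh) (ipC f). Qed.

Lemma ip_suml d e I (r : seq I) (F : I -> @fn R n) h : (forall i, hform d (F i)) -> hform e h ->
  ip n (fun x => \sum_(i <- r) F i x) h = \sum_(i <- r) ip n (F i) h.
Proof.
move=> hF hh; rewrite /ip -(sph_sum (d := (d + e))) => [|i _]; last exact (hformM (hF i) hh).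
by apply: eq_sph => x; rewrite mulr_suml.
Qed.

Lemma ip_sumr d e I (r : seq I) (F : I -> @fn R n) h : (forall i, hform d (F i)) -> hform e h ->
  ip n h (fun x => \sum_(i <- r) F i x) = \sum_(i <- r) ip n h (F i).
Proof.
move=> hF hh; rewrite ipC (ip_suml r hF hh); apply: eq_bigr => i _; exact: ipC.
Qed.

Lemma ip_ge0 f : 0 <= ip n f f.
Proof. by apply: sph_ge0 => x; rewrite -expr2 sqr_ge0. Qed.

Lemma ip_null d f g : hform d f -> hform d g -> ip n f f = 0 -> ip n f g = 0.
Proof.
move=> hf hg f0; apply/eqP/negPn/negP => a0.
(* With this [t] the squared norm of g + t f would be -1. *)
pose t := - (ip n g g + 1) / (2 * ip n f g).
have hT := hformZ t hf.
have := ip_ge0 (fun x => g x + t * f x).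
rewrite (ipDl hg hT (hformD hg hT)) (ipDr hg hT hg) (ipDr hg hT hT) (ipZl t hf hg) (ipZr t hf hg) (ipZl t hf hT) (ipZr t hf hf).
rewrite f0 !mulr0 addr0 (ipC g f).
have -> : t * ip n f g = - (ip n g g + 1) / 2 by rewrite /t; field.
lra.
Qed.

(* [f] is orthogonal to every form, so by parts are its partial derivatives. *)
Lemma ip_definite d f : (0 < n)%N -> hform d f -> ip n f f = 0 -> f = fun=> 0.
Proof.
move=> n0; elim: d f => [|d IH] f hf f0.
  have [c fc] := hform_const hf; move: f0; rewrite fc /ip sph_cst => /eqP.
  by rewrite mulf_eq0 orbb => /eqP ->.
have orth g : hform d.+1 g -> ip n f g = 0 by move=> hg; exact: ip_null hf hg f0.
have dpd j : pd j f = fun=> 0.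
  have hp : hform d (pd j f) by have := hform_pd j hf.
  apply: IH => //.
  have hfp : hform (2 * d).+1 (fun x => f x * pd j f x).
    by rewrite mul2n -addnn -addSn; exact (hformM hf hp).
  have E1 := sph_ibp j hfp.
  have E2 : sph_int n (fun x => x ord0 j * (f x * pd j f x)) = 0.
    rewrite -(orth _ (hformX j hp)) /ip; congr (sph_int n _).
    by apply/funext => x; rewrite mulrCA.
  have hpp := hform_pd j hp.
  (* The second derivative has degree too low by two; multiplying it by [r2], which is 1 on the
     sphere, gives a form to which the orthogonality of [f] applies. *)
  have E3 : sph_int n (fun x => f x * pd j (pd j f) x) = 0.
    case: d hf orth hp hfp E1 hpp => [|d] hf orth hp hfp E1 hpp.
      have [c ->] := hform_const hp; rewrite pd_cst.
      by under eq_fun do rewrite mulr0; rewrite sph_cst.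
    have h2 := hformM (hform_r2 n) hpp.
    have hq : hform (2 * d.+1) (fun x => f x * pd j (pd j f) x).
      by have := hformM hf hpp; rewrite /= mul2n -addnn addnS addSn.
    rewrite -(sph_r2 n0 hq) -(orth _ h2) /ip.
    by apply: eq_sph => x; rewrite mulrCA.
  move: E1; rewrite E2 mulr0 (pdM _ hf hp).
  have h1 : hform (2 * d) (fun x => f x * pd j (pd j f) x).
    case: d hf orth hp hfp hpp E3 => [|d] hf orth hp hfp hpp E3.
      have [c ->] := hform_const hp; rewrite pd_cst.
      by under eq_fun do rewrite mulr0; exact: hform0.
    by have := hformM hf hpp; rewrite /= mul2n -addnn addnS addSn.
  have h2 : hform (2 * d) (fun x => pd j f x * pd j f x).
    by rewrite mul2n -addnn; exact (hformM hp hp).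
  by rewrite (sphD h1 h2) E3 add0r => E; exact (esym E).
apply/funext => x; apply: (@mulfI _ (d.+1%:R : R)); first by rewrite pnatr_eq0.
rewrite mulr0 -(hform_euler _ hf) big1 // => j _; by rewrite dpd mulr0.
Qed.

End InnerProduct.

Section MonomialBasis.
Context {R : realType}.

Lemma digits_inj (B n : nat) (f g : nat -> nat) :
  (forall i, (i < n)%N -> (f i < B)%N) -> (forall i, (i < n)%N -> (g i < B)%N) ->
  (\sum_(i < n) f i * B ^ i = \sum_(i < n) g i * B ^ i)%N ->
  forall i, (i < n)%N -> f i = g i.
Proof.
elim: n f g => [//|n IH] f g fB gB.
have split (h : nat -> nat) : (\sum_(i < n.+1) h i * B ^ i = (\sum_(i < n) h i.+1 * B ^ i) * B + h 0)%N.
  rewrite big_ord_recl expn0 muln1 addnC big_distrl /=; congr (_ + _)%N.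
  by apply: eq_bigr => i _; rewrite -mulnA -expnSr.
rewrite !split => E.
have B0 : (0 < B)%N by apply: leq_ltn_trans (fB 0%N isT).
have E0 : f 0%N = g 0%N.
  by have := congr1 (modn^~ B) E; rewrite !modnMDl !modn_small ?fB ?gB.
have E1 : (\sum_(i < n) f i.+1 * B ^ i = \sum_(i < n) g i.+1 * B ^ i)%N.
  by move: E; rewrite E0 => /addIn/eqP; rewrite eqn_pmul2r // => /eqP.
case=> // i; rewrite ltnS => ilt.
by apply: (IH (fun i => f i.+1) (fun i => g i.+1)) => // j jn; [exact: fB | exact: gB].
Qed.

Lemma poly_eq0_horner (p : {poly R}) : (forall x, p.[x] = 0) -> p = 0.
Proof.
move=> p0; apply/eqP/negPn/negP => pn0.
have := max_poly_roots pn0 (rs := [seq i%:R | i <- iota 0 (size p)]).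
rewrite size_map size_iota ltnn => H; suff : false by []; apply: H.
  by apply/allP => x _; apply/rootP.
by rewrite map_inj_uniq ?iota_uniq // => i j /eqP; rewrite eqr_nat => /eqP.
Qed.

Lemma card_monomials n d : (0 < n)%N ->
  #|[pred a : {ffun 'I_n -> 'I_d.+1} | (\sum_(i < n) (a i : nat))%N == d]| = Ddim n d.
Proof.
case: n => // n _; rewrite /Ddim addSn subn1 /= -bin_sub ?leq_addl // addnK.
rewrite -card_ord_partitions.
pose F (t : n.+1.-tuple 'I_d.+1) : {ffun 'I_n.+1 -> 'I_d.+1} := [ffun i => tnth t i].
have Finj : injective F.
  by move=> s t /ffunP E; apply: eq_from_tnth => i; have := E i; rewrite !ffunE.
rewrite -(fintype.card_image Finj); apply: eq_card => a; rewrite inE; apply/idP/fintype.imageP.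
  move=> ad; exists [tuple a i | i < n.+1].
    rewrite inE big_tuple -[X in _ == X](eqP ad); apply/eqP.
    by apply: eq_bigr => i _; rewrite tnth_mktuple.
  by apply/ffunP => i; rewrite ffunE tnth_mktuple.
case=> t; rewrite inE big_tuple => /eqP td ->; apply/eqP; rewrite -[RHS]td.
by apply: eq_bigr => i _; rewrite ffunE.
Qed.

Definition monomial n (b : 'I_n -> nat) : @fn R n := fun x => \prod_i x ord0 i ^+ b i.

(** Independence is by Kronecker substitution: putting t^((d+1)^l) for the variable of index l sends
    distinct monomials to distinct powers of t, because the exponents are at most d and act as
    digits in base d+1. *)
Lemma monomial_basis n d N : (0 < n)%N -> N = Ddim n d ->
  exists a : 'I_N -> 'I_n -> nat, [/\ forall i, hform d (monomial (a i)),
    (forall f : @fn R n, hform d f ->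
      exists c : 'rV[R]_N, f = fun x => \sum_i c ord0 i * monomial (a i) x) &
    (forall c : 'rV[R]_N, (forall x, \sum_i c ord0 i * monomial (a i) x = 0) -> c = 0)].
Proof.
move=> n0 ->; rewrite -(card_monomials d n0).
set A := [pred a : {ffun 'I_n -> 'I_d.+1} | _].
exists (fun i l => (enum_val i : {ffun 'I_n -> 'I_d.+1}) l : nat); split.
- move=> i; have /eqP E := enum_valP i.
  by have := hform_monomial (R := R) (fun l => enum_val i l : nat); rewrite E.
- move=> f /is_formP[c ->]; exists (\row_i c (enum_val i)); apply/funext => x.
  transitivity (\sum_(a in A) c a * \prod_(i < n) x ord0 i ^+ a i); first exact: eq_bigl.
  by rewrite big_enum_val; apply: eq_bigr => i _; rewrite mxE.
move=> c c0; pose e (i : 'I_#|A|) := (\sum_(l < n) (enum_val i : {ffun 'I_n -> 'I_d.+1}) l * d.+1 ^ l)%N.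
have e_inj : injective e.
  move=> i j E; apply: enum_val_inj; apply/ffunP => l; apply: val_inj.
  pose F (b : {ffun 'I_n -> 'I_d.+1}) (m : nat) : nat := if insub m is Some l then b l else 0%N.
  have FE (b : {ffun 'I_n -> 'I_d.+1}) (m : 'I_n) : F b m = b m by rewrite /F valK.
  have Fd b m : (F b m < d.+1)%N by rewrite /F; case: insub.
  have := @digits_inj d.+1 n (F (enum_val i)) (F (enum_val j)) (fun m _ => Fd _ m) (fun m _ => Fd _ m).
  under eq_bigr do rewrite FE; under [X in _ = X -> _]eq_bigr do rewrite FE.
  by move=> /(_ E l (ltn_ord l)); rewrite !FE.
pose p : {poly R} := \sum_i c ord0 i *: 'X^(e i).
have p0 : p = 0.
  apply: poly_eq0_horner => t; rewrite /p horner_sum -[RHS](c0 (\row_l t ^+ (d.+1 ^ l))).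
  apply: eq_bigr => i _; rewrite hornerZ hornerXn; congr (_ * _).
  rewrite /monomial /e -prodrXr; apply: eq_bigr => l _.
  by rewrite mxE -exprM mulnC.
apply/rowP => i; rewrite mxE; have := congr1 (fun q : {poly R} => q`_(e i)) p0.
rewrite coef0 coef_sum (bigD1 i) //= coefZ coefXn eqxx mulr1 big1 ?addr0 // => j ji.
by rewrite coefZ coefXn (inj_eq e_inj) eq_sym (negPf ji) mulr0.
Qed.

End MonomialBasis.

Section OrthonormalBasis.
Context {R : realType}.
Variable n : nat.

Definition onb d N (e : 'I_N -> @fn R n) : Prop :=
  [/\ forall i, hform d (e i),
      forall i j, ip n (e i) (e j) = (i == j)%:R &
      forall f, hform d f -> f = fun x => \sum_i ip n f (e i) * e i x].

Definition lincomb N (c : 'I_N -> R) (g : 'I_N -> @fn R n) : @fn R n :=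
  fun x => \sum_i c i * g i x.

Lemma hform_lincomb d N (c : 'I_N -> R) g : (forall i, hform d (g i)) -> hform d (lincomb c g).
Proof. by move=> hg; apply: hform_sum => i _; exact: hformZ. Qed.

Lemma ip_lincombl d e N (c : 'I_N -> R) g h : (forall i, hform d (g i)) -> hform e h ->
  ip n (lincomb c g) h = \sum_i c i * ip n (g i) h.
Proof.
move=> hg hh; rewrite /lincomb (ip_suml _ (d := d) _ hh) => [|i]; last exact: hformZ.
by apply: eq_bigr => i _; rewrite (ipZl (c i) (hg i) hh).
Qed.

Lemma ip_lincombr d e N (c : 'I_N -> R) g h : (forall i, hform d (g i)) -> hform e h ->
  ip n h (lincomb c g) = \sum_i c i * ip n h (g i).
Proof.
move=> hg hh; rewrite ipC (ip_lincombl _ hg hh).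
by apply: eq_bigr => i _; rewrite (ipC h).
Qed.

Lemma onb_coord d N (e : 'I_N -> @fn R n) c j : onb d e -> ip n (lincomb c e) (e j) = c j.
Proof.
move=> [he eo _]; rewrite (ip_lincombl c he (he j)) (bigD1 j) //= eo eqxx mulr1 big1 ?addr0 //.
by move=> i /negPf ij; rewrite eo ij mulr0.
Qed.

Lemma onb_parseval d N (e : 'I_N -> @fn R n) f g : onb d e -> hform d f -> hform d g ->
  ip n f g = \sum_i ip n f (e i) * ip n g (e i).
Proof.
move=> [he eo es] hf hg; rewrite {1}(es f hf).
rewrite (ip_lincombl _ he hg); apply: eq_bigr => i _; by rewrite (ipC g).
Qed.

(** Gram-Schmidt in matrix form: if L L^T is the Gram matrix of the monomials, the rows of the
    inverse of L are the coefficients of an orthonormal basis. *)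
Lemma onb_exists d N : (0 < n)%N -> N = Ddim n d -> exists e : 'I_N -> @fn R n, onb d e.
Proof.
move=> n0 hN; have [a [ha span indep]] := monomial_basis (R := R) n0 hN.
pose mon i := monomial (R := R) (a i).
pose G := \matrix_(i, j) ip n (mon i) (mon j) : 'M[R]_N.
have GE (u v : 'rV[R]_N) : (u *m G *m v^T) ord0 ord0 =
    ip n (lincomb (u ord0) mon) (lincomb (v ord0) mon).
  rewrite (ip_lincombr _ ha (hform_lincomb _ ha)) mxE; apply: eq_bigr => j _.
  rewrite (ip_lincombl _ ha (ha j)) !mxE mulrC; congr (_ * _).
  by apply: eq_bigr => i _; rewrite mxE.
have [|L [trigL unitL LE]] := @posdef_cholesky R N G.
  split; first by apply/matrixP => i j; rewrite !mxE ipC.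
  move=> v v0; rewrite GE lt_def ip_ge0 andbT; apply: contra v0 => /eqP v0.
  apply/eqP/indep => x.
  have := ip_definite n0 (hform_lincomb _ ha) v0.
  by move/(congr1 (fun f => f x)).
pose P := invmx L.
pose e i := lincomb (P i) mon.
have he i : hform d (e i) by exact: hform_lincomb.
have eo i j : ip n (e i) (e j) = (i == j)%:R.
  have := GE (row i P) (row j P).
  have rE l : row l P ord0 = P l by apply/funext => m; rewrite mxE.
  rewrite !rE -/(e i) -/(e j) => <-.
  have : P *m G *m P^T = 1%:M.
    by rewrite LE mulmxA mulVmx // mul1mx /P -trmx_mul mulVmx // trmx1.
  move/(congr1 (fun A : 'M[R]_N => A i j)); rewrite [in RHS]mxE => <-.
  rewrite -row_mul [LHS]mxE [RHS]mxE; apply: eq_bigr => l _.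
  by congr (_ * _); rewrite !mxE.
exists e; split=> // f hf.
have [c fE] := span f hf.
have fE' : f = lincomb ((c *m L) ord0) e.
  rewrite fE; apply/funext => x; rewrite /lincomb.
  transitivity (\sum_i (c *m L *m P) ord0 i * mon i x).
    by rewrite -mulmxA mulmxV // mulmx1.
  rewrite /e /lincomb; under [RHS]eq_bigr do rewrite mulr_sumr.
  rewrite exchange_big /=; apply: eq_bigr => i _; rewrite mxE mulr_suml.
  by apply: eq_bigr => j _; rewrite mulrA.
have co j : ip n f (e j) = (c *m L) ord0 j.
  rewrite fE' (ip_lincombl _ he (he j)) (bigD1 j) //= eo eqxx mulr1 big1 ?addr0 //.
  by move=> i /negPf ij; rewrite eo ij mulr0.
by rewrite {1}fE'; apply/funext => x; apply: eq_bigr => i _; rewrite co.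
Qed.

Lemma onb_rotate d N (e : 'I_N -> @fn R n) (Q : 'M[R]_N) : Q *m Q^T = 1%:M -> onb d e ->
  onb d (fun i => lincomb (Q i) e).
Proof.
move=> QQ E; have [he eo es] := E.
split=> [i|i j|f hf]; first exact: hform_lincomb.
  rewrite (ip_lincombl _ he (hform_lincomb _ he)).
  have := congr1 (fun A : 'M[R]_N => A i j) QQ; rewrite [in RHS]mxE => <-; rewrite mxE.
  by apply: eq_bigr => l _; rewrite mxE ipC (onb_coord _ _ E).
have QTQ : Q^T *m Q = 1%:M by exact: mulmx1C.
rewrite {1}(es f hf); apply/funext => x.
under [RHS]eq_bigr do rewrite (ip_lincombr _ he hf) /lincomb mulr_suml.
under [RHS]eq_bigr do under eq_bigr do rewrite mulr_sumr.
rewrite exchange_big /=; apply: eq_bigr => j _; rewrite exchange_big /=.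
transitivity (\sum_l (j == l)%:R * (ip n f (e j) * e l x)).
  rewrite (bigD1 j) //= eqxx mul1r big1 ?addr0 // => l; rewrite eq_sym => /negPf ->.
  by rewrite mul0r.
apply: eq_bigr => l _.
have := congr1 (fun A : 'M[R]_N => A j l) QTQ; rewrite [in RHS]mxE => <-.
rewrite mxE mulr_suml; apply: eq_bigr => i _; rewrite mxE; ring.
Qed.

(** An arbitrary orthonormal basis is rotated by an orthogonal matrix whose first row holds the
    coordinates of [f]. *)
Lemma onb_exists_unit d m f : (0 < n)%N -> m.+1 = Ddim n d -> hform d f -> ip n f f = 1 ->
  exists e : 'I_m.+1 -> @fn R n, onb d e /\ e ord0 = f.
Proof.
move=> n0 hN hf ff; have [e E] := onb_exists n0 hN.
pose u : 'rV[R]_m.+1 := \row_i ip n f (e i).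
have [|Q [QQ Q0]] := @householder R m u.
  apply/matrixP => i j; rewrite !ord1 !mxE eqxx -[RHS]ff (onb_parseval E hf hf).
  by apply: eq_bigr => l _; rewrite !mxE.
exists (fun i => lincomb (Q i) e); split; first exact: onb_rotate.
have [_ _ es] := E; rewrite [RHS](es f hf); apply/funext => x; apply: eq_bigr => i _.
by rewrite Q0 mxE.
Qed.

(** The matrix [A] passing from one basis to the other is orthogonal, so it preserves the norm of
    the vector of values at [v]. *)
Lemma onb_change d N (e e' : 'I_N -> @fn R n) v : onb d e -> onb d e' ->
  \sum_i e' i v ^+ 2 = \sum_i e i v ^+ 2.
Proof.
move=> E E'; have [he eo es] := E; have [he' eo' es'] := E'.
pose A : 'M[R]_N := \matrix_(i, j) ip n (e' i) (e j).
have AA : A *m A^T = 1%:M.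
  apply/matrixP => i j; rewrite !mxE -eo' (onb_parseval E (he' i) (he' j)).
  by apply: eq_bigr => l _; rewrite !mxE.
have AE : \col_i e' i v = A *m \col_i e i v.
  apply/matrixP => i j; rewrite !mxE.
  have /(congr1 (fun f => f v)) /= -> := es (e' i) (he' i).
  by apply: eq_bigr => l _; rewrite !mxE.
have sq (g : 'I_N -> @fn R n) : \sum_i g i v ^+ 2 = ((\col_i g i v)^T *m \col_i g i v) ord0 ord0.
  by rewrite mxE; apply: eq_bigr => i _; rewrite !mxE expr2.
by rewrite !sq AE trmx_mul mulmxA -[_ *m A]mulmxA (mulmx1C AA) mulmx1.
Qed.

Lemma onb_mulmx d N (e : 'I_N -> @fn R n) (Q : 'M[R]_n) : (0 < n)%N -> Q *m Q^T = 1%:M ->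
  onb d e -> onb d (fun i x => e i (x *m Q)).
Proof.
move=> n0 QQ [he eo es]; split=> [i|i j|f hf]; first exact: hform_mulmx.
  have hij : hform (2 * d) (fun x => e i x * e j x).
    by rewrite mul2n -addnn; exact (hformM (he i) (he j)).
  by rewrite -eo; exact (sph_mulmx QQ n0 hij).
pose g x := f (x *m Q^T).
have hg : hform d g by exact: hform_mulmx.
have fE : f = fun x => g (x *m Q).
  by apply/funext => x; rewrite /g -mulmxA QQ mulmx1.
rewrite {1}fE (es g hg); apply/funext => x; apply: eq_bigr => i _; congr (_ * _).
have hgi : hform (2 * d) (fun x => g x * e i x).
  by rewrite mul2n -addnn; exact (hformM hg (he i)).
transitivity (sph_int n (fun x => g (x *m Q) * e i (x *m Q))).
  exact (esym (sph_mulmx QQ n0 hgi)).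
by apply: eq_sph => y; rewrite /g -mulmxA QQ mulmx1.
Qed.

Lemma unit_sphere_rotation (v : 'rV[R]_n) : (0 < n)%N -> r2 n v = 1 ->
  forall w : 'rV[R]_n, r2 n w = 1 -> exists Q : 'M[R]_n, Q *m Q^T = 1%:M /\ w *m Q = v.
Proof.
case: n v => // n' v _ v1.
have H (z : 'rV[R]_n'.+1) : r2 n'.+1 z = 1 ->
    exists Q : 'M[R]_n'.+1, Q *m Q^T = 1%:M /\ delta_mx 0 0 *m Q = z.
  move=> z1; have [|Q [QQ Q0]] := @householder R n' z.
    apply/matrixP => i j; rewrite !ord1 !mxE eqxx -[RHS]z1 /r2.
    by apply: eq_bigr => l _; rewrite !mxE expr2.
  by exists Q; split=> //; apply/rowP => j; rewrite -rowE mxE Q0.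
move=> w /H[Q1 [Q1Q E1]]; have [Q2 [Q2Q E2]] := H v v1.
exists (Q1^T *m Q2); split.
  by rewrite trmx_mul trmxK mulmxA -(mulmxA Q1^T Q2) Q2Q mulmx1; exact: mulmx1C.
by rewrite -E1 -!mulmxA (mulmxA Q1) Q1Q mul1mx.
Qed.

(* The reproducing kernel of the forms of degree [d], on the diagonal. *)
Lemma onb_kernel d N (e : 'I_N -> @fn R n) v : (0 < n)%N -> onb d e -> r2 n v = 1 ->
  \sum_i e i v ^+ 2 = N%:R.
Proof.
move=> n0 E v1; have [he eo _] := E.
pose K : @fn R n := fun x => \sum_i e i x ^+ 2.
(* [K] does not depend on the basis, and a rotated basis is again orthonormal; hence [K] is constant
   on the sphere. The constant is its mean, in which every basis element contributes 1. *)
have inv w : r2 n w = 1 -> K w = K v.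
  move=> w1; have [Q [QQ wQ]] := unit_sphere_rotation n0 v1 w1.
  rewrite /K -(onb_change w E (onb_mulmx n0 QQ E)).
  by apply: eq_bigr => i _; rewrite wQ.
have hsq i : hform (2 * d) (fun x => e i x ^+ 2).
  by under eq_fun do rewrite expr2; rewrite mul2n -addnn; exact (hformM (he i) (he i)).
have hK : hform (2 * d) K by apply: hform_sum => i _; exact: hsq.
have KE : K = fun x => K v * r2 n x ^+ d.
  apply/funext => x; rewrite (hform_sph x hK).
  have [x0|x0] := eqVneq (r2 n x) 0; last first.
    rewrite (inv (sph_proj x)) 1?mulrC // /sph_proj r2Z exprVn sqr_sqrtr ?r2_ge0 //.
    by rewrite mulVf.
  case: d {E he eo hsq inv} hK => [|d] hK; last by rewrite x0 expr0n mul0r mulr0.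
  by have [c ->] := hform_const hK; rewrite mul1r mulr1.
have sphr2 : sph_int n (fun x : 'rV[R]_n => r2 n x ^+ d) = 1.
  elim: d {E he eo hsq hK KE inv} => [|m IH]; first by rewrite sph_cst.
  by under eq_fun do rewrite exprS; rewrite (sph_r2 n0 (hform_r2X n m)).
transitivity (sph_int n (fun x => K v * r2 n x ^+ d)).
  by rewrite (sphZ _ (hform_r2X n d)) sphr2 mulr1.
rewrite -KE /K (sph_sum _ (fun i _ => hsq i)).
rewrite (eq_bigr (fun=> 1)) ?sumr_const ?card_ord // => i _.
transitivity (ip n (e i) (e i)); last by rewrite eo eqxx.
by apply: eq_sph => x; rewrite expr2.
Qed.

End OrthonormalBasis.

(** * The Funk-Hecke operator and harmonic decomposition *)

Section PowerKernel.
Context {R : realType}.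
Variable n : nat.
Hypothesis n0 : (0 < n)%N.

Definition dotp (a x : 'rV[R]_n) : R := \sum_(i < n) a ord0 i * x ord0 i.

Lemma dotpC a x : dotp a x = dotp x a.
Proof. by apply: eq_bigr => i _; rewrite mulrC. Qed.

Lemma hform_dotp a : hform 1 (dotp a).
Proof. by apply: hform_sum => i _; apply: hformZ; exact: hform_coord. Qed.

Lemma hform_dotpX a d : hform d (fun x => dotp a x ^+ d).
Proof. by have := hformXn d (hform_dotp a); rewrite muln1. Qed.

Lemma pd_dotp a j : pd j (dotp a) = fun=> a ord0 j.
Proof.
have hc (i : 'I_n) : true -> hform 1 (fun x : 'rV[R]_n => a ord0 i * x ord0 i).
  by move=> _; apply: hformZ; exact: hform_coord.
rewrite /dotp (pd_sum j _ hc); apply/funext => x.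
rewrite (eq_bigr (fun i => a ord0 i * (i == j)%:R)); last first.
  by move=> i _; rewrite (pdZ _ _ (hform_coord i)) pd_coord.
rewrite (bigD1 j) //= eqxx mulr1 big1 ?addr0 // => i /negPf ->; exact: mulr0.
Qed.

Lemma pd_dotpX a j d :
  pd j (fun x => dotp a x ^+ d.+1) = fun x => d.+1%:R * (a ord0 j * dotp a x ^+ d).
Proof.
elim: d => [|d IH].
  under eq_fun do rewrite expr1; rewrite (_ : (fun x => dotp a x) = dotp a) //.
  by rewrite pd_dotp; apply/funext => x; rewrite expr0 mul1r mulr1.
under eq_fun do rewrite exprS.
rewrite (pdM _ (hform_dotp a) (hform_dotpX a d.+1)) IH pd_dotp; apply/funext => x.
rewrite -[d.+2]addn1 natrD exprS; ring.
Qed.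

(** Separating the variables of the kernel spares any double integral: forms in x come out of the
    mean over v as coefficients, and the symmetry of the kernel becomes an exchange of [p] and
    [q]. *)
Lemma dotpX_split d : exists (I : finType) (p q : I -> @fn R n),
  [/\ forall i, hform d (p i), forall i, hform d (q i) &
      forall x v, dotp x v ^+ d = \sum_i p i x * q i v].
Proof.
elim: d => [|d [I [p [q [hp hq E]]]]].
  exists unit, (fun _ _ => 1), (fun _ _ => 1); split=> [_|_|x v]; do ?exact: hformC.
  by rewrite expr0 (bigD1 tt) //= big1 ?addr0 ?mulr1 // => -[].
exists ('I_n * I)%type, (fun s (x : 'rV[R]_n) => x ord0 s.1 * p s.2 x),
  (fun s (x : 'rV[R]_n) => x ord0 s.1 * q s.2 x).
split=> [s|s|x v]; do ?by apply: hformX.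
rewrite exprS E /dotp mulr_suml -(pair_bigA _ (fun l i => x ord0 l * p i x * (v ord0 l * q i v))) /=.
apply: eq_bigr => l _; rewrite mulr_sumr; apply: eq_bigr => i _; ring.
Qed.

(* The Funk-Hecke operator: it acts on [r^(2m) H_(n,b)] as the scalar [gam b m] below. *)
Definition powT d (f : @fn R n) : @fn R n := fun x => ip n (fun v => dotp x v ^+ d) f.

Lemma powT_split d (I : finType) (p q : I -> @fn R n) f :
  (forall i, hform d (q i)) -> (forall x v, dotp x v ^+ d = \sum_i p i x * q i v) ->
  hform d f -> powT d f = fun x => \sum_i ip n (q i) f * p i x.
Proof.
move=> hq E hf; apply/funext => x; rewrite /powT.
under [X in ip n X]eq_fun do rewrite E.
rewrite (ip_suml _ (d := d) _ hf) => [|i]; last exact: hformZ.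
by apply: eq_bigr => i _; rewrite (ipZl _ (hq i) hf) mulrC.
Qed.

Lemma hform_powT d f : hform d f -> hform d (powT d f).
Proof.
have [I [p [q [hp hq E]]]] := dotpX_split d.
by move=> hf; rewrite (powT_split hq E hf); apply: hform_sum => i _; exact: hformZ.
Qed.

Lemma powT_sym d f g : hform d f -> hform d g -> ip n (powT d f) g = ip n f (powT d g).
Proof.
have [I [p [q [hp hq E]]]] := dotpX_split d => hf hg.
have E' x v : dotp x v ^+ d = \sum_i q i x * p i v.
  by rewrite dotpC E; apply: eq_bigr => i _; rewrite mulrC.
rewrite (powT_split hq E hf) (powT_split hp E' hg).
rewrite (ip_suml _ (d := d) _ hg) => [|i]; last exact: hformZ.
rewrite (ip_sumr _ (d := d) _ hf) => [|i]; last exact: hformZ.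
apply: eq_bigr => i _; rewrite (ipZl _ (hp i) hg) (ipZr _ (hq i) hf).
by rewrite (ipC f) mulrC.
Qed.

Lemma powT_lincomb d N (c : 'I_N -> R) g : (forall i, hform d (g i)) ->
  powT d (lincomb c g) = lincomb c (fun i => powT d (g i)).
Proof.
by move=> hg; apply/funext => x; rewrite /powT (ip_lincombr c hg (hform_dotpX x d)).
Qed.

Lemma pd_comm d i j (f : @fn R n) : hform d f -> pd i (pd j f) = pd j (pd i f).
Proof.
elim=> {d f} [d|c|d l f hf IH|d f g hf IHf hg IHg].
- by rewrite !pd_cst.
- by rewrite !pd_cst.
- have hi := hform_pd i hf; have hj := hform_pd j hf.
  rewrite (pdX j l hf) (pdX i l hf).
  have E (a b : 'I_n) : pd a (fun x => x ord0 l * pd b f x + (l == b)%:R * f x) =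
    fun x => (x ord0 l * pd a (pd b f) x + (l == a)%:R * pd b f x) + (l == b)%:R * pd a f x.
    apply/funext => x; rewrite /pd.
    have hb := hform_pd b hf.
    have h1 := hformX l hb; have h2 := hformZ (l == b)%:R hf.
    have := congr1 (fun F => F x) (pdD a h1 h2); rewrite /pd => ->.
    have := congr1 (fun F => F x) (pdX a l hb); rewrite /pd => ->.
    by have := congr1 (fun F => F x) (pdZ a (l == b)%:R hf); rewrite /pd => ->.
  rewrite !E IH; apply/funext => x; ring.
- have hi := hform_pd i; have hj := hform_pd j.
  by rewrite (pdD j hf hg) (pdD i hf hg) (pdD i (hj _ _ _ hf) (hj _ _ _ hg)) (pdD j (hi _ _ _ hf) (hi _ _ _ hg)) IHf IHg.
Qed.

(** For [b] = 0 these are the moments of a coordinate on the sphere, 1 3 ... (2m-1) / (n (n+2) ...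
    (n+2m-2)). Each further factor is the cost of one integration by parts against a harmonic form
    of degree one higher. *)
Fixpoint gam (b m : nat) : R :=
  match b with
  | 0%N => \prod_(s < m) ((2 * s + 1)%:R / (n + 2 * s)%:R)
  | b'.+1 => (b' + 1 + 2 * m)%:R / (n + 2 * b' + 2 * m)%:R * gam b' m
  end.

Lemma gam_gt0 b m : 0 < gam b m.
Proof.
elim: b => [|b IH] /=.
  by apply: prodr_gt0 => s _; rewrite divr_gt0 // ltr0n ?addn1 // addn_gt0 n0.
by rewrite mulr_gt0 // divr_gt0 // ltr0n ?addn1 // !addn_gt0 n0.
Qed.

Lemma gamS b m :
  gam b.+1 m = (b + 1 + 2 * m)%:R / (n + 2 * b + 2 * m)%:R * gam b m.
Proof. by []. Qed.

(** Compares neighbouring harmonic components at equal total degree b + 2m + 2. Both the strict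
    decrease of the scalars and the Gamma quotients rest on this recurrence. *)
Lemma gam_step b m : (n + 2 * m + 2 * b + 2)%:R * gam b.+2 m = (2 * m + 2)%:R * gam b m.+1.
Proof.
have nz (s : nat) : ((n + s)%:R : R) != 0 by rewrite pnatr_eq0 -lt0n addn_gt0 n0.
elim: b => [|b IH].
  rewrite /= big_ord_recr /=; set P := \prod_(i < m) _.
  have h1 : n%:R + (m%:R + m%:R) != 0 :> R by rewrite -!natrD nz.
  have h2 : n%:R + 2 + (m%:R + m%:R) != 0 :> R by rewrite -!natrD -addnA nz.
  rewrite !natrD !natrM; field.
  by rewrite h1 h2.
have X0 := nz (2 * m + 2 * b + 2)%N.
rewrite 2!addnA in X0.
rewrite (gamS b.+2) (gamS b).
have -> : (n + 2 * m + 2 * b.+1 + 2)%N = (n + 2 * b.+2 + 2 * m)%N by lia.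
have -> : (n + 2 * b + 2 * m.+1)%N = (n + 2 * m + 2 * b + 2)%N by lia.
have -> : (b + 1 + 2 * m.+1)%N = (b.+2 + 1 + 2 * m)%N by lia.
have Y0 := nz (2 * b.+2 + 2 * m)%N; rewrite addnA in Y0.
have alg (X Y A C G H : R) : X != 0 -> Y != 0 -> X * G = C * H ->
    Y * (A / Y * G) = C * (A / X * H).
  move=> x0 y0 E; have -> : G = C * H / X by rewrite -E; field.
  by field; rewrite ?x0 ?y0.
exact: alg.
Qed.

Lemma sph_dotpX m x : sph_int n (fun v => dotp x v ^+ (2 * m)) = gam 0 m * r2 n x ^+ m.
Proof.
elim: m => [|m IH].
  by rewrite /= big_ord0 mulr1; under eq_fun do rewrite expr0; rewrite sph_cst.
have nz : ((n + 2 * m)%:R : R) != 0 by rewrite pnatr_eq0 -lt0n addn_gt0 n0.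
have hD := hform_dotpX x (2 * m).+1.
have hX j : hform (2 * m).+2 (fun v : 'rV[R]_n => x ord0 j * (v ord0 j * dotp x v ^+ (2 * m).+1)).
  by apply: hformZ; exact (hformX j hD).
transitivity (sph_int n (fun v => \sum_j x ord0 j * (v ord0 j * dotp x v ^+ (2 * m).+1))).
  apply: eq_sph => v.
  have -> : (2 * m.+1)%N = (2 * m).+2 by lia.
  rewrite (exprS _ (2 * m).+1) {1}/dotp mulr_suml.
  by apply: eq_bigr => j _; rewrite mulrA.
rewrite (sph_sum _ (fun j _ => hX j)).
transitivity (\sum_j ((2 * m).+1%:R / (n + 2 * m)%:R * gam 0 m * r2 n x ^+ m) * x ord0 j ^+ 2).
  apply: eq_bigr => j _; rewrite (sphZ _ (hformX j hD)).
  have E := sph_ibp j hD.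
  rewrite pd_dotpX (sphZ _ (hformZ (x ord0 j) (hform_dotpX x (2 * m)))) (sphZ _ (hform_dotpX x (2 * m))) IH in E.
  apply: (mulfI nz); rewrite mulrCA E; field.
  by move: nz; rewrite natrD natrM.
rewrite -mulr_sumr -/(r2 n x) /= big_ord_recr /= exprS addn1; ring.
Qed.

(* Differentiating [h] by parts against [dotp x ^ a] peels off one degree at a time. *)
Lemma sph_dotp_harmonic b m h : hform b h -> (forall x, laplacian n h x = 0) ->
  forall x, ip n (fun v => dotp x v ^+ (b + 2 * m)) h = gam b m * (r2 n x ^+ m * h x).
Proof.
elim: b h => [|b IH] h hh lap0 x.
  have [c ->] := hform_const hh; rewrite add0n mulrA -sph_dotpX mulrC.
  rewrite -(sphZ c (hform_dotpX x (2 * m))).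
  by apply: eq_sph => v; rewrite mulrC.
have hp j : hform b (pd j h) by exact (hform_pd j hh).
have lap0' j y : laplacian n (pd j h) y = 0.
  have lap0f : laplacian n h = fun=> 0 by apply/funext.
  have := congr1 (fun f => pd j f y) lap0f; rewrite pd_cst => E; rewrite -[RHS]E.
  rewrite !laplacianE (@pd_sum _ n j b.-1) => [|i _]; last exact (hform_pd i (hform_pd i hh)).
  apply: eq_bigr => i _.
  by rewrite (pd_comm i j hh) (pd_comm i j (hform_pd i hh)).
set a := (b.+1 + 2 * m)%N; set D := fun v => dotp x v ^+ a.
have hD : hform a D by exact: hform_dotpX.
pose D' : @fn R n := fun v => dotp x v ^+ (b + 2 * m).
have hD' : hform (b + 2 * m) D' by exact: hform_dotpX.
have nz : ((n + 2 * (b + m))%:R : R) != 0 by rewrite pnatr_eq0 -lt0n addn_gt0 n0.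
have bz : (b.+1%:R : R) != 0 by rewrite pnatr_eq0.
pose F j : @fn R n := fun v => pd j h v * D v.
have hF j : hform (2 * (b + m)).+1 (F j).
  have -> : (2 * (b + m)).+1 = (b + a)%N by rewrite /a; lia.
  exact (hformM (hp j) hD).
have E1 : b.+1%:R * ip n D h = \sum_j sph_int n (fun v => v ord0 j * F j v).
  rewrite -(sph_sum _ (fun j _ => hformX j (hF j))) /ip -(sphZ _ (hformM hD hh)).
  apply: eq_sph => v.
  rewrite mulrCA -(hform_euler v hh) mulr_sumr; apply: eq_bigr => j _.
  by rewrite /F mulrCA [D v * _]mulrC.
have hDp j : hform (a + b.-1) (fun v => D v * pd j (pd j h) v).
  exact (hformM hD (hform_pd j (hp j))).
have E2 j : (n + 2 * (b + m))%:R * sph_int n (fun v => v ord0 j * F j v) =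
    a%:R * x ord0 j * (gam b m * (r2 n x ^+ m * pd j h x)) +
    sph_int n (fun v => D v * pd j (pd j h) v).
  rewrite (sph_ibp j (hF j)) /F (pdM _ (hp j) hD).
  have pE : pd j D = fun v => a%:R * (x ord0 j * D' v) by exact: pd_dotpX.
  have hpD : hform (b + (b + 2 * m)) (fun v => pd j h v * pd j D v).
    by rewrite pE; apply: (hformM (hp j)); apply: hformZ; exact: hformZ.
  rewrite (sphD hpD (hDp j)); congr (_ + _); rewrite pE -(IH _ (hp j) (lap0' j) x).
  rewrite -mulrA -(ipZl _ hD' (hp j)) -(ipZl _ (hformZ _ hD') (hp j)).
  by apply: eq_sph => v; rewrite mulrC.
(* The second-derivative terms add up to the Laplacian of [h], so harmonicity removes them. *)
have E3 : \sum_j sph_int n (fun v => D v * pd j (pd j h) v) = 0.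
  rewrite -(sph_sum _ (fun j _ => hDp j)) -[RHS](sph_cst n); congr (sph_int n _).
  by apply/funext => v; rewrite -mulr_sumr; have := lap0 v; rewrite laplacianE => ->; rewrite mulr0.
apply: (mulfI nz); apply: (mulfI bz); rewrite mulrCA E1 mulr_sumr.
rewrite (eq_bigr _ (fun j _ => E2 j)) big_split /= E3 addr0.
transitivity (a%:R * gam b m * r2 n x ^+ m * \sum_j x ord0 j * pd j h x).
  by rewrite mulr_sumr; apply: eq_bigr => j _; ring.
rewrite (hform_euler x hh).
have -> : (b + 1 + 2 * m)%N = a by rewrite /a; lia.
have -> : (n + 2 * b + 2 * m)%N = (n + 2 * (b + m))%N by lia.
have alg (X A G P B H : R) : X != 0 -> A * G * P * (B * H) = B * (X * (A / X * G * (P * H))).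
  by move=> X0; field.
exact: alg.
Qed.

End PowerKernel.

Section HarmonicDecomposition.
Context {R : realType}.
Variable n : nat.
Hypothesis n0 : (0 < n)%N.
Implicit Types f g h : @fn R n.

Lemma sph_r2X k m f : hform (2 * k) f -> sph_int n (fun x => r2 n x ^+ m * f x) = sph_int n f.
Proof.
move=> hf; elim: m => [|m IH]; first by under eq_fun do rewrite mul1r.
have hm : hform (2 * (m + k)) (fun x => r2 n x ^+ m * f x).
  by rewrite mulnDr; exact (hformM (hform_r2X n m) hf).
rewrite -IH -(sph_r2 n0 hm); apply: eq_sph => x.
by rewrite exprS mulrA.
Qed.

Lemma hform0_pd g j : hform 0 g -> pd j g = fun=> 0.
Proof. by move=> /hform_const[c ->]; rewrite pd_cst. Qed.

(** Green's identity, twice. By parts and Euler's identity, the product of the Laplacian of f with g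
    is a multiple of <f,g> minus the sum of products of first derivatives; that sum is a multiple of
    <f,g> minus the product of f with the Laplacian of g. Both vanish by orthogonality, the last one
    after multiplying by [r2]. Finally g is the Laplacian of f itself. *)
Lemma harmonic_of_orth d f : hform d.+2 f -> (forall g, hform d g -> ip n f g = 0) ->
  forall x, laplacian n f x = 0.
Proof.
move=> hf orth.
have hp j : hform d.+1 (pd j f) by exact (hform_pd j hf).
have hpp j : hform d (pd j (pd j f)) by exact (hform_pd j (hp j)).
have hl : hform d (laplacian n f) by exact (hform_laplacian hf).
suff green g : hform d g -> \sum_j sph_int n (fun x => pd j f x * pd j g x) = 0.
  have E := ip_definite n0 hl; suff H : ip n (laplacian n f) (laplacian n f) = 0 by move=> x; rewrite E.
  move: hl; set g := laplacian n f => hg.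
  have hfg j : hform (2 * d).+1 (fun x => pd j f x * g x).
    by have := hformM (hp j) hg; rewrite addSn addnn mul2n.
  have hpg j : hform (d.+1 + d.-1) (fun x => pd j f x * pd j g x).
    exact (hformM (hp j) (hform_pd j hg)).
  have hgp j : hform (d + d) (fun x => g x * pd j (pd j f) x) by exact (hformM hg (hpp j)).
  have E1 : \sum_j sph_int n (fun x => x ord0 j * (pd j f x * g x)) = 0.
    rewrite -(sph_sum _ (fun j _ => hformX j (hfg j))).
    transitivity (sph_int n (fun x => d.+2%:R * (f x * g x))).
      apply: eq_sph => x; rewrite mulrA -(hform_euler x hf) mulr_suml.
      by apply: eq_bigr => j _; rewrite mulrA.
    rewrite (sphZ _ (hformM hf hg)); have := orth g hg; rewrite /ip => ->; exact: mulr0.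
  transitivity (\sum_j sph_int n (fun x => g x * pd j (pd j f) x)).
    rewrite -(sph_sum _ (fun j _ => hgp j)) /ip; apply: eq_sph => x.
    by rewrite -mulr_sumr.
  have E2 j : sph_int n (fun x => g x * pd j (pd j f) x) =
     (n + 2 * d)%:R * sph_int n (fun x => x ord0 j * (pd j f x * g x)) -
     sph_int n (fun x => pd j f x * pd j g x).
    rewrite (sph_ibp j (hfg j)) (pdM _ (hp j) hg) (sphD (hpg j) (hgp j)).
    by rewrite addrC addKr.
  rewrite (eq_bigr _ (fun j _ => E2 j)) sumrB -mulr_sumr E1 mulr0 green ?subr0 //.
case: d hf orth hp hpp hl => [|d] hf orth hp hpp hl hg.
  rewrite big1 // => j _; rewrite (hform0_pd j hg).
  by under eq_fun do rewrite mulr0; rewrite sph_cst.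
have hgp j : hform d (pd j g) by exact (hform_pd j hg).
have hfg j : hform (2 * d.+1).+1 (fun x => f x * pd j g x).
  by have := hformM hf (hgp j); rewrite (_ : d.+3 + d = (2 * d.+1).+1)%N //; lia.
have hfgg j : hform (d.+3 + d.-1) (fun x => f x * pd j (pd j g) x).
  exact (hformM hf (hform_pd j (hgp j))).
have hgf j : hform (d + d.+2) (fun x => pd j g x * pd j f x) by exact (hformM (hgp j) (hp j)).
have E1 : \sum_j sph_int n (fun x => x ord0 j * (f x * pd j g x)) = 0.
  rewrite -(sph_sum _ (fun j _ => hformX j (hfg j))).
  transitivity (sph_int n (fun x => d.+1%:R * (f x * g x))).
    apply: eq_sph => x; rewrite mulrCA -(hform_euler x hg) mulr_sumr.
    by apply: eq_bigr => j _; rewrite mulrCA.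
  rewrite (sphZ _ (hformM hf hg)); have := orth g hg; rewrite /ip => ->; exact: mulr0.
have E2 : \sum_j sph_int n (fun x => f x * pd j (pd j g) x) = 0.
  case: d hf orth hp hpp hl hg hgp hfg hfgg hgf E1 => [|d] hf orth hp hpp hl hg hgp hfg hfgg hgf E1.
    rewrite big1 // => j _; rewrite (hform0_pd j (hgp j)).
    by under eq_fun do rewrite mulr0; rewrite sph_cst.
  have hlg : hform d (laplacian n g) by exact (hform_laplacian hg).
  rewrite -(sph_sum _ (fun j _ => hfgg j)) -[RHS](orth _ (hformM (hform_r2 n) hlg)).
  have hflg : hform (2 * d.+2) (fun x => f x * laplacian n g x).
    by have := hformM hf hlg; rewrite (_ : d.+4 + d = 2 * d.+2)%N //; lia.
  transitivity (sph_int n (fun x => f x * laplacian n g x)).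
    by apply: eq_sph => x; rewrite -mulr_sumr.
  rewrite -(sph_r2 n0 hflg); apply: eq_sph => x.
  by rewrite mulrCA.
have E3 j : sph_int n (fun x => pd j f x * pd j g x) =
     (n + 2 * d.+1)%:R * sph_int n (fun x => x ord0 j * (f x * pd j g x)) -
     sph_int n (fun x => f x * pd j (pd j g) x).
  rewrite (sph_ibp j (hfg j)) (pdM _ hf (hgp j)) (sphD (hfgg j) (hgf j)).
  rewrite [in RHS]addrC addKr; apply: eq_sph => x; exact: mulrC.
by rewrite (eq_bigr _ (fun j _ => E3 j)) sumrB -mulr_sumr E1 E2 mulr0 subr0.
Qed.

(** As [r2] is 1 on the sphere, multiplication by it preserves inner products; [r2] times [g] is
    therefore the orthogonal projection of [f] onto the multiples of [r2], and [harmonic_of_orth]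
    applies to the remainder. *)
Lemma harmonic_split d f : hform d.+2 f -> exists g h,
  [/\ hform d g, hform d.+2 h, forall x, laplacian n h x = 0 & f = fun x => r2 n x * g x + h x].
Proof.
move=> hf; have [e E] := onb_exists (R := R) n0 (erefl (Ddim n d)).
have [he eo es] := E.
pose g := lincomb (fun i => ip n f (e i)) e.
have hg : hform d g by exact: hform_lincomb.
have hrg : hform d.+2 (fun x => r2 n x * g x) by exact (hformM (hform_r2 n) hg).
have hN := hformZ (-1) hrg.
pose h : @fn R n := fun x => f x + -1 * (r2 n x * g x).
have hh : hform d.+2 h by exact: hformD.
have orth_e i : ip n h (e i) = 0.
  rewrite (ipDl hf hN (he i)) (ipZl _ hrg (he i)).
  suff -> : ip n (fun x => r2 n x * g x) (e i) = ip n f (e i) by rewrite mulN1r subrr.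
  rewrite -[RHS](onb_coord (fun i => ip n f (e i)) i E) -/g /ip.
  have hge : hform (2 * d) (fun x => g x * e i x).
    by rewrite mul2n -addnn; exact (hformM hg (he i)).
  rewrite -(sph_r2 n0 hge); apply: eq_sph => x; exact: esym (mulrA _ _ _).
have fE : f = fun x => r2 n x * g x + h x.
  by apply/funext => x; rewrite /h mulN1r addrC subrK.
suff lap0 : forall x, laplacian n h x = 0 by exists g, h; split; [exact hg|exact hh|exact lap0|exact fE].
apply: (harmonic_of_orth hh) => g' hg'.
rewrite (es g' hg') -/(lincomb _ e) (ip_lincombr _ he hh) big1 // => i _.
by rewrite orth_e mulr0.
Qed.

Lemma rH_hform k i f : (i <= k)%N -> rH n k i f -> hform (2 * k) f.
Proof.
move=> ik [h [[/is_formP hh _] ->]].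
have -> : (2 * k = 2 * (k - i) + 2 * i)%N by lia.
exact (hformM (hform_r2X n (k - i)) hh).
Qed.

Lemma harmonic_decomposition k f : hform (2 * k) f -> exists h : nat -> @fn R n,
  (forall i, (i <= k)%N -> rH n k i (h i)) /\ f = fun x => \sum_(i < k.+1) h i x.
Proof.
elim: k f => [|k IH] f hf.
  have [c fc] := hform_const hf; exists (fun _ => f); split.
    case=> // _; exists f; split; last by apply/funext => x; rewrite mul1r.
    split; first exact/is_formP.
    move=> x; rewrite laplacianE big1 // => j _; by rewrite fc !pd_cst.
  by apply/funext => x; rewrite big_ord_recl big_ord0 addr0.
rewrite mulnS in hf.
have [g [h [hg hh lap0 ->]]] := harmonic_split hf.
have [hs [hsH ->]] := IH g hg.
exists (fun i => if i == k.+1 then h else fun x => r2 n x * hs i x); split.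
  move=> i; rewrite leq_eqVlt => /predU1P[->|]; first rewrite eqxx.
    exists h; split; last by apply/funext => x; rewrite subnn mul1r.
    by split=> //; apply/is_formP; rewrite mulnS.
  rewrite ltnS => ik; rewrite ifN; last by rewrite neq_ltn ltnS ik.
  have [h' [hh' ->]] := hsH i ik; exists h'; split=> //.
  by apply/funext => x; rewrite subSn // exprS mulrA.
apply/funext => x; rewrite [in RHS]big_ord_recr /= mulr_sumr eqxx; congr (_ + _).
by apply: eq_bigr => i _; rewrite ifN // neq_ltn ltn_ord.
Qed.

Lemma rH_powT k i f : (i <= k)%N -> rH n k i f ->
  powT (2 * k) f = fun x => gam (R := R) n (2 * i) (k - i) * f x.
Proof.
move=> ik [h [[/is_formP hh lap0] ->]]; apply/funext => x.
have hD := hform_dotpX x (2 * k).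
rewrite -(sph_dotp_harmonic n0 (k - i) hh lap0 x).
have -> : (2 * i + 2 * (k - i) = 2 * k)%N by lia.
have hDh : hform (2 * (k + i)) (fun v => dotp x v ^+ (2 * k) * h v).
  by rewrite mulnDr; exact (hformM hD hh).
rewrite /powT /ip -(sph_r2X (k - i) hDh); apply: eq_sph => v.
by rewrite mulrCA.
Qed.

(** Only distinctness of the scalars on different components is used afterwards; it separates the
    eigenspaces. *)
Lemma gam_lt k i j : (i < j <= k)%N -> gam (R := R) n (2 * j) (k - j) < gam n (2 * i) (k - i).
Proof.
move=> /andP[ij jk].
have step l : (l < k)%N -> gam (R := R) n (2 * l.+1) (k - l.+1) < gam n (2 * l) (k - l).
  move=> lk; have -> : (2 * l.+1 = (2 * l).+2)%N by lia.
  have [m mE] : exists m, (k - l = m.+1)%N by exists (k - l).-1; lia.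
  have -> : (k - l.+1 = m)%N by lia.
  rewrite mE; have := gam_step (R := R) n0 (2 * l) m.
  set A := gam _ _ m; set B := gam _ _ m.+1 => E.
  have P0 : 0 < ((2 * m + 2)%:R : R) by rewrite ltr0n; lia.
  rewrite -(ltr_pM2l P0) -E ltr_pM2r ?gam_gt0 // ltr_nat; lia.
elim: j jk ij => // j IH jk; rewrite ltnS leq_eqVlt => /predU1P[->|ij]; first exact: step.
by apply: lt_trans (IH (ltnW jk) ij); exact: step.
Qed.

(** Eigenspaces of the self-adjoint [powT] for distinct eigenvalues. *)
Lemma rH_orth k i j f g : (i <= k)%N -> (j <= k)%N -> i != j ->
  rH n k i f -> rH n k j g -> ip n f g = 0.
Proof.
move=> ik jk ij fi gj.
have hf := rH_hform ik fi; have hg := rH_hform jk gj.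
have := powT_sym hf hg; rewrite (rH_powT ik fi) (rH_powT jk gj) (ipZl _ hf hg) (ipZr _ hg hf).
move/eqP; rewrite -subr_eq0 -mulrBl mulf_eq0 => /orP[|/eqP //].
rewrite subr_eq0 => /eqP E; move: ij; rewrite neq_ltn => /orP[] lt_ij.
  by have := @gam_lt k i j; rewrite lt_ij jk E ltxx => /(_ isT).
by have := @gam_lt k j i; rewrite lt_ij ik E ltxx => /(_ isT).
Qed.

Lemma laplacianD d f g : hform d f -> hform d g ->
  laplacian n (fun x => f x + g x) = fun x => laplacian n f x + laplacian n g x.
Proof.
move=> hf hg; apply/funext => x; rewrite !laplacianE -big_split /=; apply: eq_bigr => j _.
by rewrite (pdD j hf hg) (pdD j (hform_pd j hf) (hform_pd j hg)).
Qed.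

Lemma laplacianZ d c f : hform d f -> laplacian n (fun x => c * f x) = fun x => c * laplacian n f x.
Proof.
move=> hf; apply/funext => x; rewrite !laplacianE mulr_sumr; apply: eq_bigr => j _.
by rewrite (pdZ j c hf) (pdZ j c (hform_pd j hf)).
Qed.

Lemma rH_sub k i f g : rH n k i f -> rH n k i g -> rH n k i (fun x => f x + -1 * g x).
Proof.
move=> [h1 [[/is_formP hh1 l1] ->]] [h2 [[/is_formP hh2 l2] ->]].
exists (fun x => h1 x + -1 * h2 x); split; last first.
  by apply/funext => x; rewrite mulrDr; congr (_ + _); rewrite mulrCA.
have hN := hformZ (-1) hh2; split; first by apply/is_formP; exact: hformD.
by move=> x; rewrite (laplacianD hh1 hN) (laplacianZ _ hh2) l1 l2 mulr0 addr0.
Qed.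

(** Since [oproj] selects by [xget], uniqueness of the projection has to be shown as well; two
    candidates differ by an element of the same subspace orthogonal to itself. *)
Lemma l2iE k i (h : nat -> @fn R n) : (forall i, (i <= k)%N -> rH n k i (h i)) -> (i <= k)%N ->
  l2i n k i (fun x => \sum_(j < k.+1) h j x) = h i.
Proof.
move=> hH ik; set f := fun x => _.
have hh j : (j <= k)%N -> hform (2 * k) (h j) by move=> jk; exact (rH_hform jk (hH j jk)).
have hf : hform (2 * k) f by apply: hform_sum => j _; apply: hh; rewrite -ltnS.
have proj w : rH n k i w -> ip n f w = ip n (h i) w.
  move=> wi; have hw := rH_hform ik wi.
  rewrite (ip_suml _ (d := (2 * k)%N) _ hw) => [|j]; last by apply: hh; rewrite -ltnS.
  rewrite (bigD1 (inord i)) //= inordK // big1 ?addr0 // => j ji.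
  apply: (rH_orth (k := k) (i := j) (j := i)) => //; first by rewrite -ltnS.
    by apply: contra ji => /eqP <-; rewrite inord_val.
  by apply: hH; rewrite -ltnS.
have subE g w : hform (2 * k) g -> rH n k i w -> ip n (fun x => f x - g x) w = ip n (h i) w - ip n g w.
  move=> hg wi; have hw := rH_hform ik wi.
  transitivity (ip n (fun x => f x + -1 * g x) w).
    by congr (ip n _ w); apply/funext => x; rewrite mulN1r.
  by rewrite (ipDl hf (hformZ (-1) hg) hw) (ipZl _ hg hw) (proj w wi) mulN1r.
rewrite /l2i /oproj; apply: xget_unique.
  by split; [exact: hH | move=> w wi; rewrite subE ?subrr //; exact: hh].
move=> g [gi gorth].
have hg := rH_hform ik gi.
have hd := rH_sub (hH i ik) gi.
have hhd := rH_hform ik hd.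
suff E : (fun x => h i x + -1 * g x) = (fun=> 0) :> @fn R n.
  apply/funext => x; have := congr1 (fun F => F x) E.
  by rewrite /= mulN1r => /eqP; rewrite subr_eq0 => /eqP ->.
apply: (ip_definite n0 hhd).
rewrite (ipDl (hh i ik) (hformZ (-1) hg) hhd) (ipZl _ hg hhd) mulN1r.
by rewrite -(subE g _ hg hd) gorth.
Qed.

End HarmonicDecomposition.

(** * The Gamma function *)

Section GammaFunction.
Context {R : realType}.
Notation mu := (@lebesgue_measure R).
Implicit Types a x t : R.

(** With an integer M above a, the inequality 1 + s <= exp s is taken at s = t/(2M) and raised to
    the power M. *)
Lemma powR_le_expR a : 0 <= a -> exists2 C : R, 0 < C & forall t, 0 <= t -> powR t a <= C * expR (t / 2).
Proof.
move=> a0; have [m am] : exists m, a <= m.+1%:R.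
  exists (Num.truncn a); apply: ltW; exact: truncnS_gt.
exists ((2 * m.+1%:R) ^+ m.+1) => [|t t0]; first exact: exprn_gt0.
apply: (@le_trans _ _ ((1 + t) ^+ m.+1)).
  rewrite -powR_mulrn; last by rewrite addr_ge0.
  apply: (@le_trans _ _ (powR (1 + t) a)).
    by apply: ge0_ler_powR => //; rewrite ?nnegrE ?lerDr ?addr_ge0.
  by apply: ler_powR => //; rewrite lerDl.
apply: (@le_trans _ _ ((2 * m.+1%:R) ^+ m.+1 * (1 + t / (2 * m.+1%:R)) ^+ m.+1)).
  rewrite -exprMn lerXn2r ?nnegrE ?addr_ge0 ?mulr_ge0 ?divr_ge0 ?addr_ge0 //.
    by rewrite divr_ge0 // ltW.
  rewrite mulrDr mulr1 mulrCA divff ?gt_eqF // mulr1 lerD2r.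
  by rewrite -natrM ler1n.
rewrite ler_pM2l ?exprn_gt0 //.
have -> : t / 2 = (t / (2 * m.+1%:R)) *+ m.+1.
  by have m0 : (m.+1%:R : R) != 0; [rewrite pnatr_eq0|rewrite -[RHS]mulr_natr; field].
rewrite -[X in expR X]mulr_natl expRM_natl lerXn2r ?nnegrE ?expR_ge0 ?expR_ge1Dx //.
by rewrite addr_ge0 // divr_ge0 // ltW.
Qed.

Lemma continuous_expRM c : continuous (fun t : R => expR (c * t)).
Proof.
move=> t; apply: continuous_comp; last exact: continuous_expR.
by apply: cvgM; [exact: cvg_cst|exact: cvg_id].
Qed.

Lemma expR_half_cvg0 : (fun t : R => expR (- 2^-1 * t)) @ +oo --> (0 : R).
Proof.
under eq_fun do rewrite mulNr.
apply: (@cvg_comp _ _ _ (fun t : R => 2^-1 * t) (fun s => expR (- s)) +oo +oo); last exact: cvgr_expR.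
by apply: gt0_cvgMry; [rewrite invr_gt0|exact: cvg_id].
Qed.


Notation HL := (`[0%R, +oo[%classic : set R).
Notation HLo := (`]0%R, +oo[%classic : set R).

Lemma integral_expR_half : (\int[mu]_(t in HL) (2^-1 * expR (- 2^-1 * t))%:E = 1%:E)%E.
Proof.
rewrite (@ge0_continuous_FTC2y _ (fun t => 2^-1 * expR (- 2^-1 * t)) (fun t => - expR (- 2^-1 * t)) 0 0).
- by rewrite mulr0 expR0 EFinN oppeK add0e.
- by move=> x _; rewrite mulr_ge0 ?expR_ge0.
- apply: continuous_subspaceT => t; apply: cvgM; first exact: cvg_cst.
  exact: continuous_expRM.
- by rewrite -oppr0; apply: cvgN; exact: expR_half_cvg0.
- by move=> x _; apply: ex_derive.
- apply: cvg_at_right_filter; apply: cvgN; exact: continuous_expRM.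
- move=> t _; rewrite derive1E derive_val /GRing.scale /=; ring.
Qed.

Lemma expR_half_integrable : mu.-integrable HLo (EFin \o (fun t => 2^-1 * expR (- 2^-1 * t))).
Proof.
have mf : measurable_fun HLo (EFin \o (fun t => 2^-1 * expR (- 2^-1 * t))).
  apply/measurable_EFinP/measurable_funTS; apply: continuous_measurable_fun => t.
  by apply: cvgM; [exact: cvg_cst|exact: continuous_expRM].
apply/integrableP; split => //.
under eq_integral do rewrite /= ger0_norm ?mulr_ge0 ?expR_ge0 //.
by rewrite (integral_itv_obnd_cbnd mf) integral_expR_half ltry.
Qed.

Definition gamma_fun a t : R := powR t a * expR (- t).

Lemma gammaf_ge0 a t : 0 <= gamma_fun a t.
Proof. by rewrite mulr_ge0 ?powR_ge0 ?expR_ge0. Qed.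

Lemma gammaf_le a : 0 <= a ->
  exists2 C : R, 0 < C & forall t, 0 <= t -> gamma_fun a t <= C * (2^-1 * expR (- 2^-1 * t)).
Proof.
move=> a0; have [C C0 hC] := powR_le_expR a0; exists (2 * C) => [|t t0]; first exact: mulr_gt0.
apply: le_trans (ler_wpM2r (expR_ge0 _) (hC t t0)) _.
have -> : C * expR (t / 2) * expR (- t) = C * expR (- 2^-1 * t).
  by rewrite -[LHS]mulrA -expRD; congr (_ * expR _); lra.
by apply: eq_ler; field.
Qed.

Lemma measurable_gammaf a : measurable_fun setT (gamma_fun a).
Proof.
apply: measurable_funM; first exact: measurable_powR.
by apply: continuous_measurable_fun => t; apply: continuous_comp; [exact: opp_continuous|exact: continuous_expR].
Qed.

Lemma gammaf_integrable a : 0 <= a -> mu.-integrable HLo (EFin \o gamma_fun a).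
Proof.
move=> a0; have [C C0 hC] := gammaf_le a0.
apply: (@le_integrable _ _ _ mu HLo _ _ (EFin \o (fun t => C * (2^-1 * expR (- 2^-1 * t))))) => //.
- by apply/measurable_EFinP/measurable_funTS; exact: measurable_gammaf.
- move=> t; rewrite /= in_itv /= andbT => t0; rewrite lee_fin !ger0_norm ?gammaf_ge0 //.
    by apply: hC; exact: ltW.
  by rewrite !mulr_ge0 ?expR_ge0 // ltW.
- by apply: (integrableZl _ C expR_half_integrable); exact: measurable_itv.
Qed.

Lemma is_derive_gammaf a t : 0 < t ->
  is_derive t 1 (gamma_fun a) (a * gamma_fun (a - 1) t - gamma_fun a t).
Proof.
move=> t0.
have H1 := is_derive1_powR a t0.
have H2 : is_derive t 1 (fun s : R => expR (- s)) (- expR (- t)).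
  apply: is_derive_eq; rewrite /GRing.scale /=; ring.
have := is_deriveM H1 H2; rewrite /GRing.scale /= => H.
apply: (is_derive_eq H); rewrite /gamma_fun; ring.
Qed.

Lemma gammaf_cvg a t : 0 < a -> 0 < t -> {for t, continuous (gamma_fun a)}.
Proof.
move=> a0 t0; apply: differentiable_continuous; apply/derivable1_diffP.
have H := is_derive_gammaf a t0; exact: ex_derive.
Qed.

Lemma gammaf0 a : 0 < a -> gamma_fun a 0 = 0.
Proof. by move=> a0; rewrite /gamma_fun powR0 ?gt_eqF // mul0r. Qed.

Lemma gammaf_cvg0 a : 0 < a -> gamma_fun a t @[t --> 0^'+] --> gamma_fun a 0.
Proof.
move=> a0; rewrite gammaf0 // -[X in _ --> X](mul0r (expR (- 0))).
apply: cvgM; first exact: powR_cvg0.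
apply: cvg_at_right_filter; apply: continuous_comp; [exact: opp_continuous|exact: continuous_expR].
Qed.

Lemma gammaf_cvgy a : 0 <= a -> gamma_fun a t @[t --> +oo] --> (0 : R).
Proof.
move=> a0; have [C C0 hC] := gammaf_le a0.
apply: (@squeeze_cvgr _ _ _ _ (fun=> 0) (fun t => C * (2^-1 * expR (- 2^-1 * t)))).
- near=> t; rewrite gammaf_ge0 hC //; near: t; exact: nbhs_pinfty_ge.
- exact: cvg_cst.
- rewrite -(mulr0 C) -[X in _ * X](mulr0 2^-1).
  by do 2 (apply: cvgM; first exact: cvg_cst); exact: expR_half_cvg0.
Unshelve. all: by end_near. Qed.

Lemma GammaE x : Gamma x = Rintegral mu HLo (gamma_fun (x - 1)).
Proof. by []. Qed.

(** The fundamental theorem on the half-line is applied to a nonnegative integrand, whereas the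
    derivative of t^x exp(-t) changes sign. The exponential [u], which dominates the offending term
    and has known integral, is added and finally cancelled. *)
Lemma GammaS x : 1 < x -> Gamma (x + 1) = x * Gamma x.
Proof.
move=> x1; have x0 : 0 < x by apply: lt_trans x1.
have y0 : 0 < x - 1 by rewrite subr_gt0.
have [C C0 hC] := gammaf_le (ltW y0).
pose u t : R := x * C * (2^-1 * expR (- 2^-1 * t)).
pose f t : R := u t + (gamma_fun x t - x * gamma_fun (x - 1) t).
pose F t : R := - (x * C) * expR (- 2^-1 * t) - gamma_fun x t.
have cu t : {for t, continuous u}.
  by do 2 (apply: cvgM; first exact: cvg_cst); exact: continuous_expRM.
have I1 : (\int[mu]_(t in HL) (f t)%:E = (x * C)%:E)%E.
  rewrite (@ge0_continuous_FTC2y _ f F 0 0).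
  - rewrite /F gammaf0 // mulr0 expR0; rewrite -EFinB; congr EFin; ring.
  - move=> t t0; rewrite /f addrCA addr_ge0 ?gammaf_ge0 // subr_ge0 /u -mulrA ler_pM2l //.
    exact: hC.
  - apply/continuous_within_itvcyP; split.
      move=> t; rewrite in_itv /= andbT => t0; apply: cvgD; first exact: cu.
      apply: cvgB; first exact: gammaf_cvg.
      by apply: cvgM; [exact: cvg_cst|exact: gammaf_cvg].
    apply: cvgD; first exact/cvg_at_right_filter/cu.
    apply: cvgB; first exact: gammaf_cvg0.
    by apply: cvgM; [exact: cvg_cst|exact: gammaf_cvg0].
  - rewrite -[X in _ --> X](subr0 0) -[X in _ --> X - _](mulr0 (- (x * C))).
    apply: cvgB; last exact/gammaf_cvgy/ltW.
    by apply: cvgM; [exact: cvg_cst|exact: expR_half_cvg0].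
  - move=> t t0; have := is_derive_gammaf x t0 => H; apply: ex_derive.
  - apply: cvgB; last exact: gammaf_cvg0.
    by apply: cvg_at_right_filter; apply: cvgM; [exact: cvg_cst|exact: continuous_expRM].
  - move=> t; rewrite in_itv /= andbT => t0; have H := is_derive_gammaf x t0.
    rewrite derive1E derive_val /GRing.scale /= /f /u; ring.
have iu : mu.-integrable HLo (EFin \o u).
  by apply: (integrableZl _ (x * C) expR_half_integrable); exact: measurable_itv.
have ig := gammaf_integrable (ltW x0).
have ig' := gammaf_integrable (ltW y0).
have ixg : mu.-integrable HLo (EFin \o (fun t => x * gamma_fun (x - 1) t)).
  by apply: (integrableZl _ x ig'); exact: measurable_itv.
have iB : mu.-integrable HLo (EFin \o (fun t => gamma_fun x t - x * gamma_fun (x - 1) t)).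
  by apply: (integrableB _ ig ixg); exact: measurable_itv.
have iF : mu.-integrable HLo (EFin \o f).
  by apply: (integrableD _ iu iB); exact: measurable_itv.
have uE : Rintegral mu HLo u = x * C.
  rewrite RintegralZl //; last exact: expR_half_integrable.
  by rewrite (Rintegral_itv_obnd_cbnd expR_half_integrable) /Rintegral integral_expR_half mulr1.
have fE : Rintegral mu HLo f = x * C.
  by rewrite (Rintegral_itv_obnd_cbnd iF) /Rintegral I1.
have : Rintegral mu HLo f = x * C + (Gamma (x + 1) - x * Gamma x).
  have E1 : Rintegral mu HLo f = Rintegral mu HLo u +
      Rintegral mu HLo (fun t => gamma_fun x t - x * gamma_fun (x - 1) t).
    by apply: (RintegralD _ iu iB); exact: measurable_itv.
  have E2 : Rintegral mu HLo (fun t => gamma_fun x t - x * gamma_fun (x - 1) t) =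
      Rintegral mu HLo (gamma_fun x) - Rintegral mu HLo (fun t => x * gamma_fun (x - 1) t).
    by apply: (RintegralB _ ig ixg); exact: measurable_itv.
  have E3 : Rintegral mu HLo (fun t => x * gamma_fun (x - 1) t) = x * Gamma x.
    by rewrite GammaE; apply: (RintegralZl _ _ ig'); exact: measurable_itv.
  by rewrite E1 uE E2 E3 [Gamma (x + 1)]GammaE addrK.
rewrite fE; lra.
Qed.

Lemma Gamma_gt0 x : 1 <= x -> 0 < Gamma x.
Proof.
rewrite -subr_ge0 GammaE; set a := x - 1 => a0.
pose D : set R := `[1, 2]%classic.
have ig := gammaf_integrable a0.
have mg := measurable_gammaf a.
have muD : mu D = 1%:E.
  have := @lebesgue_measure_itv R `[1, 2].
  by rewrite /= lte_fin ltr1n /= -EFinB => ->; congr EFin; ring.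
have : ((expR (- 2))%:E <= \int[mu]_(t in HLo) (gamma_fun a t)%:E)%E.
  apply: (@le_trans _ _ (\int[mu]_(t in D) (gamma_fun a t)%:E)%E); last first.
    apply: ge0_subset_integral => //; first exact: measurable_itv.
    - by apply/measurable_EFinP/measurable_funTS.
    - by move=> t _; rewrite lee_fin gammaf_ge0.
    - by move=> t; rewrite /D /= !in_itv /= andbT => /andP[t1 _]; apply: lt_le_trans t1.
  have <- : (\int[mu]_(t in D) (expR (- 2))%:E = (expR (- 2))%:E)%E.
    transitivity ((expR (- 2))%:E * mu D)%E; last by rewrite muD mule1.
    by apply: integral_cst; exact: measurable_itv.
  apply: ge0_le_integral => //; first exact: measurable_itv.
  - by apply/measurable_EFinP/measurable_funTS.
  - move=> t; rewrite /D /= in_itv /= => /andP[t1 t2]; rewrite lee_fin -[leLHS]mul1r.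
    rewrite ler_pM ?expR_ge0 //; last by rewrite ler_expR lerN2.
    by rewrite -(powRr0 t); apply: ler_powR.
have fin : (\int[mu]_(t in HLo) (gamma_fun a t)%:E)%E \is a fin_num by apply: integrable_fin_num ig.
rewrite -(fineK fin) lee_fin; apply: lt_le_trans; exact: expR_gt0.
Qed.

End GammaFunction.

Section LoewnerCoefficients.
Context {R : realType}.

(** Both sides are 1 at [i] = 0 and obey the same recurrence, by [gam_step] on one side and by the
    functional equations of Gamma and the factorial on the other. *)
Lemma lcoefE n k i : (2 <= n)%N -> (1 <= k)%N -> (i <= k)%N ->
  @lcoef R n k i = (gam n 0 k / gam n (2 * i) (k - i)) ^+ 2.
Proof.
move=> n2 k1 ik; rewrite /lcoef; congr (_ ^+ 2).
have n0 : (0 < n)%N by apply: ltn_trans n2.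
have Gpos j : 0 < Gamma ((2 * k + 2 * j + n)%:R / 2 : R).
  by apply: Gamma_gt0; rewrite ler_pdivlMr // mul1r ler_nat; lia.
have Gk : 0 < Gamma ((2 * k + n)%:R / 2 : R) by have := Gpos 0%N; rewrite muln0 addn0.
have fpos j : 0 < (j`!%:R : R) by rewrite ltr0n fact_gt0.
elim: i ik => [|i IH] ik.
  by rewrite !subn0 muln0 addn0 !divff // ?mulf_neq0 ?gt_eqF ?gam_gt0.
have [m mE] : exists m, (k - i = m.+1)%N by exists (k - i).-1; lia.
have m'E : (k - i.+1 = m)%N by lia.
have := IH (ltnW ik); rewrite mE m'E.
have -> : (2 * k + 2 * i.+1 + n)%:R / 2 = (2 * k + 2 * i + n)%:R / 2 + 1 :> R.
  by rewrite mulnS addnCA !natrD; field.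
rewrite GammaS; last by rewrite ltr_pdivlMr // mul1r ltr_nat; lia.
have -> : (2 * i.+1 = (2 * i).+2)%N by lia.
have := gam_step (R := R) n0 (2 * i) m.
have -> : (n + 2 * m + 2 * (2 * i) + 2 = 2 * k + 2 * i + n)%N by lia.
have -> : (2 * m + 2 = 2 * m.+1)%N by lia.
rewrite factS (natrM _ 2%N) (natrM _ m.+1).
have p1 := Gpos i; have p2 := fpos m; have p3 := fpos k.
have p4 := gam_gt0 (R := R) n0 (2 * i) m.+1; have p5 := gam_gt0 (R := R) n0 (2 * i).+2 m.
have p6 : 0 < (m.+1%:R : R) by [].
have p7 : 0 < ((2 * k + 2 * i + n)%:R : R) by rewrite ltr0n; lia.
move: p1 p2 p3 p4 p5 p6 p7 Gk.
move: (Gamma ((2 * k + 2 * i + n)%:R / 2)) (Gamma ((2 * k + n)%:R / 2)) (m`!%:R) (k`!%:R).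
move: (gam n (2 * i) m.+1) (gam n (2 * i).+2 m) (gam n 0 k) (m.+1%:R) ((2 * k + 2 * i + n)%:R).
move=> g2 g1 g3 M L X1 X2 f1 f2 p1 p2 p3 p4 p5 p6 p7 p8 E1 E2.
have E3 : g1 = 2 * M * g2 / L by rewrite -E1 mulrC mulKf // gt_eqF.
have E4 : g3 = M * f1 * X1 / (f2 * X2) * g2 by rewrite E2 divfK // gt_eqF.
by rewrite E3 E4; field; rewrite !gt_eqF.
Qed.

End LoewnerCoefficients.

(** * The Loewner ellipsoid *)

Section ProjectedOperator.
Context {R : realType}.
Variables n k : nat.
Hypotheses (n0 : (0 < n)%N) (k0 : (0 < k)%N).
Implicit Types f g : @fn R n.

Lemma hform_ge0_sphere d f : (0 < d)%N -> hform (2 * d) f ->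
  (forall v, r2 n v = 1 -> 0 <= f v) -> forall x, 0 <= f x.
Proof.
move=> d0 hf f0 x; have [x0|x0] := eqVneq (r2 n x) 0.
  by rewrite (hform_sph x hf) x0 expr0n gtn_eqF // mul0r.
rewrite (hform_sph x hf) mulr_ge0 ?exprn_ge0 ?r2_ge0 //; apply: f0.
exact: r2_sph_proj.
Qed.

Lemma sph_ge0_sphere d f : (0 < d)%N -> hform (2 * d) f ->
  (forall v, r2 n v = 1 -> 0 <= f v) -> 0 <= sph_int n f.
Proof. by move=> d0 hf f0; apply: sph_ge0; exact: hform_ge0_sphere hf f0. Qed.

Lemma hform_rpow : hform (2 * k) (rpow n k : @fn R n).
Proof. exact: hform_r2X. Qed.

Lemma ip_rpow d f : hform (2 * d) f -> ip n f (rpow n k) = sph_int n f.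
Proof.
move=> hf; rewrite -(sph_r2X n0 k hf) /ip; apply: eq_sph => x.
exact: mulrC.
Qed.

Lemma sph_rpow : sph_int n (rpow n k : @fn R n) = 1.
Proof.
have h1 : hform (2 * 0) (fun _ : 'rV[R]_n => 1 : R) by exact: hformC.
rewrite -[RHS](sph_cst n 1) -(sph_r2X n0 k h1); congr (sph_int n _).
by apply/funext => x; rewrite mulr1.
Qed.

Definition avgT f : @fn R n := fun x => (gam n 0 k)^-1 * powT (2 * k) f x.

Let g0 : 0 < (gam n 0 k : R). Proof. exact: gam_gt0. Qed.

Lemma hform_avgT f : hform (2 * k) f -> hform (2 * k) (avgT f).
Proof. by move=> hf; apply: hformZ; exact: hform_powT. Qed.

Lemma avgT_sym f g : hform (2 * k) f -> hform (2 * k) g -> ip n (avgT f) g = ip n f (avgT g).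
Proof.
move=> hf hg; rewrite /avgT (ipZl _ (hform_powT hf) hg) (ipZr _ (hform_powT hg) hf).
by rewrite powT_sym.
Qed.

Lemma avgT_rpow : avgT (rpow n k) = rpow n k.
Proof.
apply/funext => x; rewrite /avgT /powT (ip_rpow (hform_dotpX x (2 * k))) sph_dotpX //.
by rewrite mulKf // gt_eqF.
Qed.

Lemma sph_avgT f : hform (2 * k) f -> sph_int n (avgT f) = sph_int n f.
Proof.
move=> hf; rewrite -(ip_rpow (hform_avgT hf)) (avgT_sym hf hform_rpow) avgT_rpow.
exact (ip_rpow hf).
Qed.

Lemma avgT_lincomb N (c : 'I_N -> R) (e : 'I_N -> @fn R n) : (forall i, hform (2 * k) (e i)) ->
  avgT (lincomb c e) = lincomb c (fun i => avgT (e i)).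
Proof.
move=> he; apply/funext => x; rewrite /avgT (powT_lincomb c he) /lincomb mulr_sumr.
by apply: eq_bigr => i _; rewrite mulrCA.
Qed.

Lemma rH_scale i c f : rH n k i f -> rH n k i (fun x => c * f x).
Proof.
move=> [h [[/is_formP hh lap0] ->]]; exists (fun x => c * h x); split.
  split; first by apply/is_formP; exact: hformZ.
  by move=> x; rewrite (laplacianZ _ hh) lap0 mulr0.
by apply/funext => x; rewrite mulrCA.
Qed.

Definition avg_eig i : R := gam n (2 * i) (k - i) / gam n 0 k.

Lemma avg_eig_gt0 i : 0 < avg_eig i.
Proof. by rewrite divr_gt0 ?gam_gt0. Qed.

Lemma avgT_sum_rH (h : nat -> @fn R n) : (forall i, (i <= k)%N -> rH n k i (h i)) ->
  avgT (fun x => \sum_(i < k.+1) h i x) = fun x => \sum_(i < k.+1) avg_eig i * h i x.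
Proof.
move=> hH; have hh (i : 'I_k.+1) : hform (2 * k) (h i).
  by have ik : (i <= k)%N by [rewrite -ltnS]; exact (rH_hform n0 ik (hH i ik)).
have -> : (fun x => \sum_(i < k.+1) h i x) = lincomb (fun=> 1) (fun i : 'I_k.+1 => h i).
  by apply/funext => x; apply: eq_bigr => i _; rewrite mul1r.
rewrite avgT_lincomb //; apply/funext => x; apply: eq_bigr => i _; rewrite mul1r.
have ik : (i <= k)%N by rewrite -ltnS.
by rewrite /avgT (rH_powT n0 ik (hH i ik)) /avg_eig mulrA [_^-1 * _]mulrC.
Qed.

Lemma avgT_surj f : hform (2 * k) f -> exists2 g, hform (2 * k) g & f = avgT g.
Proof.
move=> hf; have [h [hH fE]] := harmonic_decomposition n0 hf.
have hH' i : (i <= k)%N -> rH n k i (fun x => (avg_eig i)^-1 * h i x).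
  by move=> ik; apply: rH_scale; exact: hH.
exists (fun x => \sum_(i < k.+1) (avg_eig i)^-1 * h i x).
  by apply: hform_sum => i _; have ik : (i <= k)%N by [rewrite -ltnS]; exact (rH_hform n0 ik (hH' i ik)).
rewrite (avgT_sum_rH hH') fE; apply/funext => x; apply: eq_bigr => i _.
by rewrite mulVKf // gt_eqF // avg_eig_gt0.
Qed.

(** Each weight is the inverse square of the eigenvalue of [avgT] on its component, so the weighted
    sum is the squared norm of [g] without its component of index 0. That component is the mean of
    [g] times [rpow]. *)
Lemma target_sum g : (2 <= n)%N -> hform (2 * k) g ->
  \sum_(1 <= i < k.+1) lcoef n k i * nrm n (l2i n k i (avgT g)) ^+ 2 =
  ip n g g - sph_int n g ^+ 2.
Proof.
move=> n2 hg; have [h [hH gE]] := harmonic_decomposition n0 hg.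
have hh i : (i <= k)%N -> hform (2 * k) (h i) by move=> ik; exact (rH_hform n0 ik (hH i ik)).
have hh' (i : 'I_k.+1) : hform (2 * k) (h i) by apply: hh; rewrite -ltnS.
have hK i : (i <= k)%N -> rH n k i (fun x => avg_eig i * h i x).
  by move=> ik; apply: rH_scale; exact: hH.
have proj i : (i <= k)%N -> ip n g (h i) = ip n (h i) (h i).
  move=> ik; rewrite gE (ip_suml _ (d := (2 * k)%N) _ (hh i ik)) //.
  have ik' : (i < k.+1)%N by [].
  rewrite (bigD1 (Ordinal ik')) //= big1 ?addr0 // => j ji.
  apply: (rH_orth n0 (k := k) (i := j) (j := i)) => //; first by rewrite -ltnS.
    by apply: hH; rewrite -ltnS.
  exact: hH.
have term i : (i <= k)%N -> lcoef n k i * nrm n (l2i n k i (avgT g)) ^+ 2 = ip n (h i) (h i).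
  move=> ik; rewrite gE (avgT_sum_rH hH).
  rewrite (l2iE n0 hK ik) /nrm sqr_sqrtr ?ip_ge0 //.
  rewrite (ipZl _ (hh i ik) (hformZ _ (hh i ik))) (ipZr _ (hh i ik) (hh i ik)).
  rewrite lcoefE // /avg_eig; set a := gam _ _ _; set b := gam _ _ _.
  have b0 : b != 0 by rewrite gt_eqF // gam_gt0.
  have a0 : a != 0 by rewrite gt_eqF // gam_gt0.
  by field; rewrite a0.
have total : ip n g g = \sum_(0 <= i < k.+1) ip n (h i) (h i).
  rewrite {2}gE (ip_sumr _ (d := (2 * k)%N) hh' hg) big_mkord.
  by apply: eq_bigr => i _; rewrite proj // -ltnS.
rewrite (eq_big_nat _ _ (F2 := fun i => ip n (h i) (h i))); last first.
  by move=> i /andP[_ ik]; apply: term; rewrite -ltnS.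
rewrite total [X in _ = X - _]big_ltn //.
suff -> : sph_int n g ^+ 2 = ip n (h 0%N) (h 0%N) by rewrite addrAC subrr add0r.
have [h0' [[/is_formP hh0 _] h0E]] := hH 0%N (leq0n k).
have [c hc] := hform_const hh0.
have h0c : h 0%N = fun x => c * rpow n k x.
  by rewrite h0E hc subn0; apply/funext => x; exact: mulrC.
have s1 : ip n (h 0%N) (h 0%N) = c ^+ 2.
  rewrite h0c (ipZl _ hform_rpow (hformZ _ hform_rpow)) (ipZr _ hform_rpow hform_rpow).
  by rewrite (ip_rpow hform_rpow) sph_rpow mulr1.
suff -> : sph_int n g = c by rewrite s1.
rewrite -(ip_rpow hg) gE (ip_suml _ (d := (2 * k)%N) hh' hform_rpow) big_ord_recl big1 ?addr0.
  by rewrite h0c (ipZl _ hform_rpow hform_rpow) (ip_rpow hform_rpow) sph_rpow mulr1.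
move=> i _; apply: (rH_orth n0 (k := k) (i := lift ord0 i) (j := 0%N)) => //.
- by rewrite lift0.
- by apply: hH; rewrite lift0.
exists (fun=> 1); split; last by apply/funext => x; rewrite subn0 mulr1.
split; first by apply/is_formP; exact (hformC n 1).
by move=> x; rewrite laplacianE big1 // => j _; rewrite !pd_cst.
Qed.

End ProjectedOperator.

Lemma Ddim_ge2 n d : (2 <= n)%N -> (0 < d)%N -> (1 < Ddim n d)%N.
Proof.
move=> n2 d0; rewrite /Ddim; apply: (@leq_trans 'C(d.+1, d)); first by rewrite binSn ltnS.
by apply: leq_bin2l; lia.
Qed.

Section Loewner.
Context {R : realType}.

Lemma sum_cauchy_schwarz (I : finType) (x y : I -> R) :
  (\sum_i x i * y i) ^+ 2 <= (\sum_i x i ^+ 2) * (\sum_i y i ^+ 2).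
Proof.
set A := \sum_i x i ^+ 2; set B := \sum_i y i ^+ 2; set C := \sum_i x i * y i.
have B0 : 0 <= B by apply: sumr_ge0 => i _; exact: sqr_ge0.
have E : \sum_i (B * x i - C * y i) ^+ 2 = B * (A * B - C ^+ 2).
  transitivity (\sum_i (B ^+ 2 * x i ^+ 2 + C ^+ 2 * y i ^+ 2 - 2 * B * C * (x i * y i))).
    by apply: eq_bigr => i _; ring.
  rewrite sumrB big_split /= -!mulr_sumr -/A -/B -/C; ring.
have [B_eq0|B_neq0] := eqVneq B 0.
  have y0 i : y i = 0.
    have /eqP := B_eq0; rewrite psumr_eq0 => [/allP/(_ i)|j _]; last exact: sqr_ge0.
    by rewrite mem_index_enum /= sqrf_eq0 => /(_ isT)/eqP.
  by rewrite /C B_eq0 mulr0 big1 ?expr0n // => i _; rewrite y0 mulr0.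
have Bp : 0 < B by rewrite lt_def B_neq0.
rewrite -subr_ge0 -(pmulr_rge0 _ Bp) -E; apply: sumr_ge0 => i _; exact: sqr_ge0.
Qed.

Lemma nth_root (y : R) d : (0 < d)%N -> 0 <= y -> exists2 c : R, 0 <= c & c ^+ d = y.
Proof.
move=> d0 y0; exists (powR y d%:R^-1); first exact: powR_ge0.
by rewrite -powR_mulrn ?powR_ge0 // -powRrM mulVf ?powRr1 // pnatr_eq0 -lt0n.
Qed.

Variables n k : nat.
Hypotheses (n2 : (2 <= n)%N) (k0 : (0 < k)%N).
Let n0 : (0 < n)%N. Proof. exact: ltnW. Qed.

Lemma onb_kernel_homog N (e : 'I_N -> @fn R n) x : onb (2 * k) e ->
  \sum_i e i x ^+ 2 = N%:R * (r2 n x ^+ k) ^+ 2.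
Proof.
move=> E; have [he _ _] := E.
have sE i : e i x ^+ 2 = (r2 n x ^+ k) ^+ 2 * e i (sph_proj x) ^+ 2.
  by rewrite (hform_sph x (he i)) exprMn.
rewrite (eq_bigr _ (fun i _ => sE i)) -mulr_sumr.
have [x0|x0] := eqVneq (r2 n x) 0; first by rewrite x0 expr0n gtn_eqF // expr0n /= mul0r mulr0.
by rewrite (onb_kernel n0 E) 1?mulrC ?r2_sph_proj.
Qed.

Lemma onb_kernel_le N (e : 'I_N -> @fn R n) x y : onb (2 * k) e ->
  \sum_i e i x * e i y <= N%:R * (r2 n x ^+ k * r2 n y ^+ k).
Proof.
move=> E; have := sum_cauchy_schwarz (fun i => e i x) (fun i => e i y).
rewrite !(onb_kernel_homog _ E); set C := \sum_i _.
have -> : N%:R * (r2 n x ^+ k) ^+ 2 * (N%:R * (r2 n y ^+ k) ^+ 2) =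
  (N%:R * (r2 n x ^+ k * r2 n y ^+ k)) ^+ 2 by ring.
have X0 : 0 <= N%:R * (r2 n x ^+ k * r2 n y ^+ k) by rewrite !mulr_ge0 ?exprn_ge0 ?r2_ge0.
by rewrite -[_ ^+ 2 <= _]ler_sqrt ?sqr_ge0 // !sqrtr_sqr (ger0_norm X0); apply: le_trans (ler_norm C).
Qed.

(** A sum of powers of linear forms a_j is the image of the combination [lincomb c e] of reproducing
    kernels at the a_j. Pairs of kernels are bounded by [onb_kernel_le], and the mean-one condition
    [mass] says that the total weight is 1. *)
Lemma Lfbar_preimage N (e : 'I_N -> @fn R n) (f : @fn R n) : onb (2 * k) e -> Lfbar n k f ->
  exists g, [/\ hform (2 * k) g, f = avgT k g & ip n g g <= N%:R].
Proof.
move=> E [[M [a fE]] [_ f1]]; have [he eo es] := E.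
have g0 : 0 < gam n 0 k :> R by exact: gam_gt0.
pose c i : R := gam n 0 k * \sum_(j < M) e i (a j).
have hf (j : 'I_M) : hform (2 * k) (fun x => dotp (a j) x ^+ (2 * k)) by exact: hform_dotpX.
have mass : gam n 0 k * \sum_(j < M) r2 n (a j) ^+ k = 1.
  rewrite -f1 fE (sph_sum _ (fun j _ => hf j)) mulr_sumr; apply: eq_bigr => j _.
  by rewrite sph_dotpX.
exists (lincomb c e); split; first exact: hform_lincomb.
  apply/funext => x; rewrite avgT_lincomb // fE /lincomb.
  transitivity (\sum_(j < M) \sum_i e i (a j) * ip n (e i) (fun y => dotp x y ^+ (2 * k))).
    apply: eq_bigr => j _; have := es _ (hform_dotpX x (2 * k)).
    move/(congr1 (fun F => F (a j))); rewrite -/(dotp (a j) x) dotpC => ->.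
    by apply: eq_bigr => i _; rewrite mulrC [ip _ (e i) _]ipC.
  rewrite exchange_big /=; apply: eq_bigr => i _.
  by rewrite -mulr_suml /c /avgT /powT ipC mulrACA mulfV ?mul1r // gt_eqF.
rewrite (onb_parseval E (hform_lincomb c he) (hform_lincomb c he)).
under eq_bigr do rewrite (onb_coord c _ E) -expr2 /c exprMn.
rewrite -mulr_sumr.
have -> : \sum_i (\sum_(j < M) e i (a j)) ^+ 2 =
    \sum_(j < M) \sum_(l < M) \sum_i e i (a j) * e i (a l).
  under eq_bigr do rewrite expr2 mulr_suml.
  rewrite exchange_big; apply: eq_bigr => j _ /=.
  by under eq_bigr do rewrite mulr_sumr; rewrite exchange_big.
apply: (@le_trans _ _ (gam n 0 k ^+ 2 *
    \sum_(j < M) \sum_(l < M) N%:R * (r2 n (a j) ^+ k * r2 n (a l) ^+ k))).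
  rewrite ler_pM2l ?exprn_gt0 //; apply: ler_sum => j _; apply: ler_sum => l _.
  exact: onb_kernel_le.
apply: eq_ler.
under eq_bigr do rewrite -!mulr_sumr.
set s := \sum_(j < M) r2 n (a j) ^+ k in mass *.
have -> : \sum_(j < M) N%:R * (r2 n (a j) ^+ k * s) = s * (N%:R * s).
  by rewrite {2}/s mulr_suml; apply: eq_bigr => j _; ring.
transitivity (N%:R * (gam n 0 k * s) ^+ 2); first by ring.
by rewrite mass expr1n mulr1.
Qed.

Local Notation m := (Ddim n (2 * k) - 1)%N.

Lemma DdimE : Ddim n (2 * k) = m.+1.
Proof. by have := @Ddim_ge2 n (2 * k) n2; lia. Qed.

Let m0 : (0 < m)%N. Proof. by have := @Ddim_ge2 n (2 * k) n2; lia. Qed.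

Variable e : 'I_m.+1 -> @fn R n.
Hypotheses (eb : onb (2 * k) e) (e0 : e ord0 = rpow n k).
Let he i : hform (2 * k) (e i). Proof. by case: eb. Qed.

(** Mean-one forms of squared norm at most m + 1 make up the ball of radius sqrt(m) about [rpow];
    [avgT] carries its orthogonal axes to these vectors. *)
Definition axes (j : 'I_m) : @fn R n := fun x => Num.sqrt m%:R * avgT k (e (lift ord0 j)) x.

Lemma coord0 g : hform (2 * k) g -> ip n g (e ord0) = sph_int n g.
Proof. by move=> hg; rewrite e0; exact (ip_rpow k n0 hg). Qed.

Lemma avgT_expand g x : hform (2 * k) g ->
  avgT k g x = sph_int n g * rpow n k x + \sum_j ip n g (e (lift ord0 j)) * avgT k (e (lift ord0 j)) x.
Proof.
move=> hg; have [_ _ es] := eb.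
have -> : avgT k g = lincomb (fun i => ip n g (e i)) (fun i => avgT k (e i)).
  by rewrite -avgT_lincomb //; congr avgT; exact: es.
by rewrite /lincomb big_ord_recl (coord0 hg) e0 (avgT_rpow k n0).
Qed.

Lemma ip_expand f g : hform (2 * k) f -> hform (2 * k) g ->
  ip n f g = sph_int n f * sph_int n g + \sum_j ip n f (e (lift ord0 j)) * ip n g (e (lift ord0 j)).
Proof.
by move=> hf hg; rewrite (onb_parseval eb hf hg) big_ord_recl (coord0 hf) (coord0 hg).
Qed.

Lemma loewner_targetP (f : @fn R n) : loewner_target n k f <-> exists g,
  [/\ hform (2 * k) g, sph_int n g = 1, f = avgT k g & ip n g g <= m.+1%:R].
Proof.
split.
  move=> [[/is_formP hf f1]]; have [g hg fE] := avgT_surj n0 hf.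
  have g1 : sph_int n g = 1 by rewrite -f1 fE sph_avgT.
  rewrite fE target_sum // g1 expr1n lerD2r => gg.
  by exists g; split=> //; rewrite -DdimE.
move=> [g [hg g1 -> gg]]; split; last first.
  by rewrite target_sum // g1 expr1n lerD2r DdimE.
by split; [apply/is_formP; exact: hform_avgT | rewrite sph_avgT].
Qed.

Lemma loewner_target_ellipsoid : loewner_target n k = ellipsoid n m (rpow n k) axes.
Proof.
have s0 : 0 < Num.sqrt m%:R :> R by rewrite sqrtr_gt0 ltr0n.
apply/seteqP; split=> f.
  move=> /loewner_targetP[g [hg g1 -> gg]].
  exists (fun j => ip n g (e (lift ord0 j)) / Num.sqrt m%:R); split.
    under eq_bigr do rewrite exprMn exprVn sqr_sqrtr //.
    rewrite -mulr_suml ler_pdivrMr ?ltr0n // mul1r.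
    move: gg; rewrite (ip_expand hg hg) g1 mulr1 -natr1 addrC lerD2r.
    by under eq_bigr do rewrite -expr2.
  apply/funext => x; rewrite (avgT_expand x hg) g1 mul1r; congr (_ + _).
  by apply: eq_bigr => j _; rewrite /axes [RHS]mulrA divfK // gt_eqF.
move=> [t [t1 ->]]; apply/loewner_targetP.
pose c (i : 'I_m.+1) : R := if unlift ord0 i is Some j then Num.sqrt m%:R * t j else 1.
have c0 : c ord0 = 1 by rewrite /c unlift_none.
have cl j : c (lift ord0 j) = Num.sqrt m%:R * t j by rewrite /c liftK.
have hg := hform_lincomb c he.
have gc i : ip n (lincomb c e) (e i) = c i by exact (onb_coord c i eb).
have g1 : sph_int n (lincomb c e) = 1 by rewrite -(coord0 hg) gc.
exists (lincomb c e); split=> //.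
  apply/funext => x; rewrite (avgT_expand x hg) g1 mul1r; congr (_ + _).
  by apply: eq_bigr => j _; rewrite gc cl /axes mulrCA mulrA.
rewrite (ip_expand hg hg) g1 mulr1 -natr1 addrC lerD2r.
under eq_bigr do rewrite gc cl -expr2 exprMn sqr_sqrtr //.
by rewrite -mulr_sumr -[X in _ <= X]mulr1 ler_pM2l // ltr0n.
Qed.

Lemma sph_el j : sph_int n (e (lift ord0 j)) = 0.
Proof. by rewrite -(coord0 (he _)); case: eb => _ -> _; rewrite eq_sym (negPf (neq_lift _ _)). Qed.

Lemma ip_rpow_el j : ip n (rpow n k) (e (lift ord0 j)) = 0.
Proof. by rewrite -e0 ipC (coord0 (he _)) sph_el. Qed.

Definition coords (w : 'I_m -> @fn R n) : 'M[R]_m := \matrix_(i, j) ip n (w i) (e (lift ord0 j)).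

Lemma gram_coords (w : 'I_m -> @fn R n) : (forall i, hform (2 * k) (w i)) ->
  (forall i, sph_int n (w i) = 0) -> gram n m w = coords w *m (coords w)^T.
Proof.
move=> hw w0; apply/matrixP => i j; rewrite !mxE (ip_expand (hw i) (hw j)) w0 mul0r add0r.
by apply: eq_bigr => l _; rewrite !mxE.
Qed.

Lemma det_gram_coords (w : 'I_m -> @fn R n) : (forall i, hform (2 * k) (w i)) ->
  (forall i, sph_int n (w i) = 0) -> \det (gram n m w) = \det (coords w) ^+ 2.
Proof. by move=> hw w0; rewrite (gram_coords hw w0) det_mulmx det_tr expr2. Qed.

(* [avgT] on the forms of mean zero: it maps a ball to the Loewner ellipsoid. *)
Definition avg_mx : 'M[R]_m := coords (fun i => avgT k (e (lift ord0 i))).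

(** [avgT] is onto, and by self-adjointness the coordinates of preimages of the basis form a left
    inverse. *)
Lemma avg_mx_unit : avg_mx \in unitmx.
Proof.
pose g i := projT1 (cid2 (avgT_surj n0 (he (lift ord0 i)))).
have hg i : hform (2 * k) (g i) by rewrite /g; case: (cid2 _).
have gE i : e (lift ord0 i) = avgT k (g i) by rewrite /g; case: (cid2 _).
suff /mulmx1_unit[] : coords g *m avg_mx = 1%:M by [].
apply/matrixP => i l; rewrite !mxE.
have hS j : hform (2 * k) (avgT k (e (lift ord0 j))) by exact: hform_avgT.
transitivity (ip n (g i) (avgT k (e (lift ord0 l)))).
  rewrite (ip_expand (hg i) (hS l)) sph_avgT // sph_el mulr0 add0r.
  apply: eq_bigr => j _; rewrite !mxE; congr (_ * _).
  by rewrite (avgT_sym (he _) (he _)) ipC.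
rewrite -(avgT_sym (hg i) (he _)) -gE; case: eb => _ -> _.
by rewrite (inj_eq lift_inj).
Qed.

Lemma hform_axes j : hform (2 * k) (axes j).
Proof. by apply: hformZ; apply: hform_avgT. Qed.

Lemma sph_axes j : sph_int n (axes j) = 0.
Proof.
have hS := hform_avgT (he (lift ord0 j)).
by rewrite /axes (sphZ _ hS) sph_avgT // sph_el mulr0.
Qed.

Lemma det_gram_axes : \det (gram n m axes) = m%:R ^+ m * \det avg_mx ^+ 2.
Proof.
rewrite (det_gram_coords hform_axes sph_axes).
have -> : coords axes = Num.sqrt m%:R *: avg_mx.
  apply/matrixP => i j; rewrite !mxE /axes.
  exact (ipZl _ (hform_avgT (he _)) (he _)).
by rewrite detZ exprMn exprAC sqr_sqrtr.
Qed.

Lemma power_in_Lfbar (v : 'rV[R]_n) : r2 n v = 1 ->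
  Lfbar n k (fun x => (gam n 0 k)^-1 * dotp v x ^+ (2 * k)).
Proof.
move=> v1; have g0 : 0 < gam n 0 k :> R by exact: gam_gt0.
have k2 : (0 < 2 * k)%N by lia.
have iv0 : 0 <= (gam n 0 k : R)^-1 by rewrite invr_ge0 ltW.
have [c c0 cE] := nth_root k2 iv0.
have hv := hform_dotpX v (2 * k).
split; last split.
- exists 1%N, (fun=> c *: v); apply/funext => x; rewrite big_ord1 -cE -exprMn; congr (_ ^+ _).
  by rewrite mulr_sumr; apply: eq_bigr => i _; rewrite mxE mulrA.
- by apply/is_formP; apply: hformZ.
- by rewrite (sphZ _ hv) sph_dotpX // v1 expr1n mulr1 mulVf // gt_eqF.
Qed.

Lemma loewner_minimal (c' : @fn R n) v' : is_ellipsoid_in_M n k c' v' ->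
  Lfbar n k `<=` ellipsoid n _ c' v' -> \det (gram n m axes) <= \det (gram n m v').
Proof.
move=> [[/is_formP hc c1] [v0 detv]] sub.
have hv j : hform (2 * k) (v' j) by case: (v0 j) => /is_formP.
have sv j : sph_int n (v' j) = 0 by case: (v0 j).
rewrite det_gram_axes; move: detv; rewrite (det_gram_coords hv sv); set B := coords v' => detB.
have uB : B \in unitmx.
  by rewrite unitmxE unitfE; apply: contraTneq detB => ->; rewrite expr0n ltxx.
pose A := invmx B.
pose d l : R := ip n c' (e (lift ord0 l)).
pose S l : @fn R n := avgT k (e (lift ord0 l)).
have hS l : hform (2 * k) (S l) by exact: hform_avgT.
pose q j : @fn R n := lincomb (fun l => A l j) S.
have hq j : hform (2 * k) (q j) by exact: hform_lincomb.
pose D j := \sum_l d l * A l j.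
(* For v on the sphere, [p j v] is the coordinate along [v' j] of the normalised power at v,
   measured from the centre [c']. Multiplying the constant [D j] by [rpow] makes it homogeneous
   without changing it on the sphere. *)
pose p j : @fn R n := fun x => q j x + - D j * rpow n k x.
have hD j : hform (2 * k) (fun x => - D j * rpow n k x) by apply: hformZ; exact: hform_rpow.
have hp j : hform (2 * k) (p j) by exact: hformD.
have on_sphere v : r2 n v = 1 -> \sum_j p j v ^+ 2 <= 1.
  move=> v1; have [t [t1 tE]] := sub _ (power_in_Lfbar v1).
  have coef l : S l v = d l + (\row_j t j *m B) ord0 l.
    rewrite !mxE.
    have hd := hform_dotpX v (2 * k).
    have -> : S l v = ip n (fun x => (gam n 0 k)^-1 * dotp v x ^+ (2 * k)) (e (lift ord0 l)).
      by rewrite (ipZl _ hd (he _)).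
    rewrite tE (ipDl hc (hform_lincomb t hv) (he _)); congr (_ + _).
    rewrite (ip_lincombl t hv (he _)); apply: eq_bigr => j _; by rewrite !mxE.
  have tA : \row_j t j = (\row_l (S l v - d l)) *m A.
    rewrite -[LHS](mulmxK uB); congr (_ *m _); apply/rowP => l.
    by rewrite [in RHS]mxE coef addrC addKr.
  apply: le_trans t1; apply: eq_ler; apply: eq_bigr => j _.
  have -> : t j = (\row_j t j) ord0 j by rewrite mxE.
  rewrite tA mxE /p /q /lincomb /D /rpow v1 expr1n mulr1 -sumrB; congr (_ ^+ 2).
  by apply: eq_bigr => l _; rewrite mxE mulrBl mulrC.
(* The inequality on the sphere is made homogeneous, as nonnegativity of the form [F] of degree 4k,
   and then integrated. *)
have int_le : \sum_j ip n (p j) (p j) <= 1.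
  pose F : @fn R n := fun x => rpow n k x * rpow n k x + -1 * \sum_j p j x * p j x.
  have hpp j : hform (2 * k + 2 * k) (fun x => p j x * p j x) by exact (hformM (hp j) (hp j)).
  have hr : hform (2 * k + 2 * k) (fun x : 'rV[R]_n => rpow n k x * rpow n k x).
    exact (hformM (hform_rpow n k) (hform_rpow n k)).
  have hs : hform (2 * k + 2 * k) (fun x : 'rV[R]_n => \sum_j p j x * p j x).
    by apply: hform_sum => j _.
  have F0 : 0 <= sph_int n F.
    apply: (@sph_ge0_sphere _ _ (2 * k)%N) => [|//|v v1]; first by lia.
      by rewrite mul2n -addnn; exact (hformD hr (hformZ (-1) hs)).
    rewrite /F /rpow v1 expr1n mul1r mulN1r subr_ge0.
    by under eq_bigr do rewrite -expr2; exact: on_sphere.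
  move: F0; rewrite /F (sphD hr (hformZ (-1) hs)) (sphZ _ hs) (sph_sum _ (fun j _ => hpp j)).
  have -> : sph_int n (fun x : 'rV[R]_n => rpow n k x * rpow n k x) = 1.
    exact (etrans (ip_rpow k n0 (hform_rpow n k)) (sph_rpow k n0)).
  by rewrite mulN1r subr_ge0.
have coef j l : ip n (p j) (e (lift ord0 l)) = (A^T *m avg_mx) j l.
  rewrite (ipDl (hq j) (hD j) (he _)) (ipZl _ (hform_rpow n k) (he _)) ip_rpow_el mulr0 addr0.
  rewrite (ip_lincombl _ hS (he _)) mxE; apply: eq_bigr => i _; by rewrite !mxE.
have HS : \sum_j \sum_l (A^T *m avg_mx) j l ^+ 2 <= 1.
  apply: le_trans int_le; apply: ler_sum => j _; rewrite (ip_expand (hp j) (hp j)).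
  rewrite -expr2 -[leLHS]add0r lerD ?sqr_ge0 //; apply: eq_ler.
  by apply: eq_bigr => l _; rewrite coef expr2.
have uA : A^T *m avg_mx \in unitmx.
  by rewrite unitmx_mul unitmx_tr unitmx_inv uB avg_mx_unit.
(* The Hilbert-Schmidt bound gives m^m det(avg_mx)^2 <= det(B)^2, and these are the two Gram
   determinants. *)
have := det_gram_le m0 uA HS.
by rewrite det_mulmx det_tr det_inv exprMn exprVn mulrCA ler_pdivrMl // mulr1.
Qed.

Theorem loewner_Lfbar : @loewner_ellipsoid R n k (Lfbar n k) (loewner_target n k).
Proof.
exists (rpow n k), axes; split; [|split; [|split]].
- split; last split.
  + by split; [apply/is_formP; exact: hform_rpow|exact: sph_rpow].
  + by move=> j; split; [apply/is_formP; exact: hform_axes|exact: sph_axes].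
  + rewrite det_gram_axes; apply: mulr_gt0; first by rewrite exprn_gt0 ?ltr0n.
    rewrite lt_def sqr_ge0 andbT sqrf_eq0.
    by have := avg_mx_unit; rewrite unitmxE unitfE.
- exact: loewner_target_ellipsoid.
- move=> f Kf; apply/loewner_targetP; have [g [hg fE gg]] := Lfbar_preimage eb Kf.
  exists g; split=> //; case: Kf => _ [_]; rewrite fE sph_avgT //.
- exact: loewner_minimal.
Qed.

End Loewner.

Theorem loewner_ellipsoid_Lfbar (R : realType) n k : (2 <= n)%N -> (1 <= k)%N ->
  @loewner_ellipsoid R n k (Lfbar n k) (loewner_target n k).
Proof.
move=> n2 k1; have n0 : (0 < n)%N by apply: ltn_trans n2.
have r1 : ip n (rpow n k) (rpow n k : @fn R n) = 1.
  by rewrite (ip_rpow k n0 (hform_rpow n k)) sph_rpow.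
have [e [eb e0]] := onb_exists_unit n0 (esym (DdimE n2 k1)) (hform_rpow n k) r1.
exact: (loewner_Lfbar n2 k1 eb e0).
Qed.

(** * Nonnegative polynomials on a half-line *)

Section SumsOfSquares.
Context {R : realType}.
Implicit Types p q : {poly R}.

Lemma poly_ge0_lead_gt0 p : (1 < size p)%N -> (forall x, 0 <= p.[x]) -> 0 < lead_coef p.
Proof.
move=> sp p0; rewrite ltNge; apply/negP => l0.
have pn0 : lead_coef p != 0 by rewrite lead_coef_eq0 -size_poly_gt0 ltnW.
have lN : 0 < lead_coef (- p) by rewrite lead_coefN oppr_gt0 lt_def eq_sym pn0.
have [b hb] := polyrcf.poly_pinfty_gt_lc lN.
have := hb b (lexx _); rewrite hornerN => /(lt_le_trans lN); rewrite oppr_gt0 ltNge.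
by rewrite p0.
Qed.

(** The leading coefficients of p(x) - p(0) and p(-x) - p(0) are positive when p is not constant, so
    beyond some [B] on either side the values are at least p(0); the minimum over [-B, B] is then
    global. *)
Lemma poly_ge0_attains_min p : (forall x, 0 <= p.[x]) -> exists c, forall x, p.[c] <= p.[x].
Proof.
move=> p0; have [sp|sp] := leqP (size p) 1.
  by exists 0 => x; rewrite (size1_polyC sp) !hornerC.
have right q : (1 < size q)%N -> (forall x, 0 <= q.[x]) -> exists b, forall x, b <= x -> q.[0] <= q.[x].
  move=> sq q0; have lq : lead_coef (q - q.[0]%:P) = lead_coef q.
    by rewrite lead_coefDl // size_polyN (leq_ltn_trans (size_polyC_leq1 _)).
  have l0 : 0 < lead_coef (q - q.[0]%:P) by rewrite lq; exact: poly_ge0_lead_gt0.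
  have [b hb] := polyrcf.poly_pinfty_gt_lc l0; exists b => x /hb.
  by rewrite hornerD hornerN hornerC => /(le_trans (ltW l0)); rewrite subr_ge0.
have [b hb] := right p sp p0.
have [b' hb'] : exists b, forall x, b <= x -> (p \Po - 'X).[0] <= (p \Po - 'X).[x].
  apply: right => [|x]; last by rewrite horner_comp.
  by rewrite size_comp_poly2 // size_polyN size_polyX.
pose B := Num.max `|b| `|b'|.
have BB : - B <= B by rewrite lerNl ge0_cp // /B le_max normr_ge0.
have [c _ cmin] := EVT_min BB (continuous_subspaceT (@horner_continuous R p)).
have B0 : 0 <= B by rewrite le_max normr_ge0.
have c0 : p.[c] <= p.[0] by apply: cmin; rewrite in_itv /= B0 oppr_le0 B0.
exists c => x; have [xB|xB] := leP x B; last first.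
  apply: (le_trans c0); apply: hb; apply: le_trans (ltW xB).
  by rewrite le_max ler_norm.
have [Bx|Bx] := leP (- B) x; first by apply: cmin; rewrite in_itv /= Bx xB.
apply: (le_trans c0); have := hb' (- x).
rewrite !horner_comp !hornerN !hornerX opprK oppr0; apply.
rewrite lerNr; apply: (le_trans (ltW Bx)); rewrite lerN2.
by rewrite le_max ler_norm orbT.
Qed.

Lemma poly_gt0_near p c : 0 < p.[c] ->
  exists2 e : R, 0 < e & forall x, `|x - c| < e -> 0 < p.[x].
Proof.
move=> pc; have /cvgrPdist_lt /(_ p.[c] pc) /nbhs_ballP[e /= e0 he] := @horner_continuous R p c.
exists e => // x xc; have := he x; rewrite /ball /= distrC => /(_ xc).
by rewrite ltr_norml => /andP[_ h]; lra.
Qed.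

Lemma poly_ge0_off_root p c : (forall x, x != c -> 0 <= p.[x]) -> forall x, 0 <= p.[x].
Proof.
move=> p0 x; have [->|/p0//] := eqVneq x c.
rewrite leNgt; apply/negP => pc.
have pc' : 0 < (- p).[c] by rewrite hornerN oppr_gt0.
have [e e0 he] := poly_gt0_near pc'.
have := he (c + e / 2); rewrite addrAC subrr add0r ger0_norm; last by lra.
rewrite hornerN oppr_gt0 => /(_ _) h.
have /h : e / 2 < e by lra.
by apply/negP; rewrite -leNgt; apply: p0; rewrite -subr_eq0 addrAC subrr add0r gt_eqF //; lra.
Qed.

(** No factorisation over the complex numbers is needed. Subtracting the minimum, attained at [c],
    leaves a nonnegative polynomial with a double root at [c]; the quotient by (X - c)^2 is
    nonnegative of degree two less, and the minimum is itself a square. *)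
Lemma poly_ge0_sum_squares k p : (size p <= (2 * k).+1)%N -> (forall x, 0 <= p.[x]) ->
  exists s : seq {poly R}, (forall q, q \in s -> (size q <= k.+1)%N) /\ p = \sum_(q <- s) q ^+ 2.
Proof.
have const l p' : (size p' <= 1)%N -> (forall x, 0 <= p'.[x]) ->
    exists s : seq {poly R}, (forall q, q \in s -> (size q <= l.+1)%N) /\ p' = \sum_(q <- s) q ^+ 2.
  move=> sp p0; exists [:: (Num.sqrt p'`_0)%:P]; split.
    by move=> q; rewrite inE => /eqP ->; apply: leq_trans (size_polyC_leq1 _) _.
  rewrite big_seq1 -polyC_exp sqr_sqrtr -?size1_polyC //.
  by have := p0 0; rewrite horner_coef0.
elim: k p => [|k IH] p sp p0; first exact: const.
have [sp1|sp1] := leqP (size p) 1; first exact: const.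
have [c cmin] := poly_ge0_attains_min p0.
pose q := p - p.[c]%:P.
have q0 x : 0 <= q.[x] by rewrite hornerD hornerN hornerC subr_ge0.
have : root q c by rewrite /root hornerD hornerN hornerC subrr.
move=> /factor_theorem[r rE].
have r_sign x : 0 <= r.[x] * (x - c) by have := q0 x; rewrite rE hornerM hornerXsubC.
have : root r c.
  rewrite /root eq_le !leNgt; apply/andP; split; apply/negP => rc.
    have [e e0 he] := poly_gt0_near rc.
    have := he (c - e / 2); have := r_sign (c - e / 2).
    rewrite addrAC subrr sub0r normrN ger0_norm; last by lra.
    rewrite mulrN oppr_ge0 leNgt => /negP H /(_ _) h; apply: H.
    by rewrite mulr_gt0 ?divr_gt0 //; apply: h; lra.
  have rc' : 0 < (- r).[c] by rewrite hornerN oppr_gt0.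
  have [e e0 he] := poly_gt0_near rc'.
  have := he (c + e / 2); have := r_sign (c + e / 2).
  rewrite addrAC subrr add0r ger0_norm; last by lra.
  rewrite hornerN oppr_gt0 leNgt => /negP H /(_ _) h; apply: H.
  by rewrite pmulr_llt0 ?divr_gt0 //; apply: h; lra.
move=> /factor_theorem[t tE].
have qE : q = t * ('X - c%:P) ^+ 2 by rewrite rE tE -mulrA expr2.
have sq : size q = size p.
  by rewrite size_polyDl // size_polyN (leq_ltn_trans (size_polyC_leq1 _)).
have t_neq0 : t != 0.
  by apply: contraTneq sp1 => t0; rewrite -sq qE t0 mul0r size_poly0.
have st : (size t <= (2 * k).+1)%N.
  have := sq; rewrite qE size_Mmonic ?monic_exp ?monicXsubC // size_exp_XsubC.
  move: sp; move: (size p) (size t) => sp' st'; lia.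
have t0 : forall x, 0 <= t.[x].
  apply: (@poly_ge0_off_root _ c) => x xc.
  have := q0 x; rewrite qE hornerM horner_exp hornerXsubC pmulr_lge0 //.
  by rewrite lt_def sqr_ge0 sqrf_eq0 subr_eq0 xc.
have [s [ss tsq]] := IH t st t0.
exists ((Num.sqrt p.[c])%:P :: [seq u * ('X - c%:P) | u <- s]); split.
  move=> u; rewrite inE => /predU1P[->|/mapP[v /ss sv ->]].
    by apply: leq_trans (size_polyC_leq1 _) _.
  by apply: leq_trans (size_polyMleq _ _) _; rewrite size_XsubC addn2.
rewrite big_cons big_map -polyC_exp sqr_sqrtr //.
under eq_bigr do rewrite exprMn.
by rewrite -mulr_suml -tsq -qE /q addrC subrK.
Qed.

(* The even and odd parts of the squares in a decomposition of [p.[z^2]] do not mix. *)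
Lemma poly_ge0_halfline k p : (size p <= k.+1)%N -> (forall z : R, 0 <= z -> 0 <= p.[z]) ->
  exists s : seq ({poly R} * {poly R}),
    (forall ab, ab \in s -> (size ab.1).*2 <= k.+2)%N /\
    forall z : R, 0 <= z -> p.[z] = \sum_(ab <- s) (ab.1.[z] ^+ 2 + z * ab.2.[z] ^+ 2).
Proof.
move=> sp p0; pose p2 := p \Po 'X^2.
have p2E x : p2.[x] = p.[x ^+ 2] by rewrite horner_comp hornerXn.
have p2_ge0 x : 0 <= p2.[x] by rewrite p2E p0 ?sqr_ge0.
have sp2 : (size p2 <= (2 * k).+1)%N.
  have [pz|p_neq0] := eqVneq p 0; first by rewrite /p2 pz comp_poly0 size_poly0.
  have := size_comp_poly p 'X^2; rewrite -/p2 size_polyXn => E.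
  have := size_poly_gt0 p; rewrite p_neq0; move: E sp; move: (size p) (size p2); lia.
have [s [ss sE]] := poly_ge0_sum_squares sp2 p2_ge0.
exists [seq (even_poly q, odd_poly q) | q <- s]; split.
  move=> ab /mapP[q /ss sq ->] /=.
  by have := size_even_poly q; rewrite -(leq_double) => /leq_trans; apply; lia.
move=> z z0; rewrite big_map /=; pose y := Num.sqrt z.
have yz : y ^+ 2 = z by rewrite sqr_sqrtr.
have qE (q : {poly R}) x : q.[x] = (even_poly q).[x ^+ 2] + (odd_poly q).[x ^+ 2] * x.
  by rewrite -{1}(poly_even_odd q) hornerD hornerM hornerX !horner_comp hornerXn.
have E x : p2.[x] = \sum_(q <- s) q.[x] ^+ 2.
  by rewrite sE horner_sum; apply: eq_bigr => q _; rewrite horner_exp.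
have : p.[z] + p.[z] = \sum_(q <- s) (q.[y] ^+ 2 + q.[- y] ^+ 2).
  by rewrite big_split /= -!E !p2E sqrrN yz.
have -> : \sum_(q <- s) (q.[y] ^+ 2 + q.[- y] ^+ 2) =
    \sum_(q <- s) 2 * ((even_poly q).[z] ^+ 2 + z * (odd_poly q).[z] ^+ 2).
  apply: eq_bigr => q _; rewrite (qE q y) (qE q (- y)) sqrrN yz.
  by move: (even_poly q).[z] (odd_poly q).[z] => u v; rewrite -yz; ring.
rewrite -mulr_sumr; set S := \sum_(q <- s) _; lra.
Qed.

End SumsOfSquares.

(** * Values of nonnegative forms *)

Section Slices.
Context {R : realType}.
Variable n : nat.
Implicit Types (x : 'rV[R]_n.+1) (y : 'rV[R]_n).

Definition tail x : 'rV[R]_n := \row_j x ord0 (lift ord0 j).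

Lemma tailE x j : tail x ord0 j = x ord0 (lift ord0 j).
Proof. by rewrite mxE. Qed.

Lemma hform_tail d (q : @fn R n) : hform d q -> hform d (fun x => q (tail x)).
Proof.
elim=> {d q} [d|c|d j f hf IH|d f g hf IHf hg IHg]; first exact: hform0.
- exact: hformC.
- by under eq_fun do rewrite tailE; apply: hformX.
- exact: hformD.
Qed.

Lemma pd_tail d j (q : @fn R n) : hform d q ->
  pd (lift ord0 j) (fun x => q (tail x)) = fun x => pd j q (tail x).
Proof.
elim=> {d q} [d|c|d i f hf IH|d f g hf IHf hg IHg].
- by rewrite !pd_cst.
- by rewrite !pd_cst.
- rewrite (pdX j i hf).
  transitivity (pd (lift ord0 j) (fun x => x ord0 (lift ord0 i) * f (tail x))).
    by congr pd; apply/funext => x; rewrite tailE.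
  rewrite (pdX _ _ (hform_tail hf)) IH; apply/funext => x.
  by rewrite tailE (inj_eq lift_inj).
- by rewrite (pdD j hf hg) (pdD _ (hform_tail hf) (hform_tail hg)) IHf IHg.
Qed.

Lemma pd0_tail d (q : @fn R n) : hform d q -> pd ord0 (fun x => q (tail x)) = fun=> 0.
Proof.
elim=> {d q} [d|c|d i f hf IH|d f g hf IHf hg IHg].
- by rewrite !pd_cst.
- by rewrite !pd_cst.
- transitivity (pd ord0 (fun x => x ord0 (lift ord0 i) * f (tail x))).
    by congr pd; apply/funext => x; rewrite tailE.
  rewrite (pdX _ _ (hform_tail hf)) IH; apply/funext => x.
  by rewrite mulr0 add0r eq_sym (negPf (neq_lift _ _)) mul0r.
- by rewrite (pdD _ (hform_tail hf) (hform_tail hg)) IHf IHg; apply/funext => x; rewrite addr0.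
Qed.

Lemma hform_x0 a d (q : @fn R n.+1) : hform d q -> hform (a + d) (fun x => x ord0 ord0 ^+ a * q x).
Proof.
move=> hq; apply: hformM hq.
by have := hformXn a (hform_coord (R := R) (ord0 : 'I_n.+1)); rewrite muln1.
Qed.

Lemma pd0_slice a d (q : @fn R n) : hform d q ->
  pd ord0 (fun x => x ord0 ord0 ^+ a * q (tail x)) =
  fun x => a%:R * (x ord0 ord0 ^+ a.-1 * q (tail x)).
Proof.
move=> hq; have hq' := hform_tail hq; elim: a => [|a IH].
  transitivity (pd ord0 (fun x => q (tail x))).
    by congr pd; apply/funext => x; rewrite expr0 mul1r.
  by rewrite (pd0_tail hq); apply/funext => x; rewrite mul0r.
transitivity (pd ord0 (fun x => x ord0 ord0 * (x ord0 ord0 ^+ a * q (tail x)))).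
  by congr pd; apply/funext => x; rewrite mulrA -exprS.
rewrite (pdX _ _ (hform_x0 a hq')) IH; apply/funext => x; rewrite eqxx mul1r -[in RHS]natr1.
case: a {IH} => [|a]; first by rewrite mul0r mulr0 !add0r mul1r.
rewrite /= exprS; ring.
Qed.

Lemma slices d (G : @fn R n.+1) : hform d G -> exists g : nat -> @fn R n,
  (forall j, hform j (g j)) /\
  forall x, G x = \sum_(j < d.+1) x ord0 ord0 ^+ (d - j) * g j (tail x).
Proof.
elim=> {d G} [d|c|d i f hf [g [hg gE]]|d f1 f2 hf1 [g1 [hg1 gE1]] hf2 [g2 [hg2 gE2]]].
- exists (fun _ _ => 0); split=> [j|x]; first exact: hform0.
  by rewrite big1 // => j _; rewrite mulr0.
- exists (fun j => if j is 0%N then fun=> c else fun=> 0); split=> [[|j]|x].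
  + exact: hformC.
  + exact: hform0.
  + by rewrite big_ord_recl big_ord0 addr0 mul1r.
- case: (unliftP ord0 i) => [i'|] ->.
    exists (fun j => if j is j'.+1 then fun y => y ord0 i' * g j' y else fun=> 0); split.
      by case=> [|j]; [exact: hform0|exact: hformX].
    move=> x; rewrite gE [in RHS]big_ord_recl mulr0 add0r mulr_sumr; apply: eq_bigr => j _.
    by rewrite lift0 subSS tailE mulrCA.
  exists (fun j => if (j <= d)%N then g j else fun=> 0); split.
    by move=> j; case: ifP => _ //; exact: hform0.
  move=> x; rewrite gE [in RHS]big_ord_recr /= ltnn mulr0 addr0 mulr_sumr.
  apply: eq_bigr => j _; have jd : (j <= d)%N by rewrite -ltnS.
  by rewrite jd mulrA -exprS subSn.
exists (fun j y => g1 j y + g2 j y); split=> [j|x]; first exact: hformD.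
by rewrite gE1 gE2 -big_split; apply: eq_bigr => j _; rewrite mulrDr.
Qed.

Lemma r2_tail x : r2 n.+1 x = x ord0 ord0 ^+ 2 + r2 n (tail x).
Proof.
rewrite /r2 big_ord_recl; congr (_ + _); apply: eq_bigr => j _; by rewrite tailE.
Qed.

Lemma hform_ge0_off0 d (h : @fn R n.+1) : hform d h ->
  (forall x, x ord0 ord0 != 0 -> 0 <= h x) -> forall x, 0 <= h x.
Proof.
move=> hh h0 x; have [p pE] := hform_line hh x ord0.
have sx (y : R) : setcoord x ord0 y ord0 ord0 = y by rewrite /setcoord mxE eqxx.
have p0 (y : R) : y != 0 -> 0 <= p.[y].
  by move=> y0; have [<- _] := pE y; apply: h0; rewrite sx.
have := poly_ge0_off_root p0 (x ord0 ord0); have [<- _] := pE (x ord0 ord0).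
congr (_ <= h _); apply/rowP => i; rewrite /setcoord mxE.
by case: eqP => // ->.
Qed.

(** The ratio between the mean over the larger sphere of a form in the last [n] coordinates and its
    mean over their own sphere. *)
Fixpoint tail_moment b : R := if b is b'.+1 then (n + 2 * b')%:R / (n.+1 + 2 * b')%:R * tail_moment b' else 1.

Lemma sph_tail b (q : @fn R n) : hform (2 * b) q ->
  sph_int n.+1 (fun x => q (tail x)) = tail_moment b * sph_int n q.
Proof.
elim: b q => [|b IH] q hq.
  by have [c ->] := hform_const hq; rewrite !sph_cst mul1r.
have nz : ((n.+1 + 2 * b)%:R : R) != 0 by rewrite pnatr_eq0 addSn.
(* An inner induction on the construction of the form reduces it to products of a coordinate and a
   form, where integration by parts on both spheres leads to the same derivative. *)
suff H d (q' : @fn R n) : hform d q' -> d = (2 * b).+2 -> sph_int n.+1 (fun x => q' (tail x)) = tail_moment b.+1 * sph_int n q'.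
  by apply: (H _ _ hq); rewrite mulnS.
elim=> {d q' q hq} [d|c|d j f hf _|d f g hf IHf hg IHg] // dE.
- by rewrite !sph_cst mulr0.
- case: dE => dE; rewrite dE in hf.
  have E1 := sph_ibp j hf.
  have E2 := sph_ibp (lift ord0 j) (hform_tail hf).
  have hp : hform (2 * b) (pd j f) by exact (hform_pd j hf).
  rewrite (pd_tail j hf) (IH _ hp) -E1 in E2.
  have -> : sph_int n.+1 (fun x => tail x ord0 j * f (tail x)) =
            sph_int n.+1 (fun x => x ord0 (lift ord0 j) * f (tail x)).
    by apply: eq_sph => x; rewrite tailE.
  apply: (mulfI nz); rewrite E2 /=; move: (sph_int n _) => S.
  have alg (A B C : R) : B != 0 -> C * (A * S) = B * (A / B * C * S) by move=> ?; field.
  exact: alg.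
- rewrite (sphD (hform_tail hf) (hform_tail hg)) (sphD hf hg) mulrDr.
  by rewrite (IHf dE) (IHg dE).
Qed.

Fixpoint slice_moment a b : R :=
  if a is a'.+1 then (2 * a').+1%:R / (n.+1 + 2 * (a' + b))%:R * slice_moment a' b else tail_moment b.

Lemma sph_slice_step a d m (q : @fn R n) : hform d q -> (a + d = 2 * m)%N ->
  (n.+1 + 2 * m)%:R * sph_int n.+1 (fun x => x ord0 ord0 ^+ a.+2 * q (tail x)) =
  a.+1%:R * sph_int n.+1 (fun x => x ord0 ord0 ^+ a * q (tail x)).
Proof.
move=> hq E; have hq' := hform_tail hq.
have hf : hform (2 * m).+1 (fun x => x ord0 ord0 ^+ a.+1 * q (tail x)).
  by rewrite -E; exact (hform_x0 a.+1 hq').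
rewrite -(sphZ _ (hform_x0 a hq')) -(pd0_slice _ hq) -(sph_ibp ord0 hf).
by congr (_ * _); apply: eq_sph => x; rewrite mulrA -exprS.
Qed.

(** The factor is the same for all [q] of a given degree: a slice may be exchanged for the multiple
    of a power of the radius with the same mean, which is why passing to [zonal] preserves the
    mean. *)
Lemma sph_slice_even a b (q : @fn R n) : hform (2 * b) q ->
  sph_int n.+1 (fun x => x ord0 ord0 ^+ (2 * a) * q (tail x)) = slice_moment a b * sph_int n q.
Proof.
move=> hq; elim: a => [|a IH].
  by rewrite /= -(sph_tail hq); apply: eq_sph => x; rewrite expr0 mul1r.
have nz : ((n.+1 + 2 * (a + b))%:R : R) != 0 by rewrite pnatr_eq0 addSn.
rewrite mulnS; apply: (mulfI nz).
rewrite (sph_slice_step hq (esym (mulnDr 2%N a b))) IH.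
have alg (A B C D : R) : B != 0 -> A * (C * D) = B * (A / B * C * D) by move=> ?; field.
exact: alg.
Qed.

Lemma sph_slice_odd a b (q : @fn R n) : hform (2 * b).+1 q ->
  sph_int n.+1 (fun x => x ord0 ord0 ^+ (2 * a).+1 * q (tail x)) = 0.
Proof.
move=> hq; have hq' := hform_tail hq.
have nz m : ((n.+1 + 2 * m)%:R : R) != 0 by rewrite pnatr_eq0 addSn.
elim: a => [|a IH].
  apply: (mulfI (nz b)); rewrite mulr0 -[RHS](sph_cst n.+1 0) -(pd0_tail hq) -(sph_ibp ord0 hq').
  by congr (_ * sph_int _ _); apply/funext => x.
rewrite mulnS; apply: (mulfI (nz (a + b).+1)).
have E : ((2 * a).+1 + (2 * b).+1 = 2 * (a + b).+1)%N by lia.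
by rewrite (sph_slice_step hq E) IH !mulr0.
Qed.

Lemma sum_parity k (F : nat -> R) :
  \sum_(j < (2 * k).+1) F j = \sum_(i < k.+1) F (2 * i)%N + \sum_(i < k) F (2 * i).+1.
Proof.
elim: k => [|k IH]; first by rewrite !big_ord_recr !big_ord0 /= addr0.
have -> : (2 * k.+1).+1 = (2 * k).+3 by rewrite mulnS.
rewrite big_ord_recr big_ord_recr /= IH [in RHS]big_ord_recr [X in _ = _ + X]big_ord_recr /=.
have -> : (2 * k.+1 = (2 * k).+2)%N by rewrite mulnS.
ring.
Qed.

End Slices.

Section ZonalBound.
Context {R : realType}.

Lemma form_sqr_le n d (f : @fn R n) v : (0 < n)%N -> hform d f -> r2 n v = 1 ->
  f v ^+ 2 <= (Ddim n d)%:R * ip n f f.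
Proof.
move=> n0 hf v1; have [e E] := onb_exists (R := R) n0 (erefl (Ddim n d)).
have [he _ es] := E.
rewrite {1}(es f hf); apply: le_trans (sum_cauchy_schwarz _ _) _.
rewrite (onb_kernel n0 E v1) mulrC ler_pM2l; last first.
  by rewrite ltr0n /Ddim bin_gt0; case: n n0 {f v hf v1 e E he es} => // n _; rewrite addSn subn1 leq_addl.
rewrite (onb_parseval E hf hf); apply: eq_ler.
by apply: eq_bigr => i _; rewrite expr2.
Qed.

Variables n k : nat.
Hypotheses (n0 : (0 < n)%N) (k0 : (0 < k)%N).
Implicit Types (x : 'rV[R]_n.+1) (y : 'rV[R]_n).

Definition cons_row (s : R) y : 'rV[R]_n.+1 :=
  \row_i (if unlift ord0 i is Some j then y ord0 j else s).

Lemma cons_row0 s y : cons_row s y ord0 ord0 = s.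
Proof. by rewrite mxE unlift_none. Qed.

Lemma tail_cons s y : tail (cons_row s y) = y.
Proof. by apply/rowP => j; rewrite !mxE liftK. Qed.

Variable G : @fn R n.+1.
Hypothesis G0 : forall x, 0 <= G x.

Section Sliced.
Variable g : nat -> @fn R n.
Hypotheses (hg : forall j, hform j (g j))
  (gE : forall x, G x = \sum_(j < (2 * k).+1) x ord0 ord0 ^+ (2 * k - j) * g j (tail x)).

Let P i := sph_int n (g (2 * i)).

(** Adding [G] at (1, ty) and at (1, -ty), where t^2 = z, cancels the odd slices and leaves twice
    the even part, which is nonnegative. Powers of [r2] make it a form in y, whose mean is the
    stated polynomial. *)
Lemma slices_mean_ge0 (z : R) : 0 <= z -> 0 <= \sum_(i < k.+1) P i * z ^+ i.
Proof.
move=> z0; pose t := Num.sqrt z; have tz : t ^+ 2 = z by rewrite sqr_sqrtr.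
pose E y := \sum_(i < k.+1) z ^+ i * (r2 n y ^+ (k - i) * g (2 * i) y).
have hE1 (i : 'I_k.+1) : hform (2 * k) (fun y => r2 n y ^+ (k - i) * g (2 * i) y).
  have -> : (2 * k = 2 * (k - i) + 2 * i)%N by have := ltn_ord i; lia.
  exact (hformM (hform_r2X n (k - i)) (hg (2 * i))).
have hE : hform (2 * k) E by apply: hform_sum => i _; exact (hformZ _ (hE1 i)).
have -> : \sum_(i < k.+1) P i * z ^+ i = sph_int n E.
  rewrite /E (sph_sum _ (fun (i : 'I_k.+1) _ => hformZ (z ^+ i) (hE1 i))); apply: eq_bigr => i _.
  by rewrite (sphZ _ (hE1 i)) (sph_r2X n0 (k - i) (hg (2 * i))) mulrC.
apply: (sph_ge0_sphere k0 hE) => y y1.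
have GE u : G (cons_row 1 (u *: y)) = \sum_(i < k.+1) u ^+ (2 * i) * g (2 * i)%N y +
    \sum_(i < k) u ^+ (2 * i).+1 * g (2 * i).+1 y.
  rewrite gE -(sum_parity k (fun j => u ^+ j * g j y)); apply: eq_bigr => j _.
  by rewrite cons_row0 tail_cons expr1n mul1r (hform_homog (hg j)).
have := addr_ge0 (G0 (cons_row 1 (t *: y))) (G0 (cons_row 1 (- t *: y))); rewrite !GE.
have -> : \sum_(i < k.+1) (- t) ^+ (2 * i) * g (2 * i)%N y = E y.
  by apply: eq_bigr => i _; rewrite exprM sqrrN tz y1 expr1n mul1r.
have -> : \sum_(i < k.+1) t ^+ (2 * i) * g (2 * i)%N y = E y.
  by apply: eq_bigr => i _; rewrite exprM tz y1 expr1n mul1r.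
have -> : \sum_(i < k) (- t) ^+ (2 * i).+1 * g (2 * i).+1 y =
    - \sum_(i < k) t ^+ (2 * i).+1 * g (2 * i).+1 y.
  by rewrite -sumrN; apply: eq_bigr => i _; rewrite !exprS !exprM sqrrN !mulNr.
set S := \sum_(i < k) _; lra.
Qed.

(* The mean of [G] over the rotations that fix the pole [cons_row 1 0]. *)
Definition zonal x : R := \sum_(i < k.+1) P i * (x ord0 ord0 ^+ (2 * (k - i)) * r2 n (tail x) ^+ i).

Lemma hform_zonal_term (i : 'I_k.+1) :
  hform (2 * k) (fun x => x ord0 ord0 ^+ (2 * (k - i)) * r2 n (tail x) ^+ i).
Proof.
have -> : (2 * k = 2 * (k - i) + 2 * i)%N by have := ltn_ord i; lia.
exact (hform_x0 (2 * (k - i)) (hform_tail (hform_r2X n i))).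
Qed.

Lemma hform_zonal : hform (2 * k) zonal.
Proof. by apply: hform_sum => i _; exact (hformZ _ (hform_zonal_term i)). Qed.

Lemma sph_zonal : sph_int n.+1 zonal = sph_int n.+1 G.
Proof.
have hGt (j : 'I_(2 * k).+1) : hform (2 * k) (fun x => x ord0 ord0 ^+ (2 * k - j) * g j (tail x)).
  by have := hform_x0 (2 * k - j) (hform_tail (hg j)); rewrite subnK // -ltnS.
have -> : sph_int n.+1 G = \sum_(j < (2 * k).+1)
    sph_int n.+1 (fun x => x ord0 ord0 ^+ (2 * k - j) * g j (tail x)).
  rewrite -(sph_sum _ (fun j _ => hGt j)); congr (sph_int _ _); exact/funext.
rewrite (sum_parity k (fun j => sph_int n.+1 (fun x => x ord0 ord0 ^+ (2 * k - j) * g j (tail x)))).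
rewrite [X in _ = _ + X]big1 ?addr0 => [|i _].
  rewrite /zonal (sph_sum _ (fun (i : 'I_k.+1) _ => hformZ (P i) (hform_zonal_term i))).
  apply: eq_bigr => i _; rewrite (sphZ _ (hform_zonal_term i)).
  rewrite (sph_slice_even (k - i) (hform_r2X n i)) (sph_rpow i n0 : sph_int n (fun y => r2 n y ^+ i) = 1).
  have -> : (2 * k - 2 * i = 2 * (k - i))%N by lia.
  by rewrite (sph_slice_even (k - i) (hg (2 * i))) mulr1 mulrC.
have -> : (2 * k - (2 * i).+1 = (2 * (k - i.+1)).+1)%N by have := ltn_ord i; lia.
exact (sph_slice_odd (k - i.+1) (hg (2 * i).+1)).
Qed.

Lemma zonal_pole : G (cons_row 1 0) <= (Ddim n.+1 k)%:R * sph_int n.+1 G.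
Proof.
pose p := \poly_(i < k.+1) P i.
have pE (z : R) : p.[z] = \sum_(i < k.+1) P i * z ^+ i by exact: horner_poly.
have [||s [ss sE]] := @poly_ge0_halfline R k p; first exact: size_poly.
  by move=> z z0; rewrite pE slices_mean_ge0.
(* Homogenises the first polynomial of each pair to a form of degree [k]; the size bound keeps its
   degree at most k/2. The second polynomials are dropped: their terms carry the factor z, so they
   are nonnegative and vanish at the pole. *)
pose A (ab : {poly R} * {poly R}) x :=
  \sum_(i < k./2.+1) ab.1`_i * (x ord0 ord0 ^+ (k - 2 * i) * r2 n (tail x) ^+ i).
have hA1 (i : 'I_k./2.+1) : hform k (fun x => x ord0 ord0 ^+ (k - 2 * i) * r2 n (tail x) ^+ i).
  have ik : (k = (k - 2 * i) + 2 * i)%N by have := ltn_ord i; lia.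
  rewrite [X in hform X]ik; exact (hform_x0 (k - 2 * i) (hform_tail (hform_r2X n i))).
have hA ab : hform k (A ab) by apply: hform_sum => i _; exact (hformZ _ (hA1 i)).
have hAA ab : hform (k + k) (fun x => A ab x * A ab x) by exact (hformM (hA ab) (hA ab)).
have hS : hform (k + k) (fun x => \sum_(ab <- s) A ab x * A ab x) by exact: hform_sum.
have hZ : hform (k + k) zonal by rewrite addnn -mul2n; exact hform_zonal.
(* Nonnegativity of [D] bounds the means of the squares by the mean of [G], while at the pole the
   sum of the squares equals [G]. *)
pose D x := zonal x + -1 * \sum_(ab <- s) A ab x * A ab x.
have hD : hform (k + k) D by exact (hformD hZ (hformZ (-1) hS)).
have D0 x : 0 <= D x.
  apply: (hform_ge0_off0 hD) => {}x; set c := x ord0 ord0 => c0.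
  (* Dehomogenisation by the first coordinate; the hyperplane where it vanishes is recovered by
     continuity in [hform_ge0_off0]. *)
  pose z := r2 n (tail x) / c ^+ 2.
  have c2 : c ^+ 2 != 0 by rewrite sqrf_eq0.
  have rz : r2 n (tail x) = c ^+ 2 * z by rewrite /z mulrCA divff // mulr1.
  have z0 : 0 <= z by rewrite divr_ge0 ?r2_ge0 ?sqr_ge0.
  have ZE : zonal x = (c ^+ k) ^+ 2 * p.[z].
    rewrite pE mulr_sumr; apply: eq_bigr => i _; rewrite rz [RHS]mulrCA; congr (_ * _).
    rewrite exprMn mulrA -!exprM -exprD; congr (_ ^+ _ * _).
    by have := ltn_ord i; lia.
  have AE ab : ab \in s -> A ab x = c ^+ k * ab.1.[z].
    move=> /ss sa; rewrite (@horner_coef_wide _ k./2.+1) ?mulr_sumr; last first.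
      by move: sa; move: (size _) => l; lia.
    apply: eq_bigr => i _; rewrite rz [RHS]mulrCA; congr (_ * _).
    rewrite exprMn mulrA -!exprM -exprD; congr (_ ^+ _ * _).
    by have := ltn_ord i; lia.
  rewrite /D ZE sE // mulN1r.
  have -> : \sum_(ab <- s) A ab x * A ab x = (c ^+ k) ^+ 2 * \sum_(ab <- s) ab.1.[z] ^+ 2.
    rewrite mulr_sumr big_seq [RHS]big_seq; apply: eq_bigr => ab abs.
    by rewrite AE // -expr2 exprMn.
  rewrite -mulrBr mulr_ge0 ?sqr_ge0 // big_split /= addrAC subrr add0r.
  by apply: sumr_ge0 => ab _; rewrite mulr_ge0 ?sqr_ge0.
have SD := sph_ge0 D0.
rewrite /D (sphD hZ (hformZ (-1) hS)) (sphZ _ hS) (sph_sum _ (fun ab _ => hAA ab)) mulN1r subr_ge0 sph_zonal in SD.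
have r0 : r2 n (0 : 'rV[R]_n) = 0.
  by rewrite /r2 big1 // => j _; rewrite mxE expr0n.
have pole : r2 n.+1 (cons_row 1 0) = 1 by rewrite r2_tail cons_row0 tail_cons r0 expr1n addr0.
have GP : G (cons_row 1 0) = P 0%N.
  have [c hc] := hform_const (hg 0).
  rewrite gE big_ord_recl big1 ?addr0 => [|j _].
    by rewrite cons_row0 expr1n mul1r /P muln0 hc sph_cst.
  by rewrite tail_cons -(scale0r (0 : 'rV[R]_n)) (hform_homog (hg _)) exprS !mul0r mulr0.
have AP ab : A ab (cons_row 1 0) = ab.1.[0].
  rewrite /A big_ord_recl big1 ?addr0 => [|j _].
    by rewrite cons_row0 expr1n !mulr1 horner_coef0.
  by rewrite tail_cons r0 lift0 exprS mul0r !mulr0.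
have -> : G (cons_row 1 0) = \sum_(ab <- s) A ab (cons_row 1 0) ^+ 2.
  have := sE 0 (lexx _); rewrite pE big_ord_recl big1 ?addr0 => [|j _].
    rewrite mulr1 GP => ->; apply: eq_bigr => ab _; by rewrite AP mul0r addr0.
  by rewrite lift0 exprS mul0r mulr0.
apply: (@le_trans _ _ (\sum_(ab <- s) (Ddim n.+1 k)%:R * ip n.+1 (A ab) (A ab))).
  by apply: ler_sum => ab _; exact: form_sqr_le.
by rewrite -mulr_sumr ler_wpM2l.
Qed.

End Sliced.
End ZonalBound.

Lemma nonneg_form_le (R : realType) n k (G : @fn R n) v : (2 <= n)%N -> (0 < k)%N ->
  hform (2 * k) G -> (forall x, 0 <= G x) -> r2 n v = 1 -> G v <= (Ddim n k)%:R * sph_int n G.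
Proof.
case: n G v => // n G v n2 k0 hG G0 v1.
have n0 : (0 < n)%N by rewrite -ltnS.
have r0 : r2 n (0 : 'rV[R]_n) = 0.
  by rewrite /r2 big1 // => j _; rewrite mxE expr0n.
have pole : r2 n.+1 (cons_row 1 0 : 'rV[R]_n.+1) = 1 by rewrite r2_tail cons_row0 tail_cons r0 expr1n addr0.
have [Q [QQ Qv]] := unit_sphere_rotation (ltn0Sn n) v1 pole.
have hQ := hform_mulmx Q hG.
have [g [hg gE]] := slices hQ.
have := zonal_pole n0 k0 (fun x => G0 (x *m Q)) hg gE.
by rewrite Qv (sph_mulmx QQ (ltn0Sn n) hG).
Qed.

(** * The dual cone and the coefficient of symmetry *)

Section DualCone.
Context {R : realType}.

Lemma hform_continuous_comp (T : topologicalType) n d (f : @fn R n) (c : T -> 'rV[R]_n) :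
  (forall i, continuous (fun t => c t ord0 i)) -> hform d f -> continuous (fun t => f (c t)).
Proof.
move=> hc; elim=> {d f} [d|a|d j f _ IH|d f g _ IHf _ IHg] t.
- exact: cvg_cst.
- exact: cvg_cst.
- by apply: cvgM; [exact: hc|exact: IH].
- by apply: cvgD; [exact: IHf|exact: IHg].
Qed.

Lemma continuous_sum (T : topologicalType) (I : Type) (r : seq I) (F : I -> T -> R) :
  (forall i, continuous (F i)) -> continuous (fun t => \sum_(i <- r) F i t).
Proof.
move=> hF; elim: r => [|i r IH] t.
  by under eq_fun do rewrite big_nil; exact: cvg_cst.
by under eq_fun do rewrite big_cons; apply: cvgD; [exact: hF|exact: IH].
Qed.

Variables n k M : nat.
Hypotheses (n0 : (0 < n)%N) (k0 : (0 < k)%N).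

Definition pw (a : 'rV[R]_n) : @fn R n := fun x => dotp a x ^+ (2 * k).
Definition sumpw (A : 'M[R]_(M, n)) : @fn R n := fun x => \sum_j pw (row j A) x.

Lemma hform_pw a : hform (2 * k) (pw a).
Proof. exact: hform_dotpX. Qed.

Lemma hform_sumpw A : hform (2 * k) (sumpw A).
Proof. by apply: hform_sum => j _; exact: hform_pw. Qed.

Lemma pwZ c a : pw (c *: a) = fun x => c ^+ (2 * k) * pw a x.
Proof.
apply/funext => x; rewrite /pw -exprMn; congr (_ ^+ _).
by rewrite /dotp mulr_sumr; apply: eq_bigr => i _; rewrite mxE mulrA.
Qed.

Lemma sph_sumpw A : sph_int n (sumpw A) = gam n 0 k * \sum_j r2 n (row j A) ^+ k.
Proof.
rewrite /sumpw (sph_sum _ (fun j _ => hform_pw (row j A))) mulr_sumr.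
by apply: eq_bigr => j _; rewrite /pw sph_dotpX.
Qed.

Lemma ip_residual_sub (f g : @fn R n) : hform (2 * k) f -> hform (2 * k) g -> forall s : R,
  ip n (fun x => f x + - s * g x) (fun x => f x + - s * g x) =
  ip n f f - 2 * s * ip n f g + s ^+ 2 * ip n g g.
Proof.
move=> hf hg s; have hs := hformZ (- s) hg; have hd := hformD hf hs.
rewrite (ipDl hf hs hd) (ipDr hf hs hf) (ipDr hf hs hs) (ipZr _ hg hf) (ipZl _ hg hf).
rewrite (ipZl _ hg hs) (ipZr _ hg hg) [ip n g f]ipC; ring.
Qed.

Lemma sph_sqr_le (f : @fn R n) : hform (2 * k) f -> sph_int n f ^+ 2 <= ip n f f.
Proof.
move=> hf; have hr := hform_rpow (R := R) n k.
have := ip_ge0 (fun x => f x + - sph_int n f * rpow n k x).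
rewrite (ip_residual_sub hf hr) (ip_rpow k n0 hf) (ip_rpow k n0 hr) (sph_rpow k n0); lra.
Qed.

Variable p : @fn R n.
Hypothesis hp : hform (2 * k) p.

Definition residual A : @fn R n := fun x => p x + -1 * sumpw A x.

Lemma hform_residual A : hform (2 * k) (residual A).
Proof. by apply: hformD => //; apply: hformZ; exact: hform_sumpw. Qed.

Lemma sumpw0 : sumpw 0 = fun=> 0.
Proof.
apply/funext => x; rewrite /sumpw big1 // => j _; rewrite row0 -(scale0r 0) pwZ.
by rewrite expr0n gtn_eqF ?mul0r // muln_gt0.
Qed.

(** The residual is continuous and coercive in the matrix of linear forms: a large entry forces a
    large mean of the sum of powers, and the squared norm of the residual is at least its squared
    mean. A minimum over a compact cube is therefore global. *)
Lemma nearest_sum_of_powers : exists A, forall B,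
  ip n (residual A) (residual A) <= ip n (residual B) (residual B).
Proof.
have [e E] := onb_exists (R := R) n0 (erefl (Ddim n (2 * k))); have [he _ _] := E.
pose Phi (w : 'rV[R]_(M * n)) := ip n (residual (vec_mx w)) (residual (vec_mx w)).
have PhiE w : Phi w = \sum_i (ip n p (e i) + -1 * \sum_j powT (2 * k) (e i) (row j (vec_mx w))) ^+ 2.
  rewrite /Phi (onb_parseval E (hform_residual _) (hform_residual _)); apply: eq_bigr => i _.
  rewrite -expr2; congr (_ ^+ 2).
  rewrite (ipDl hp (hformZ _ (hform_sumpw _)) (he i)) (ipZl _ (hform_sumpw _) (he i)).
  by rewrite (ip_suml _ (fun j => hform_pw (row j (vec_mx w))) (he i)).
have cPhi : continuous Phi.
  have -> : Phi = fun w => \sum_i (ip n p (e i) + -1 * \sum_j powT (2 * k) (e i) (row j (vec_mx w))) ^+ 2.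
    exact/funext.
  apply: continuous_sum => i; under eq_fun do rewrite expr2.
  have cS : continuous (fun w : 'rV[R]_(M * n) => \sum_j powT (2 * k) (e i) (row j (vec_mx w))).
    apply: continuous_sum => j.
    apply: (@hform_continuous_comp _ _ _ _ (fun w => row j (vec_mx w)) _ (hform_powT (he i))) => l.
    have -> : (fun w : 'rV[R]_(M * n) => row j (vec_mx w) ord0 l) = fun w => w ord0 (mxvec_index j l).
      by apply/funext => w'; rewrite !mxE.
    exact: coord_continuous.
  have cD w : {for w, continuous (fun w : 'rV[R]_(M * n) =>
      ip n p (e i) + -1 * \sum_j powT (2 * k) (e i) (row j (vec_mx w)))}.
    apply: continuousD; first exact: cst_continuous.
    by apply: continuousM; [exact: cst_continuous|exact: cS].
  by move=> w; exact: continuousM (cD w) (cD w).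
have g0 : 0 < gam n 0 k :> R by exact: gam_gt0.
(* If the mean of the sum of powers is at least [K], the mean of the residual has absolute value at
   least 1 + <p,p>, so the residual is no better than the one at 0, whose squared norm is <p,p>. *)
pose K := `|sph_int n p| + 1 + ip n p p.
have K1 : 1 <= K by rewrite /K addrAC lerDr addr_ge0 ?ip_ge0.
pose C := Num.max 1 (K / gam n 0 k).
have C1 : 1 <= C by rewrite /C le_max lexx.
have CK : K <= gam n 0 k * C ^+ (2 * k).
  rewrite mulrC -ler_pdivrMr //; apply: (@le_trans _ _ C); first by rewrite /C le_max lexx orbT.
  by rewrite -[leLHS]expr1; apply: ler_weXn2l => //; rewrite muln_gt0.
pose cube : set 'rV[R]_(M * n) := [set w | forall i, `[- C, C]%classic (w ord0 i)].
have cube0 : cube 0.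
  by move=> i /=; rewrite mxE in_itv /= oppr_le0 (le_trans ler01 C1).
have ccube : compact cube by exact (@rV_compact _ _ (fun=> `[- C, C]%classic) (fun=> @segment_compact R (- C) C)).
have [w _ wmin] := compact_EVT_min (ex_intro _ 0 cube0) ccube (continuous_subspaceT cPhi).
exists (vec_mx w) => B; rewrite -(mxvecK B) -/(Phi w) -/(Phi (mxvec B)).
have [inB|/existsNP[l outB]] := pselect (cube (mxvec B)); first by apply: wmin; exact/mem_set.
apply: (@le_trans _ _ (Phi 0)); first by apply: wmin; exact/mem_set.
have [j [i lE]] : exists j i, l = mxvec_index j i.
  by case/mxvec_indexP: l outB => j i _; exists j, i.
have BC : C ^+ 2 <= r2 n (row j B).
  have CB : C <= `|B j i|.
    move: outB; rewrite lE mxvecE /= in_itv /= -ler_norml => /negP; rewrite -ltNge.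
    exact: ltW.
  apply: (@le_trans _ _ (B j i ^+ 2)).
    by rewrite -[B j i ^+ 2]real_normK ?num_real // lerXn2r ?nnegrE // (le_trans ler01).
  rewrite /r2 (bigD1 i) //= mxE lerDl; apply: sumr_ge0 => ? _; exact: sqr_ge0.
have big : K <= sph_int n (sumpw B).
  rewrite sph_sumpw; apply: (le_trans CK); rewrite ler_pM2l // exprM.
  apply: (@le_trans _ _ (r2 n (row j B) ^+ k)).
    by rewrite lerXn2r ?nnegrE ?r2_ge0 ?sqr_ge0.
  rewrite (bigD1 j) //= lerDl; apply: sumr_ge0 => ? _; by rewrite exprn_ge0 ?r2_ge0.
have -> : Phi 0 = ip n p p.
  rewrite /Phi linear0; congr (ip n _ _); apply/funext => x;
    by rewrite /residual sumpw0 mulr0 addr0.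
rewrite /Phi mxvecK; apply: le_trans (sph_sqr_le (hform_residual B)).
rewrite (sphD hp (hformZ _ (hform_sumpw B))) (sphZ _ (hform_sumpw B)).
have := ler_norm (sph_int n p); have := ip_ge0 p; move: big; rewrite /K.
move: (sph_int n p) `|sph_int n p| (sph_int n (sumpw B)) (ip n p p) => a a' s Y h1 h2 h3.
have h4 : 1 + Y <= s - a by lra.
have h5 : (1 + Y) ^+ 2 <= (s - a) ^+ 2 by rewrite lerXn2r ?nnegrE //; lra.
nra.
Qed.

(** More powers than the dimension are linearly dependent. Subtracting the multiple of the
    dependence that first makes a weight vanish keeps the other weights nonnegative, and their 2k-th
    roots are absorbed into the linear forms. *)
Lemma caratheodory (A : 'M[R]_(M, n)) : (Ddim n (2 * k) < M)%N ->
  exists (B : 'M[R]_(M, n)) (j0 : 'I_M), sumpw B = sumpw A /\ row j0 B = 0.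
Proof.
move=> NM; have k2 : (0 < 2 * k)%N by rewrite muln_gt0.
have [e E] := onb_exists (R := R) n0 (erefl (Ddim n (2 * k))); have [he _ es] := E.
pose L : 'M[R]_(M, Ddim n (2 * k)) := \matrix_(j, i) ip n (pw (row j A)) (e i).
have kerL : kermx L != 0.
  rewrite kermx_eq0 /row_free; apply/negP => /eqP rL.
  by have := rank_leq_col L; rewrite rL leqNgt NM.
have /rowV0Pn[u0 /sub_kermxP u0L u0n] := kerL.
have [j1 u0j] : exists j, u0 ord0 j != 0.
  by apply/existsP; apply: contraNT u0n => /existsPn H; apply/eqP/rowP => j; rewrite mxE; apply/eqP/negPn.
(* The sign is chosen so that some coefficient of the dependence is positive, and with it the
   largest one. *)
pose u := if 0 < u0 ord0 j1 then u0 else - u0.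
have uL : u *m L = 0 by rewrite /u; case: ifP => _; rewrite ?mulNmx u0L ?oppr0.
have uj : 0 < u ord0 j1.
  rewrite /u; case: ifPn => //; rewrite -leNgt => h.
  by rewrite mxE oppr_gt0 lt_def eq_sym u0j.
have dep x : \sum_j u ord0 j * pw (row j A) x = 0.
  have hs : hform (2 * k) (fun x => \sum_j u ord0 j * pw (row j A) x).
    by apply: hform_sum => j _; apply: hformZ; exact: hform_pw.
  have := congr1 (fun F => F x) (es _ hs); rewrite /= => ->.
  apply: big1 => i _.
  rewrite -[fun x => _]/(lincomb (fun j => u ord0 j) (fun j => pw (row j A))).
  rewrite (ip_lincombl _ (fun j => hform_pw (row j A)) (he i)).
  have := congr1 (fun C : 'rV_(Ddim n (2 * k)) => C ord0 i) uL; rewrite !mxE => uLi.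
  rewrite [X in X * _](_ : _ = 0) ?mul0r // -[RHS]uLi.
  by apply: eq_bigr => j _; rewrite mxE.
have [j0 _ j0max] := @arg_maxP _ R _ j1 predT (fun j => u ord0 j) isT.
have t0 : 0 < u ord0 j0 by apply: lt_le_trans uj (j0max j1 isT).
have d0 j : 0 <= 1 - u ord0 j / u ord0 j0.
  by rewrite subr_ge0 ler_pdivrMr // mul1r; exact: j0max.
pose c j := projT1 (cid2 (nth_root k2 (d0 j))).
have cE j : c j ^+ (2 * k) = 1 - u ord0 j / u ord0 j0 by rewrite /c; case: (cid2 _).
pose B : 'M[R]_(M, n) := \matrix_(j, i) (c j * A j i).
have rB j : row j B = c j *: row j A by apply/rowP => i; rewrite !mxE.
exists B, j0; split.
  apply/funext => x; rewrite /sumpw.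
  transitivity (\sum_j (pw (row j A) x - (u ord0 j0)^-1 * (u ord0 j * pw (row j A) x))).
    by apply: eq_bigr => j _; rewrite rB pwZ cE; ring.
  by rewrite sumrB -mulr_sumr dep mulr0 subr0.
rewrite rB; suff -> : c j0 = 0 by rewrite scale0r.
have := cE j0; rewrite divff ?gt_eqF // subrr => /eqP.
by rewrite expf_eq0 => /andP[_ /eqP].
Qed.

(** The first-order condition at a one-sided minimum. *)
Lemma quadratic_at0 (X Y : R) : 0 <= Y -> (forall s, 0 <= s -> 0 <= - 2 * s * X + s ^+ 2 * Y) -> X <= 0.
Proof.
move=> Y0 H; rewrite leNgt; apply/negP => X0.
have s0 : 0 < X / (Y + 1) by rewrite divr_gt0 // ltr_wpDl.
have := H _ (ltW s0); set s := X / (Y + 1).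
have XE : X = s * (Y + 1) by rewrite /s divfK // gt_eqF // ltr_wpDl.
have -> : - 2 * s * X + s ^+ 2 * Y = - (s ^+ 2 * (Y + 2)) by rewrite XE; ring.
rewrite oppr_ge0 leNgt mulr_gt0 ?exprn_gt0 //; lra.
Qed.

End DualCone.

Section DualConeCriterion.
Context {R : realType}.
Variables n k : nat.
Hypotheses (n0 : (0 < n)%N) (k0 : (0 < k)%N).

(* The residual of a nearest sum of [2k]-th powers is nonpositive on every power; the freed
   slot of [caratheodory] is what allows an arbitrary further power to be added. *)
Lemma Lf_dual (p : @fn R n) : hform (2 * k) p ->
  (forall rho, hform (2 * k) rho -> (forall a, 0 <= powT (2 * k) rho a) -> 0 <= ip n rho p) ->
  Lf n k p.
Proof.
move=> hp dual; pose M := (Ddim n (2 * k)).+1.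
have [A0 A0min] := nearest_sum_of_powers M n0 k0 hp.
have [A [j0 [AE Aj0]]] := caratheodory n0 k0 A0 (ltnSn _).
have resE : residual k p A0 = residual k p A by rewrite /residual AE.
have Amin (B : 'M[R]_(M, n)) : ip n (residual k p A) (residual k p A) <= ip n (residual k p B) (residual k p B).
  by rewrite -resE; exact: A0min.
set rho := residual k p A in Amin.
have hrho : hform (2 * k) rho by exact: hform_residual.
have hS := hform_sumpw k A.
have k2 : (0 < 2 * k)%N by rewrite muln_gt0.
(* The free slot [j0] receives the power of [b] with an arbitrary coefficient [s >= 0], which cannot
   improve the residual. *)
have polar b : ip n rho (pw k b) <= 0.
  have hb := hform_pw k b; apply: (@quadratic_at0 _ _ _ (ip_ge0 (pw k b))) => s s0.
  have [c c0 cE] := nth_root k2 s0.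
  pose B : 'M[R]_(M, n) := \matrix_(j, i) (if j == j0 then c * b ord0 i else A j i).
  have sB : residual k p B = fun x => rho x + - s * pw k b x.
    apply/funext => x; rewrite /rho /residual /sumpw (bigD1 j0) //= [in RHS](bigD1 j0) //= Aj0.
    have -> : row j0 B = c *: b by apply/rowP => i; rewrite !mxE eqxx.
    have -> : \sum_(j < M | j != j0) pw k (row j B) x = \sum_(j < M | j != j0) pw k (row j A) x.
      apply: eq_bigr => j jj0; congr (pw k _ x); apply/rowP => i.
      by rewrite !mxE (negPf jj0).
    rewrite pwZ cE -(scale0r b) pwZ expr0n gtn_eqF // mul0r; ring.
  have := Amin B; rewrite sB (ip_residual_sub hrho hb) -subr_ge0.
  by congr (_ <= _); ring.
have tight : 0 <= ip n rho (sumpw k A).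
  rewrite leNgt; apply/negP => X0.
  have Y0 := ip_ge0 (sumpw k A); move: (ip_residual_sub hrho hS) X0 Y0.
  set X := ip n rho (sumpw k A); set Y := ip n (sumpw k A) (sumpw k A) => XY X0 Y0.
  (* A small contraction of the sum of powers would improve the residual. This [w] lies in (0, 1)
     and gives 2X + wY = X - w + wX < 0. *)
  pose w := - X / (Y + 1 - X).
  have den : 0 < Y + 1 - X by lra.
  have w0 : 0 < w by rewrite divr_gt0 // oppr_gt0.
  have w1 : 0 <= 1 - w by rewrite subr_ge0 ler_pdivrMr // mul1r; lra.
  have [c c0 cE] := nth_root k2 w1.
  have sB : residual k p (c *: A) = fun x => rho x + - - w * sumpw k A x.
    apply/funext => x; rewrite /rho /residual.
    have -> : sumpw k (c *: A) x = (1 - w) * sumpw k A x.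
      rewrite /sumpw mulr_sumr; apply: eq_bigr => j _.
      by rewrite linearZ /= pwZ cE.
    ring.
  have wE : w * (Y + 1 - X) = - X by rewrite /w divfK // gt_eqF.
  have wX : w * X < 0 by rewrite pmulr_rlt0.
  have := Amin (c *: A); rewrite sB XY.
  have -> : ip n rho rho - 2 * - w * X + (- w) ^+ 2 * Y = ip n rho rho + w * (2 * X + w * Y) by ring.
  rewrite lerDl pmulr_rge0 //; move: wE; rewrite !mulrDr mulr1 mulrN; lra.
(* The opposite of [rho] is nonnegative on powers, so <rho,p> <= 0; but p is [rho] plus the sum of
   powers, whose product with [rho] is nonnegative by [tight]. *)
have rho0 : ip n rho rho = 0.
  have hN := hformZ (-1) hrho.
  have : 0 <= ip n (fun x => -1 * rho x) p.
    apply: dual => // a; rewrite /powT (ipZr _ hrho (hform_dotpX a (2 * k))) mulN1r oppr_ge0.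
    by rewrite ipC; exact: polar.
  have pE : p = fun x => rho x + sumpw k A x.
    by apply/funext => x; rewrite /rho /residual mulN1r subrK.
  rewrite {1}pE (ipDr hrho hS hN) (ipZl _ hrho hrho) (ipZl _ hrho hS).
  by have := ip_ge0 rho; lra.
have rE := ip_definite n0 hrho rho0.
exists M, (fun j => row j A); apply/funext => x.
have := congr1 (fun F => F x) rE; rewrite /rho /residual mulN1r => /eqP.
by rewrite subr_eq0 => /eqP ->.
Qed.

End DualConeCriterion.

Section Symmetry.
Context {R : realType}.
Variables n k : nat.
Hypotheses (n2 : (2 <= n)%N) (k0 : (0 < k)%N).
Let n0 : (0 < n)%N. Proof. exact: ltnW. Qed.
Let g0 : 0 < gam n 0 k :> R. Proof. exact: gam_gt0. Qed.
Let N1 : (0 : R) < (Ddim n k)%:R - 1.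
Proof. by rewrite subr_gt0 ltr1n; exact: Ddim_ge2. Qed.

Lemma nonneg_form_le_homog (G : @fn R n) a : hform (2 * k) G -> (forall x, 0 <= G x) ->
  G a <= (Ddim n k)%:R * sph_int n G * r2 n a ^+ k.
Proof.
move=> hG G0; rewrite (hform_sph a hG).
have [a0|a0] := eqVneq (r2 n a) 0; first by rewrite a0 expr0n gtn_eqF // mul0r mulr0.
rewrite mulrC ler_wpM2r ?exprn_ge0 ?r2_ge0 //; apply: nonneg_form_le => //.
exact: r2_sph_proj.
Qed.

Lemma sph_powT (f : @fn R n) : hform (2 * k) f ->
  sph_int n (powT (2 * k) f) = gam n 0 k * sph_int n f.
Proof.
move=> hf; rewrite -(sph_avgT n0 hf) /avgT (sphZ _ (hform_powT hf)) mulrA mulfV ?mul1r //.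
by rewrite gt_eqF.
Qed.

Lemma ip_pw (f : @fn R n) a : ip n f (pw k a) = powT (2 * k) f a.
Proof. exact: ipC. Qed.

(** The reflected form is (1+b) r^(2k) - b f. Its product with a test form [rho] is (1+b) s - b X,
    where s is the mean of [rho] and X = <rho,f>. The bound on nonnegative forms, applied to [powT]
    of [rho], gives X <= N s with N = D(n,k); the choice of b is exactly 1 + b = b N. *)
Lemma sym_ok_Lfbar : sym_ok n (Lfbar n k) (rpow n k) (1 / ((Ddim n k)%:R - 1) : R).
Proof.
move=> f [[M [a fE]] [/is_formP hf f1]]; set b := 1 / _.
have fE' : f = fun x => \sum_(j < M) pw k (a j) x by [].
have hr := hform_rpow (R := R) n k.
have -> : (fun x => rpow n k x - b * (f x - rpow n k x)) =
    fun x : 'rV[R]_n => (1 + b) * rpow n k x + - b * f x.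
  by apply/funext => x; ring.
have h1 := hformZ (1 + b) hr; have h2 := hformZ (- b) hf; have hp := hformD h1 h2.
have b0 : 0 <= b by rewrite /b mul1r invr_ge0 ltW.
have bN : b * ((Ddim n k)%:R - 1) = 1 by rewrite /b mul1r mulVf // gt_eqF.
split; last first.
  split; first exact/is_formP.
  by rewrite (sphD h1 h2) (sphZ _ hr) (sphZ _ hf) (sph_rpow k n0) f1; ring.
apply: (Lf_dual n0 k0 hp) => rho hrho rho0.
have hG := hform_powT hrho.
have mass : gam n 0 k * \sum_(j < M) r2 n (a j) ^+ k = 1.
  rewrite -f1 fE' (sph_sum _ (fun j _ => hform_pw k (a j))) mulr_sumr; apply: eq_bigr => j _.
  by rewrite sph_dotpX.
have rf : ip n rho f <= (Ddim n k)%:R * sph_int n rho.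
  rewrite fE' (ip_sumr _ (fun j => hform_pw k (a j)) hrho).
  under eq_bigr do rewrite ip_pw.
  apply: (@le_trans _ _ (\sum_(j < M) (Ddim n k)%:R * sph_int n (powT (2 * k) rho) * r2 n (a j) ^+ k)).
    by apply: ler_sum => j _; exact: nonneg_form_le_homog.
  rewrite -mulr_sumr sph_powT // -[leRHS]mulr1 -mass; apply: eq_ler; ring.
rewrite (ipDr h1 h2 hrho) (ipZr _ hr hrho) (ipZr _ hf hrho) (ip_rpow k n0 hrho).
have := ler_wpM2l b0 rf; move: bN; move: (ip n rho f) (sph_int n rho) (Ddim n k)%:R => X s N bN' h.
have -> : (1 + b) * s + - b * X = b * (N * s) - b * X + (1 - b * (N - 1)) * s by ring.
by rewrite bN' subrr mul0r addr0 subr_ge0.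
Qed.

(* The extremal nonnegative form is the square of the reproducing kernel at [v]. *)
Lemma sym_ok_le b' : sym_ok n (Lfbar n k) (rpow n k) b' -> b' <= 1 / ((Ddim n k)%:R - 1) :> R.
Proof.
move=> sym; pose v : 'rV[R]_n := ebasis n (Ordinal n0).
have v1 : r2 n v = 1.
  rewrite /r2 (bigD1 (Ordinal n0)) //= big1 ?addr0 => [|i /negPf i0]; rewrite !mxE eqxx /=.
    exact: expr1n.
  by rewrite i0 expr0n.
have [e E] := onb_exists (R := R) n0 (erefl (Ddim n k)); have [he eo es] := E.
pose q := lincomb (fun i => e i v) e.
have hq : hform k q := hform_lincomb _ he.
pose G : @fn R n := fun x => q x * q x.
have hG : hform (2 * k) G by rewrite mul2n -addnn; exact (hformM hq hq).
have qv : q v = (Ddim n k)%:R.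
  by rewrite -(onb_kernel n0 E v1); apply: eq_bigr => i _; rewrite expr2.
have sG : sph_int n G = (Ddim n k)%:R.
  rewrite -/(ip n q q) (onb_parseval E hq hq) -(onb_kernel n0 E v1); apply: eq_bigr => i _.
  by rewrite /q (onb_coord _ _ E) expr2.
(* Pulling [G] back through [avgT] gives a functional whose values on powers of linear forms are
   those of [G] up to a positive constant. *)
have [h hh GE] := avgT_surj n0 hG.
have sh : sph_int n h = (Ddim n k)%:R by rewrite -sG GE (sph_avgT n0 hh).
have [[M [a pE]] _] := sym _ (power_in_Lfbar n2 k0 v1).
have hr := hform_rpow (R := R) n k.
pose u : @fn R n := fun x => (gam n 0 k)^-1 * dotp v x ^+ (2 * k).
have hu : hform (2 * k) u by exact (hformZ _ (hform_dotpX v (2 * k))).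
have hu' : ip n h u = (Ddim n k)%:R ^+ 2.
  have Gv : G v = (Ddim n k)%:R ^+ 2 by rewrite /G qv expr2.
  rewrite -Gv GE /avgT /u (ipZr _ (hform_dotpX v (2 * k)) hh); congr (_ * _).
  exact: ip_pw.
have pE' : (fun x => (1 + b') * rpow n k x + - b' * u x) = fun x => \sum_(j < M) pw k (a j) x.
  transitivity (fun x : 'rV[R]_n => rpow n k x - b' * (u x - rpow n k x)); last exact: pE.
  by apply/funext => x; ring.
have pos : 0 <= ip n h (fun x => (1 + b') * rpow n k x + - b' * u x).
  rewrite pE' (ip_sumr _ (fun j => hform_pw k (a j)) hh); apply: sumr_ge0 => j _.
  have -> : ip n h (pw k (a j)) = gam n 0 k * G (a j).
    by rewrite ip_pw GE /avgT mulrA mulfV ?mul1r // gt_eqF.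
  apply: mulr_ge0; first exact: ltW.
  by rewrite /G -expr2 sqr_ge0.
(* With N = D(n,k) the inequality reads (1 + b') N - b' N^2 >= 0, that is b' (N - 1) <= 1. *)
move: pos; rewrite (ipDr (hformZ _ hr) (hformZ _ hu) hh) (ipZr _ hr hh) (ipZr _ hu hh).
rewrite (ip_rpow k n0 hh) sh hu' ler_pdivlMr // => pos.
have NN : 0 < (Ddim n k)%:R :> R by move: N1; lra.
rewrite -subr_ge0 -(pmulr_rge0 _ NN); move: pos; congr (_ <= _); ring.
Qed.

Theorem coeff_symmetry_Lfbar :
  coeff_symmetry n (Lfbar n k) (rpow n k) (1 / ((Ddim n k)%:R - 1) : R).
Proof. by split; [exact: sym_ok_Lfbar | exact: sym_ok_le]. Qed.

End Symmetry.

Theorem theorem7p7 (R : realType) (n k : nat) (hn : (2 <= n)%N) (hk : (1 <= k)%N) :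
  @loewner_ellipsoid R n k (Lfbar n k) (loewner_target n k) /\
  @coeff_symmetry R n (Lfbar n k) (rpow n k) (1 / ((Ddim n k)%:R - 1)).
Proof. by split; [exact: loewner_ellipsoid_Lfbar | exact: coeff_symmetry_Lfbar]. Qed.
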